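(* The coupled energy $\mathcal{E}_{bv}\{y\}=\sum_{\eta\in R}\mathcal{E}_\eta\{y\}$ based on bond volumes (defined in the context) is free of ghost forces: for every constant $3\times3$ matrix $\mathsf F$ with $\det \mathsf F>0$, with $y_F(x)=\mathsf F x$, $$\langle D\mathcal{E}_{bv}(y_F),v\rangle=0\qquad\text{for all } v\in\mathscr V .$$
   Context: Lattice and domain. $\varepsilon=1/k$ with $k$ a positive integer; $x_\ell=\varepsilon\ell$ for $\ell\in\mathbb{Z}^3$; $e_1,e_2,e_3$ is the standard basis of $\mathbb R^3$. For positive integers $M_1,M_2,M_3$, $\Omega=\prod_{i=1}^3[-M_i+1,M_i]$ and $\mathfrak L=\mathbb{Z}^3\cap\frac1\varepsilon\Omega$. $\mathscr V$ is the space of lattice functions $v:\mathfrak L\to\mathbb{R}^3$, $v_\ell=v(x_\ell)$, that are periodic with basic period $\Omega$ (values at corresponding points of opposite faces of $\Omega$ coincide) and have zero average over a period. Deformations are $y_\ell=\mathsf F x_\ell+v_\ell$, $v\in\mathscr V$. $\overline D_\eta y_\ell=(y_{\ell+\eta}-y_\ell)/\varepsilon$. Potentials. $R\subset\mathbb{Z}^3$ is a finite set of interaction vectors $\eta=(\eta_1,\eta_2,\eta_3)$ with $\eta_1\eta_2\eta_3\neq0$; for each $\eta\in R$, $\phi_\eta:\mathbb{R}^3\to\mathbb{R}$ is a sufficiently smooth function (e.g. $C^2$). Bond volumes and type A decompositions. For $\eta_1\eta_2\eta_3\ne0$, $B_{\ell,\eta}$ is the interior of the rectangular parallelepiped with edges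 parallel to the $e_i$ and main diagonal from $x_\ell$ to $x_{\ell+\eta}$. Its type A decomposition is the decomposition into six tetrahedra whose edges are the edges of $B_{\ell,\eta}$, the main diagonal from $x_\ell$ to $x_{\ell+\eta}$, and the face diagonals starting at $x_\ell$ or at $x_{\ell+\eta}$. The lattice cells are $K_\ell=x_\ell+(0,\varepsilon)^3$; the type A decomposition of $K_\ell$ is that of $B_{\ell,(1,1,1)}=K_\ell$. $\mathcal T_T$ is the set of all (open) tetrahedra of the type A decompositions of all cells $K_\ell\subset\Omega$. A lattice tetrahedron is a tetrahedron with vertices in $\varepsilon\mathbb{Z}^3$. Regions. $\Omega_a$ (atomistic) and $\Omega_*$ (atomistic Cauchy–Born) are disjoint, connected, and each is the interior of the closure of a union of tetrahedra of $\mathcal T_T$; $\Omega=\overline\Omega_a\cup\overline\Omega_*$ and $\Gamma=\overline\Omega_a\cap\overline\Omega_*$. $\overline\Omega_a$ lies in the interior of $\Omega$ at sufficient distance from $\partial\Omega$, so that every closed bond volume $\overline B_{\ell,\eta}$, $\eta\in R$, meeting $\overline\Omega_a$ is contained in the interior of $\Omega$. For each $\eta\in R$ every bond volume is of one of three types: (a) $\overline B_{\ell,\eta}\subset\Omega_a$; (b) $B_{\ell,\eta}\subset\Omega_*$ (bond volumes meeting $\partial\Omega$ are regarded as being of this type, by periodic extension); (c) $B_{\ell,\eta}\in B_\Gamma$, the set of bond volumes satisfying neither (a) nor (b). Interpolants. For a lattice function $y$, $\overline y$ is the continuous function on $\overline\Omega_*$ that is affine on each $T\in\mathcal T_T$,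 $T\subset\Omega_*$, with $\overline y(x_\ell)=y_\ell$ at the vertices. For each $B_{\ell,\eta}\in B_\Gamma$ a decomposition $\mathcal T(B_{\ell,\eta})$ of $B_{\ell,\eta}$ into tetrahedra, each contained in $\Omega_a$ or in $\Omega_*$, and a function $y^{\ell,\eta}$ are fixed such that: (i) $y^{\ell,\eta}\in C(\overline B_{\ell,\eta})$; (ii) if $T\in\mathcal T(B_{\ell,\eta})$ and $T\subset\Omega_*$ then $T$ is a tetrahedron of the type A decomposition of a lattice cell; if $T\subset\Omega_a$ then $T$ is a lattice tetrahedron; (iii) if $T\in\mathcal T(B_{\ell,\eta})$, $T\subset\Omega_a$, has a face on $\partial(B_{\ell,\eta}\cap\Omega_a)\setminus\Gamma$, then it is part of a conforming decomposition compatible with the decompositions of the other bond volumes sharing a face with $B_{\ell,\eta}$, where bond volumes of type (a) are type A decomposed; (iv) on each $T\in\mathcal T(B_{\ell,\eta})$, $y^{\ell,\eta}$ is affine and interpolates $\{y_\ell\}$ at the vertices of $T$. Coverings and conformity requirement. For fixed $\eta$ there are $|\eta_1\eta_2\eta_3|$ coverings $\mathcal S^m_{B_\eta}$, $m=1,\dots,|\eta_1\eta_2\eta_3|$, of $\mathbb{R}^3$ by non-overlapping bond volumes: one for each coset of $\eta_1\mathbb{Z}\times\eta_2\mathbb{Z}\times\eta_3\mathbb{Z}$ in $\mathbb{Z}^3$, consisting of the $B_{\ell,\eta}$ with $\ell$ in that coset. For a lattice function $v\in\mathscr V$ define $v^{[m]}$ on $\Omega$ by: on $B_{\ell,\eta}\in\mathcal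 S^m_{B_\eta}$ of type (a), $v^{[m]}$ is the piecewise affine interpolant of $\{v_\ell\}$ on the type A decomposition of $B_{\ell,\eta}$; on $B_{\ell,\eta}\in\mathcal S^m_{B_\eta}\cap B_\Gamma$, $v^{[m]}=v^{\ell,\eta}$ (constructed from $v$ as $y^{\ell,\eta}$ from $y$); on bond volumes of type (b), $v^{[m]}=\overline v$. The decompositions $\mathcal T(B_{\ell,\eta})$ are chosen so that $v^{[m]}\in H^1(\Omega)$ for every $\eta\in R$, every $m$ and every $v\in\mathscr V$. Energy. $\mathcal E_{\eta}\{y\}=E^a_{\Omega_a,\eta}\{y\}+E^{a,cb}_{\Omega_*,\eta}\{y\}+E_{\Gamma,\eta}\{y\}$, where $$E^a_{\Omega_a,\eta}\{y\}=\varepsilon^3\sum_{\ell\in\mathfrak L,\ \overline B_{\ell,\eta}\subset\Omega_a}\phi_\eta(\overline D_\eta y_\ell),\qquad E^{a,cb}_{\Omega_*,\eta}\{y\}=\int_{\Omega_*}\phi_\eta(\nabla\overline y(x)\eta)\,dx=\frac{\varepsilon^3}{6}\sum_{T\in\mathcal T_T,\ T\subset\Omega_*}\phi_\eta(\nabla\overline y|_T\,\eta),$$ $$E_{\Gamma,\eta}\{y\}=\sum_{\ell\in\mathfrak L,\ B_{\ell,\eta}\in B_\Gamma}\frac{1}{|\eta_1\eta_2\eta_3|}\int_{B_{\ell,\eta}}\chi_{\Omega_a}\,\phi_\eta(\nabla y^{\ell,\eta}\eta)\,dx,$$ with $\chi_{\Omega_a}$ the characteristic function of $\Omega_a$. Finally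 $\langle D\mathcal E_{bv}(y),v\rangle=\frac{d}{dt}\mathcal E_{bv}\{y+tv\}\big|_{t=0}$, and $y_F$ is identified with its lattice values $\mathsf F x_\ell$. *)

(* Defs.v *)
From HB Require Import structures.
From mathcomp Require Import all_boot all_order all_algebra all_fingroup.
From mathcomp Require Import finmap.
From mathcomp Require Import all_classical all_reals all_analysis.

Set Implicit Arguments.
Unset Strict Implicit.
Unset Printing Implicit Defensive.

Import Order.TTheory GRing.Theory Num.Theory.
Import numFieldNormedType.Exports.

Local Open Scope classical_set_scope.
Local Open Scope ring_scope.

Notation site := 'cV[int]_3.

Section Analysis.
Context {R : realType}.
Local Notation pt := 'cV[R]_3.

Definition bdry (A : set pt) : set pt := closure A `\` A°.

Definition pt_of (z : R * R * R) : pt :=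
  \col_i tnth [tuple z.1.1; z.1.2; z.2] i.

(* R carries its Borel sigma-algebra through measurableTypeR R, the domain of
   lebesgue_measure. *)
Local Notation B := (measurableTypeR R).

Definition lebesgue3 : {measure set (B * B * B) -> \bar R} :=
  ((@lebesgue_measure R \x @lebesgue_measure R) \x @lebesgue_measure R)%E.

Definition int3 (A : set pt) (f : pt -> R) : R :=
  Rintegral lebesgue3 (pt_of @^-1` A) (f \o pt_of).

Fixpoint Cn (n : nat) (f : pt -> R) : Prop :=
  if n is n'.+1 then
    (forall x : pt, differentiable f x) /\
    (forall u : pt, Cn n' (fun x : pt => 'D_u f x))
  else continuous f.

Definition test_fun (U : set pt) (psi : pt -> R) : Prop :=
  (forall n, Cn n psi) /\
  exists K : set pt, [/\ compact K, K `<=` U & forall x, ~ K x -> psi x = 0].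

Definition in_L2 (U : set pt) (f : pt -> R) : Prop :=
  (f \o pt_of) \_ (pt_of @^-1` U) \in Lfun lebesgue3 2%:E.

Definition in_H1 (U : set pt) (f : pt -> R) : Prop :=
  in_L2 U f /\
  forall i : 'I_3, exists g : pt -> R, in_L2 U g /\
    forall psi, test_fun U psi ->
      int3 U (fun x => f x * 'D_(delta_mx i 0 : pt) psi x) =
      - int3 U (fun x => g x * psi x).

End Analysis.

Section Tetrahedra.
Context {R : realType}.
Local Notation pt := 'cV[R]_3.
Local Notation tet := ('I_4 -> 'cV[R]_3).

(* Relatively open and closed faces of T, spanned by the vertices T i with
   i \in I. *)
Definition oface (T : tet) (I : pred 'I_4) : set pt :=
  [set x | exists w : 'I_4 -> R,
    [/\ forall i, if I i then 0 < w i else w i == 0,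
        \sum_i w i = 1 & x = \sum_i w i *: T i]].

Definition cface (T : tet) (I : pred 'I_4) : set pt :=
  [set x | exists w : 'I_4 -> R,
    [/\ forall i, if I i then 0 <= w i else w i == 0,
        \sum_i w i = 1 & x = \sum_i w i *: T i]].

Definition tetra (T : tet) : set pt := oface T predT.

Definition nondegenerate (T : tet) : Prop :=
  \det (\matrix_(i < 3, j < 3) (T (lift ord0 j) - T ord0) i 0) != 0.

(* The intersection of the closed tetrahedra is a common face; I = pred0
   gives the empty set. *)
Definition conforming (T T' : tet) : Prop :=
  exists I I' : pred 'I_4,
    cface T predT `&` cface T' predT = cface T I /\
    cface T I = cface T' I'.

Definition tet_decomposition (D : set tet) (B : set pt) : Prop :=
  [/\ finite_set D,
      forall T, D T -> nondegenerate T /\ tetra T `<=` B,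
      trivIset D tetra &
      \bigcup_(T in D) closure (tetra T) = closure B].

End Tetrahedra.

Section Lattice.
Context {R : realType}.
Variables (k : nat) (M : 'I_3 -> nat).
Local Notation pt := 'cV[R]_3.
Local Notation tet := ('I_4 -> 'cV[R]_3).

Definition real_vec (l : site) : pt := map_mx intr l.

Definition eps : R := k%:R^-1.

Definition xl (l : site) : pt := eps *: real_vec l.

Definition Omega : set pt :=
  [set x : pt | forall i, 1 - (M i)%:R <= x i 0 <= (M i)%:R].

Definition lat : set site := [set l | Omega (xl l)].

(* Lattice functions are taken on all of Z^3, by periodic extension; Omega has
   side lengths 2 * M i - 1. *)
Definition lat_periodic (v : site -> pt) : Prop :=
  forall (i : 'I_3) (l : site),
    v (l + (k%:Z * (2 * (M i)%:Z - 1)) *: delta_mx i 0) = v l.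

(* Exactly one representative of each lattice point modulo periods: opposite
   faces of Omega are not counted twice. *)
Definition period_cell : set site :=
  [set l | forall i, 1 - (M i)%:R <= xl l i 0 < (M i)%:R].

Definition in_V (v : site -> pt) : Prop :=
  lat_periodic v /\ \sum_(l \in period_cell) v l = 0.

(* Taking F = 0 shows that elements of V are themselves deformations. *)
Definition deformation (y : site -> pt) : Prop :=
  exists (F : 'M[R]_3) (v : site -> pt),
    in_V v /\ forall l, y l = F *m xl l + v l.

Definition bond (l eta : site) : set pt :=
  [set x : pt | forall i, Num.min (xl l i 0) (xl (l + eta) i 0) < x i 0
                     < Num.max (xl l i 0) (xl (l + eta) i 0)].

(* The tetrahedra having the main diagonal as an edge and only face diagonals
   issued from x_l or x_(l + eta) are the six whose vertices form an edge path
   from x_l to x_(l + eta); along the path indexed by s, the coordinate i is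
   the (s i)-th one to be switched. *)
Definition typeA (l eta : site) (s : 'S_3) : tet :=
  fun j => xl (\col_i (l i 0 + (if (s i < j)%N then eta i 0 else 0))).

Definition cell (l : site) : set pt := bond l (const_mx 1).

Definition cell_tet (l : site) (s : 'S_3) : tet := typeA l (const_mx 1) s.

Definition TT : set tet :=
  [set T | exists (l : site) (s : 'S_3),
     cell l `<=` Omega /\ T = cell_tet l s].

Definition region (O : set pt) : Prop :=
  exists S : set tet, S `<=` TT /\ O = (closure (\bigcup_(T in S) tetra T))°.

Definition affine_interp (y : site -> pt) (T : tet) (f : pt -> pt) : Prop :=
  exists (A : 'M[R]_3) (b : pt),
    (forall x, tetra T x -> f x = A *m x + b) /\
    (forall i l, T i = xl l -> A *m T i + b = y l).

Definition Dbar (eta : site) (y : site -> pt) (l : site) : pt :=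
  eps^-1 *: (y (l + eta) - y l).

End Lattice.

Arguments lat R k M l : clear implicits, rename.
Arguments bond R k l eta : clear implicits, rename.

Section Coupling.
Context {R : realType}.
Variables (k : nat) (M : 'I_3 -> nat).
Variables Oa Os : set 'cV[R]_3.
Local Notation pt := 'cV[R]_3.
Local Notation tet := ('I_4 -> 'cV[R]_3).
Local Notation Om := (@Omega R M).
Local Notation bond := (bond R k).

Definition bond_a (l eta : site) : Prop := closure (bond l eta) `<=` Oa.

(* By periodic extension, bond volumes reaching the boundary of Omega count as
   lying in the Cauchy-Born region. *)
Definition bond_b (l eta : site) : Prop :=
  bond l eta `<=` Os \/ closure (bond l eta) `&` bdry Om !=set0.

Definition bond_G (l eta : site) : Prop :=
  [/\ lat R k M l, ~ bond_a l eta & ~ bond_b l eta].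

Definition interface : set pt := closure Oa `&` closure Os.

Definition is_overline (y : site -> pt) (f : pt -> pt) : Prop :=
  {within closure Os, continuous f} /\
  forall T, TT k M T -> tetra T `<=` Os -> affine_interp k y T f.

(* D l eta is only meaningful for bond volumes in B_Gamma: those of type (a)
   always carry their type A decomposition. *)
Variable D : site -> site -> set tet.

Definition decomp_near_a (l eta : site) : set tet :=
  [set T | (bond_G l eta /\ D l eta T) \/
           (bond_a l eta /\ exists s, T = typeA k l eta s)].

Definition same_or_face_neighbour (eta l l' : site) : Prop :=
  l' = l \/ exists i : 'I_3,
    l' = l + eta i 0 *: delta_mx i 0 \/ l' = l - eta i 0 *: delta_mx i 0.

Definition compatible (l eta : site) (T : tet) : Prop :=
  forall l' T', same_or_face_neighbour eta l l' ->
    decomp_near_a l' eta T' -> tetra T' `<=` Oa -> conforming T T'.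

Record admissible_decomposition (l eta : site) : Prop := {
  dec_bond : tet_decomposition (D l eta) (bond l eta);
  dec_side : forall T, D l eta T -> tetra T `<=` Oa \/ tetra T `<=` Os;
  dec_cb : forall T, D l eta T -> tetra T `<=` Os ->
    exists l' s, range T = range (cell_tet (R := R) k l' s);
  dec_atom : forall T, D l eta T -> tetra T `<=` Oa ->
    range T `<=` range (xl (R := R) k);
  dec_conf : forall T (i : 'I_4), D l eta T -> tetra T `<=` Oa ->
    oface T (predC1 i) `<=` bdry (bond l eta `&` Oa) `\` interface ->
    compatible l eta T }.

Definition is_bond_interp (l eta : site) (y : site -> pt) (f : pt -> pt) :
    Prop :=
  {within closure (bond l eta), continuous f} /\
  forall T, D l eta T -> affine_interp k y T f.

(* ybar y and yint l eta y stand for overline y and y^{l,eta}. *)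
Variable ybar : (site -> pt) -> pt -> pt.
Variable yint : site -> site -> (site -> pt) -> pt -> pt.

Definition in_coset (eta r l : site) : Prop :=
  forall i, (eta i 0%R %| l i 0%R - r i 0%R)%Z.

(* w is v^[m], m being the coset of r; the values of v^[m] on the boundaries of
   the bond volumes and of the tetrahedra, a null set, are left free. *)
Definition is_vm (eta r : site) (v : site -> pt) (w : pt -> pt) : Prop :=
  forall l, in_coset eta r l ->
    [/\ bond_a l eta -> forall s, affine_interp k v (typeA k l eta s) w,
        bond_G l eta -> forall x, bond l eta x -> w x = yint l eta v x &
        bond_b l eta ->
          forall x, bond l eta x -> Om x -> w x = ybar v x].

Definition vm_in_H1 (eta r : site) (v : site -> pt) : Prop :=
  exists w, is_vm eta r v w /\ forall c : 'I_3, in_H1 Om° (fun x => w x c 0).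

Variable bonds : {fset site}.
Variable phi : site -> pt -> R.

Definition E_atom (eta : site) (y : site -> pt) : R :=
  eps k ^+ 3 *
  \sum_(l \in [set l | lat R k M l /\ bond_a l eta])
     phi eta (Dbar k eta y l).

Definition E_cb (eta : site) (y : site -> pt) : R :=
  int3 Os (fun x => phi eta ('d (ybar y) x (real_vec eta))).

Definition E_interface (eta : site) (y : site -> pt) : R :=
  \sum_(l \in [set l | bond_G l eta])
     (`|\prod_i eta i 0|%:~R)^-1 *
     int3 (bond l eta)
       (fun x => \1_Oa x * phi eta ('d (yint l eta y) x (real_vec eta))).

Definition E_bv (y : site -> pt) : R :=
  \sum_(eta <- bonds) (E_atom eta y + E_cb eta y + E_interface eta y).

End Coupling.

(* Main.v *)
Require Import Defs.
From HB Require Import structures.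
From mathcomp Require Import all_boot all_order all_algebra all_fingroup.
From mathcomp Require Import finmap.
From mathcomp Require Import all_classical all_reals all_analysis.
From mathcomp Require Import measurable_realfun.
From mathcomp Require Import zify ring lra.

Set Implicit Arguments.
Unset Strict Implicit.
Unset Printing Implicit Defensive.

Import Order.TTheory GRing.Theory Num.Theory.
Import numFieldNormedType.Exports.

Local Open Scope classical_set_scope.
Local Open Scope ring_scope.

(** At the affine state the argument of the potential is the constant F eta in
   each of the three parts of the energy.  The derivative in the direction v is
   therefore the differential of the potential at F eta, a linear form, applied
   to a sum of gradients of interpolants of v along eta.  Let N be the number of
   coverings by bond volumes.

   The main diagonal of a bond volume is an edge of each of the six tetrahedra
   of its type A decomposition; the piecewise affine interpolant has thus the
   constant derivative [Dbar] along eta ([typeA_edge]), and a purely atomistic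
   bond contributes 1/N times the integral of the gradient of the interpolant
   over its bond volume, the volume of which is N eps^3.  The derivative of the
   energy is now written with integrals only.  A bond volume belongs to exactly
   one covering, and the Cauchy-Born region is seen by all of them; so N times
   the derivative is the sum over the coverings of the integrals over Omega of
   the gradient, defined almost everywhere, of the functions v^[m] along eta
   ([coverings_identity]).

   Each of these N integrals vanishes ([coset_identity]).  As v^[m] is in H^1,
   it has a weak gradient g, without singular part on the interfaces between
   the pieces: testing with a partition of unity subordinate to the pieces shows
   that g has the same integral as the gradient computed piece by piece
   ([weak_derivative_pieces]).  In the Cauchy-Born region, in particular near
   the boundary of Omega, v^[m] is the continuous periodic interpolant V of v on
   the type A decompositions of the lattice cells ([vm_interpolant_Os]).  For a
   cutoff psi equal to 1 on the atomistic region and compactly supported in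
   Omega, the integral of g psi is minus that of V times the gradient of psi; as
   V (1 - psi) takes the same values on opposite faces, its gradient has mean
   zero, and the integral of g psi is minus that of (1 - psi) times the gradient
   of V.  When psi tends to 1, the former tends to the integral of g and the
   latter to 0 ([weak_derivative_mean0]).

   For test functions an explicit class suffices, generated by affine functions
   and exp (- 1 / t) ([smooth]); and mean zero of the gradient of a function with
   equal values on opposite faces is a matter of translating difference
   quotients and of dominated convergence ([integ_derive_box]).  The
   decompositions determine all the integrands only up to null sets, which is
   harmless even for functions whose measurability is unknown
   ([ae_eq_integral_arbitrary]). *)

(** * Integration without measurability, translations *)

Section ArbitraryIntegrands.
Local Open Scope ereal_scope.
Context d (T : measurableType d) (R : realType).
Variable mu : {measure set T -> \bar R}.

Import HBNNSimple.

Let ge0_integral_le_ae (f g : T -> \bar R) :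
  (forall x, 0 <= f x) -> (forall x, 0 <= g x) ->
  {ae mu, forall x, f x = g x} -> \int[mu]_x f x <= \int[mu]_x g x.
Proof.
move=> f0 g0 [N [mN N0 fgN]]; rewrite !ge0_integralTE//=.
apply: ge_ereal_sup => _ [h /= hf <-].
(* Multiplying a simple function below [f] by the indicator of the complement
   of [N] puts it below [g] without changing its integral. *)
have mNC : measurable (~` N) by exact: measurableC.
rewrite -integralT_nnsfun.
have -> : \int[mu]_x (h x)%:E = \int[mu]_x (proj_nnsfun h mNC x)%:E.
  apply: ae_eq_integral => //.
  - by apply/measurable_EFinP.
  - exact/measurable_EFinP/(@measurable_funPT _ _ _ _ (proj_nnsfun h mNC)).
  - exists N; split => // x /= /not_implyP [_ hx].
    apply: contra_notP hx => Nx /=.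
    by rewrite mindicE mem_set ?mulr1.
rewrite integralT_nnsfun; apply: ereal_sup_ubound; exists (proj_nnsfun h mNC) => //.
move=> x /=; rewrite mindicE; case: (asboolP ((~` N) x)) => Nx.
  rewrite mem_set// mulr1; apply: (le_trans (hf x)).
  suff -> : f x = g x by [].
  by apply: contrapT => fgx; apply: Nx; exact: fgN.
by rewrite memNset// mulr0.
Qed.

(** Integrals are suprema of integrals of simple functions, and so do not see
   null sets even when the integrand fails to be measurable. *)
Lemma ae_eq_integral_arbitrary (f g : T -> \bar R) :
  {ae mu, forall x, f x = g x} -> \int[mu]_x f x = \int[mu]_x g x.
Proof.
move=> fg; rewrite integralE [RHS]integralE.
have gf : {ae mu, forall x, g x = f x} by apply: filterS fg => x ->.
congr (_ - _); apply/eqP; rewrite eq_le; apply/andP; split;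
  apply: ge0_integral_le_ae => //.
- by apply: filterS fg => x h; rewrite !funeposE h.
- by apply: filterS gf => x h; rewrite !funeposE h.
- by apply: filterS fg => x h; rewrite !funenegE h.
- by apply: filterS gf => x h; rewrite !funenegE h.
Qed.

End ArbitraryIntegrands.

Section Lebesgue3.
Context {R : realType}.
Local Notation B := (measurableTypeR R).
Local Notation pt := 'cV[R]_3.
Local Notation leb := (@lebesgue_measure R).

Definition shift1 (h : R) : B -> B := fun x => x + h.

Lemma measurable_shift1 h : measurable_fun setT (shift1 h).
Proof. exact: measurable_funD. Qed.

HB.instance Definition _ h :=
  isMeasurableFun.Build _ _ _ _ (shift1 h) (measurable_shift1 h).

Lemma lebesgue_measure_shift (h : R) (A : set B) : measurable A ->
  leb (shift1 h @^-1` A) = leb A.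
Proof.
move=> mA; rewrite -[LHS]/(pushforward leb (shift1 h) A).
apply/esym/lebesgue_measure_unique => //= _ [[a b] /= _ <-].
rewrite /pushforward /=.
have -> : shift1 h @^-1` `]a, b]%classic = `](a - h), (b - h)]%classic.
  by apply/seteqP; split => x /=; rewrite !in_itv/= ltrBlDr lerBrDr.
by rewrite !lebesgue_measure_itv/= !lte_fin ltrD2r -!EFinB opprB addrA subrK.
Qed.

Definition shift2 (h : B * B) (z : B * B) : B * B :=
  (shift1 h.1 z.1, shift1 h.2 z.2).

Lemma measurable_shift2 h : measurable_fun setT (shift2 h).
Proof.
by apply: measurable_fun_pair => /=; apply: measurableT_comp.
Qed.

HB.instance Definition _ h :=
  isMeasurableFun.Build _ _ _ _ (shift2 h) (measurable_shift2 h).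

Let measurable_preimage d1 d2 (T1 : measurableType d1) (T2 : measurableType d2)
  (f : {mfun T1 >-> T2}) A : measurable A -> measurable (f @^-1` A).
Proof. by move=> mA; rewrite -[X in measurable X]setTI; exact: measurable_funPT. Qed.

Lemma lebesgue2_shift h (A : set (B * B)) : measurable A ->
  (leb \x leb)%E (shift2 h @^-1` A) = (leb \x leb)%E A.
Proof.
move=> mA; rewrite -[LHS]/(pushforward (leb \x leb)%E (shift2 h) A).
apply/esym; apply: product_measure_unique mA => /= A1 A2 mA1 mA2.
rewrite /pushforward -[X in (_ \x _)%E X]/((shift1 h.1 @^-1` A1) `*` (shift1 h.2 @^-1` A2)).
rewrite product_measure1E; [|exact: measurable_preimage..].
by congr (_ * _)%E; exact: lebesgue_measure_shift.
Qed.

Local Notation T3 := (B * B * B)%type.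
Local Notation leb3 := (@lebesgue3 R).

Definition shift3 (h : T3) (z : T3) : T3 :=
  (shift2 h.1 z.1, shift1 h.2 z.2).

Lemma measurable_shift3 h : measurable_fun setT (shift3 h).
Proof.
by apply: measurable_fun_pair => /=; apply: measurableT_comp.
Qed.

HB.instance Definition _ h :=
  isMeasurableFun.Build _ _ _ _ (shift3 h) (measurable_shift3 h).

(** The uniqueness theorem for product measures, applied to [lebesgue3], asks for
   the structure of a sigma-finite measure on its first factor. *)
Definition leb2 : set (B * B) -> \bar R := (leb \x leb)%E.

HB.instance Definition _ := Measure.copy leb2 (leb \x leb)%E.

Let sigma_finite_leb2 : sigma_finite setT leb2.
Proof.
exists (fun n => `]- n%:R, n%:R[ `*` `]- n%:R, n%:R[).
  apply/esym; rewrite -subTset => -[x y] _ /=.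
  have [n xn] : exists n : nat, `|x| < n%:R.
    by have [N _ /(_ N (leqnn _))] := nbhs_infty_gtr `|x|; exists N.
  have [m ym] : exists n : nat, `|y| < n%:R.
    by have [N _ /(_ N (leqnn _))] := nbhs_infty_gtr `|y|; exists N.
  exists (n + m)%N => //=; rewrite !in_itv/= -!ltr_norml natrD.
  by split; [rewrite (lt_le_trans xn)// lerDl|rewrite (lt_le_trans ym)// lerDr].
move=> n; split; first exact: measurableX.
by rewrite [X in (X < _)%E]product_measure1E//= !lebesgue_measure_itv/=;
  case: ifP => _; rewrite ?mul0e// -EFinB -EFinM ltry.
Qed.

HB.instance Definition _ := Measure_isSigmaFinite.Build _ _ _ leb2
  sigma_finite_leb2.

Lemma lebesgue3_shift h (A : set T3) : measurable A ->
  leb3 (shift3 h @^-1` A) = leb3 A.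
Proof.
have E A1 A2 : measurable A1 -> measurable A2 ->
    pushforward leb3 (shift3 h) (A1 `*` A2) = (leb2 A1 * leb A2)%E.
  move=> mA1 mA2; rewrite /pushforward.
  transitivity (leb3 ((shift2 h.1 @^-1` A1) `*` (shift1 h.2 @^-1` A2))) => //.
  rewrite [LHS]product_measure1E; [|exact: measurable_preimage..].
  by congr (_ * _)%E; [exact: lebesgue2_shift|exact: lebesgue_measure_shift].
move=> mA; rewrite -[LHS]/(pushforward leb3 (shift3 h) A).
apply/esym.
exact: (@product_measure_unique _ _ _ _ R leb2 (@lebesgue_measure R)
  (pushforward leb3 (shift3 h)) E A mA).
Qed.

Definition of_pt (x : pt) : T3 := (x (inord 0) 0, x (inord 1) 0, x (inord 2) 0).

Lemma pt_ofK : cancel pt_of of_pt.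
Proof.
by case=> [[a b] c]; rewrite /pt_of /of_pt !mxE /= !(tnth_nth 0) /= !inordK.
Qed.

Lemma of_ptK : cancel of_pt pt_of.
Proof.
move=> x; apply/colP; case; case=> [|[|[|//]]] lt; rewrite !mxE !(tnth_nth 0) /=;
  by congr (x _ _); apply: val_inj; rewrite /= inordK.
Qed.

Lemma pt_of_shift h z : pt_of (shift3 h z) = pt_of z + pt_of h.
Proof. by apply: (can_inj of_ptK); rewrite pt_ofK /of_pt !mxE /= !(tnth_nth 0) /= !inordK. Qed.

(** * Measurable, integrable and almost everywhere, on column vectors *)

(** Column vectors carry no sigma-algebra of their own: all notions are those of
   the triples of coordinates. *)
Definition aeL (P : pt -> Prop) := {ae leb3, forall z, P (pt_of z)}.

Definition mfun (f : pt -> R) := measurable_fun setT (f \o pt_of : T3 -> R).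

Definition integrable3 (f : pt -> R) :=
  leb3.-integrable setT (EFin \o (f \o pt_of)).

Definition integ (f : pt -> R) : R := int3 setT f.

Definition mset (A : set pt) := measurable (pt_of @^-1` A : set T3).

Lemma pt_of_coord (z : T3) (i : 'I_3) : pt_of z i 0 =
  if i == inord 0 then z.1.1 else if i == inord 1 then z.1.2 else z.2.
Proof.
case: i; case=> [|[|[|//]]] lt; rewrite !mxE !(tnth_nth 0) /=;
  by rewrite -!val_eqE /= !inordK.
Qed.

Lemma mfun_coord i : mfun (fun x => x i 0).
Proof.
rewrite /mfun; apply: (eq_measurable_fun (fun z : T3 =>
  if i == inord 0 then z.1.1 else if i == inord 1 then z.1.2 else z.2)).
  by move=> z _; rewrite /= pt_of_coord.
case: (i == inord 0) => /=; first exact: (measurableT_comp measurable_fst measurable_fst).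
case: (i == inord 1) => /=; first exact: (measurableT_comp measurable_snd measurable_fst).
exact: measurable_snd.
Qed.

Lemma mfun_cst c : mfun (fun=> c). Proof. exact: measurable_cst. Qed.

Lemma mfunD f g : mfun f -> mfun g -> mfun (fun x => f x + g x).
Proof. exact: measurable_funD. Qed.

Lemma mfunM f g : mfun f -> mfun g -> mfun (fun x => f x * g x).
Proof. exact: measurable_funM. Qed.

Lemma mfun_sum (I : Type) (r : seq I) (f : I -> pt -> R) :
  (forall i, mfun (f i)) -> mfun (fun x => \sum_(i <- r) f i x).
Proof. by move=> mf; apply: measurable_sum => i; exact: mf. Qed.

Lemma mfun_comp (h : R -> R) f : measurable_fun setT h -> mfun f ->
  mfun (h \o f).
Proof. by move=> mh mf; exact: (measurableT_comp mh mf). Qed.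

Lemma mfun_indic A : mset A -> mfun (\1_A).
Proof.
move=> mA; by rewrite /mfun (_ : _ \o _ = \1_(pt_of @^-1` A)).
Qed.

Lemma mset_gt0 f : mfun f -> mset [set x | 0 < f x].
Proof.
move=> mf; rewrite /mset -[X in measurable X]setTI.
have -> : pt_of @^-1` [set x | 0 < f x] = (f \o pt_of : T3 -> R) @^-1` `]0, +oo[.
  by apply/seteqP; split => z /=; rewrite in_itv/= andbT.
exact: mf.
Qed.

Lemma mset_fin_bigcap (I : finType) (A : I -> set pt) :
  (forall i, mset (A i)) -> mset [set x | forall i, A i x].
Proof.
move=> mA; rewrite /mset.
have -> : pt_of @^-1` [set x | forall i, A i x] =
    \bigcap_(i in [set: I]) (pt_of @^-1` A i).
  by apply/seteqP; split => z /=; [move=> h i _; exact: h|move=> h i; exact: h].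
by apply: fin_bigcap_measurable => // i _; exact: mA.
Qed.

Definition obox (lo hi : pt) : set pt :=
  [set x | forall i, lo i 0 < x i 0 < hi i 0].

Lemma obox_pt_of lo hi : pt_of @^-1` obox lo hi =
  (`]lo (inord 0) 0, hi (inord 0) 0[ `*` `]lo (inord 1) 0, hi (inord 1) 0[)
    `*` `]lo (inord 2) 0, hi (inord 2) 0[.
Proof.
apply/seteqP; split => z /= => [h|].
  have := (h (inord 0), h (inord 1), h (inord 2)).
  rewrite !in_itv /= !pt_of_coord !eqxx.
  rewrite -!val_eqE /= !inordK //=.
  by case=> [[]].
rewrite !in_itv/= => -[[h0 h1] h2] i; rewrite pt_of_coord.
have : [|| i == inord 0, i == inord 1 | i == inord 2].
  by case: i; case=> [|[|[|//]]] lt; rewrite -!val_eqE /= !inordK.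
have [->//|_] := eqVneq i (inord 0).
by have [->//|_] := eqVneq i (inord 1) => /= /eqP ->.
Qed.

Lemma mset_obox lo hi : mset (obox lo hi).
Proof. by rewrite /mset obox_pt_of; do 2?apply: measurableX. Qed.

Lemma prod_ord3 (f : 'I_3 -> R) :
  \prod_i f i = f (inord 0) * f (inord 1) * f (inord 2).
Proof.
rewrite !big_ord_recl big_ord0 mulr1 mulrA.
by congr (f _ * f _ * f _); apply: val_inj; rewrite /= inordK.
Qed.

Lemma sum_ord3 (V : zmodType) (f : 'I_3 -> V) :
  \sum_i f i = f (inord 0) + f (inord 1) + f (inord 2).
Proof.
rewrite !big_ord_recl big_ord0 addr0 addrA.
by congr (f _ + f _ + f _); apply: val_inj; rewrite /= inordK.
Qed.

Lemma measure_obox (lo hi : pt) : (forall i, lo i 0 <= hi i 0) ->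
  leb3 (pt_of @^-1` obox lo hi) = (\prod_i (hi i 0 - lo i 0))%:E.
Proof.
move=> lohi; rewrite obox_pt_of /lebesgue3.
have E a b : a <= b -> leb `]a, b[%classic = (b - a)%:E.
  rewrite lebesgue_measure_itv/= lte_fin le_eqVlt => /predU1P[->|->].
    by rewrite ltxx subrr.
  by rewrite EFinB.
rewrite [LHS]product_measure1E//; last exact: measurableX.
rewrite [X in (X * _)%E]product_measure1E//=.
by rewrite !E// -!EFinM prod_ord3.
Qed.

(** ** Null sets *)

Lemma aeL_and (P Q : pt -> Prop) : aeL P -> aeL Q -> aeL (fun x => P x /\ Q x).
Proof. by move=> hP hQ; exact: (@filterS2 _ _ (ae_filter_ringOfSetsType leb3) _ _ _ (fun z a b => conj a b) hP hQ). Qed.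

Lemma aeLW (P : pt -> Prop) : (forall x, P x) -> aeL P.
Proof. by move=> h; exact: aeW. Qed.

Lemma aeLS (P Q : pt -> Prop) : (forall x, P x -> Q x) -> aeL P -> aeL Q.
Proof. by move=> h; apply: (@filterS _ _ (ae_filter_ringOfSetsType leb3)) => z; exact: h. Qed.

Lemma aeL_forallnat (P : nat -> pt -> Prop) :
  (forall n, aeL (P n)) -> aeL (fun x => forall n, P n x).
Proof. by move=> h; exact: ae_foralln. Qed.

Lemma aeL_forallcount (I : countType) (P : I -> pt -> Prop) :
  (forall n, aeL (P n)) -> aeL (fun x => forall n, P n x).
Proof.
move=> h.
have : aeL (fun x => forall n : nat, if @choice.unpickle I n is Some i then P i x else True).
  apply: aeL_forallnat => n; case: (@choice.unpickle I n) => [i|]; first exact: h.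
  exact: aeLW.
by apply: aeLS => x hx i; have := hx (choice.pickle i); rewrite choice.pickleK.
Qed.

(** Affine functionals are kept as pairs rather than as functions, so that lists
   of them, which describe polyhedra, have decidable membership. *)
Definition aff (l : 'rV[R]_3 * R) (x : pt) : R := (l.1 *m x) 0 0 + l.2.

Lemma affE l x : aff l x = \sum_i l.1 0 i * x i 0 + l.2.
Proof. by rewrite /aff mxE. Qed.

Lemma mfun_aff l : mfun (aff l).
Proof.
rewrite (_ : aff l = fun x => \sum_i l.1 0 i * x i 0 + l.2); last first.
  by apply/funext => x; rewrite affE.
apply: mfunD; last exact: mfun_cst.
by apply: mfun_sum => i; apply: mfunM; [exact: mfun_cst|exact: mfun_coord].
Qed.

Let null_line (a b : R) : a != 0 -> leb [set x : B | a * x + b = 0] = 0%E.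
Proof.
move=> a0; rewrite (_ : [set _ | _] = [set - b / a]) ?lebesgue_measure_set1//.
apply/seteqP; split => x /= h.
  by apply: (mulfI a0); rewrite mulrCA divff// mulr1; move/eqP: h; rewrite addr_eq0 => /eqP.
by rewrite h mulrCA divff// mulr1 addNr.
Qed.

(** A hyperplane meets the lines in some coordinate direction in single
   points; the last such coordinate is the one to integrate first. *)
Lemma aeL_aff_neq0 l : l.1 != 0 -> aeL (fun x => aff l x != 0).
Proof.
move=> l0.
pose a i := l.1 0 (inord i : 'I_3).
pose N : set T3 := [set z | a 0%N * z.1.1 + a 1%N * z.1.2 + a 2%N * z.2 + l.2 = 0].
have affN z : (aff l (pt_of z) == 0) = (z \in N).
  rewrite affE sum_ord3 !pt_of_coord -!val_eqE /= !inordK //=.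
  by apply/eqP/idP; rewrite inE.
have mN : measurable N.
  have -> : N = setT `&` (aff l \o pt_of : T3 -> R) @^-1` [set 0].
    rewrite setTI; apply/seteqP; split => z /= h.
      by apply/eqP; rewrite affN inE.
    by apply/set_mem; rewrite -affN h.
  exact: mfun_aff.
exists N; split => //; last first.
  by move=> z /= /negP; rewrite negbK affN inE.
have [a2|] := boolP (a 2%N == 0); last first.
  move=> a2; rewrite [LHS]integral0_eq// => z _ /=.
  rewrite (_ : xsection N z =
    [set x : B | a 2%N * x + (a 0%N * z.1 + a 1%N * z.2 + l.2) = 0]) ?null_line//.
  by apply/seteqP; split => x; rewrite /xsection /= inE /N /= => <-; ring.
have [a1|] := boolP (a 1%N == 0); last first.
  move=> a1; pose N2 : set (B * B) := [set z | a 0%N * z.1 + a 1%N * z.2 + l.2 = 0].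
  have NE : N = N2 `*` setT.
    apply/seteqP; split => z; rewrite /N /N2 /= (eqP a2) mul0r addr0 //.
    by case.
  have mN2 : measurable N2.
    have -> : N2 = setT `&` (fun z : B * B => a 0%N * z.1 + a 1%N * z.2 + l.2) @^-1` [set 0].
      by rewrite setTI.
    apply: (_ : measurable_fun setT _) => //.
    apply: measurable_funD => //; apply: measurable_funD; apply: measurable_funM => //.
  rewrite NE /lebesgue3 [LHS]product_measure1E//=.
  rewrite (_ : (_ \x _)%E N2 = 0%E) ?mul0e//.
  rewrite [LHS]integral0_eq// => z _ /=.
  rewrite (_ : xsection N2 z = [set x : B | a 1%N * x + (a 0%N * z + l.2) = 0]) ?null_line//.
  by apply/seteqP; split => x; rewrite /xsection /= inE /N2 /= => <-; ring.
have a0 : a 0%N != 0.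
  apply: contra l0 => a0; apply/eqP/rowP; case; case=> [|[|[|//]]] lt; rewrite mxE.
  - by rewrite -(eqP a0); congr (l.1 _ _); apply: val_inj; rewrite /= inordK.
  - by rewrite -(eqP a1); congr (l.1 _ _); apply: val_inj; rewrite /= inordK.
  - by rewrite -(eqP a2); congr (l.1 _ _); apply: val_inj; rewrite /= inordK.
pose N1 : set B := [set x | a 0%N * x + l.2 = 0].
have mN1 : measurable N1.
  have -> : N1 = setT `&` (fun z : B => a 0%N * z + l.2) @^-1` [set 0] by rewrite setTI.
  apply: (_ : measurable_fun setT _) => //.
  by apply: measurable_funD => //; exact: measurable_funM.
have -> : N = (N1 `*` setT) `*` setT.
  apply/seteqP; split => z; rewrite /N /N1 /= (eqP a2) (eqP a1) !mul0r !addr0 //.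
  by case=> [[]].
rewrite /lebesgue3 [LHS]product_measure1E//=; last exact: measurableX.
by rewrite [X in (X * _)%E]product_measure1E//= null_line// !mul0e.
Qed.

(** ** Integration over the whole space *)

Lemma int3E A f : int3 A f = integ (fun x => \1_A x * f x).
Proof.
rewrite /integ /int3 preimage_setT Rintegral_mkcond; apply: eq_Rintegral => z _.
rewrite patchE indicE /=.
have -> : (z \in pt_of @^-1` A) = (pt_of z \in A).
  by apply/idP/idP; rewrite !inE.
by case: ifP; rewrite ?mul1r ?mul0r.
Qed.

Lemma integ_ae f g : aeL (fun x => f x = g x) -> integ f = integ g.
Proof.
move=> fg; rewrite /integ /int3 preimage_setT; congr fine.
apply: ae_eq_integral_arbitrary.
by apply: (@filterS _ _ (ae_filter_ringOfSetsType leb3)) fg => z /= ->.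
Qed.

Lemma eq_integ f g : f =1 g -> integ f = integ g.
Proof. by move=> /funext ->. Qed.

Lemma integrable3D f g : integrable3 f -> integrable3 g ->
  integrable3 (fun x => f x + g x).
Proof. by move=> hf hg; have := integrableD measurableT hf hg. Qed.

Lemma integrable3Z c f : integrable3 f -> integrable3 (fun x => c * f x).
Proof. by move=> hf; have := integrableZl measurableT c hf. Qed.

Lemma integrable3_mfun f : integrable3 f -> mfun f.
Proof. by move=> /measurable_int /measurable_EFinP. Qed.

Lemma le_integrable3 f g : mfun f -> (forall x, `|f x| <= `|g x|) ->
  integrable3 g -> integrable3 f.
Proof.
move=> mf fg; apply: le_integrable => //; first exact/measurable_EFinP.
by move=> z _ /=; rewrite lee_fin.
Qed.

Lemma integrable3_bounded f lo hi C : mfun f -> (forall x, `|f x| <= C) ->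
  (forall x, ~ obox lo hi x -> f x = 0) -> integrable3 f.
Proof.
move=> mf fC f0.
have [lohi|] := pselect (forall i, lo i 0 <= hi i 0); last first.
  move=> h; apply: (eq_integrable _ (cst 0)) => //; last exact: integrable0.
  move=> z _; rewrite /= f0// => hb; apply: h => i.
  by have /andP[a b] := hb i; exact: ltW (lt_trans a b).
have mB := mset_obox lo hi.
have ibox : leb3.-integrable (pt_of @^-1` obox lo hi) (EFin \o (f \o pt_of)).
  apply: measurable_bounded_integrable => //.
  - by rewrite measure_obox ?ltry.
  - exact: measurable_funTS mf.
  - exists C; split; first exact: num_real.
    by move=> y Cy z _ /=; apply: le_trans (fC _) (ltW Cy).
move: ibox; rewrite (integrable_mkcond _ mB); apply: eq_integrable => // z _.
rewrite patchE /=; case: ifPn => // /negP; rewrite inE => h.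
by rewrite /= f0.
Qed.

Lemma integrable3_indic (A : set pt) lo hi : mset A -> A `<=` obox lo hi ->
  integrable3 (\1_A : pt -> R).
Proof.
move=> mA Ab; apply: (@integrable3_bounded _ lo hi 1); first exact: mfun_indic.
  by move=> x; rewrite indicE ger0_norm// lern1 leq_b1.
by move=> x hx; rewrite indicE memNset// => /Ab.
Qed.

Lemma integ_shift h f : integrable3 f -> integ (fun x => f (x + h)) = integ f.
Proof.
move=> hf; rewrite /integ /int3 !preimage_setT; congr fine.
have <- : (\int[pushforward leb3 (shift3 (of_pt h))]_z (f (pt_of z))%:E =
    \int[leb3]_z (f (pt_of z))%:E)%E.
  by apply: eq_measure_integral => A mA _; exact: lebesgue3_shift.
have mf : measurable_fun setT (EFin \o (f \o pt_of)) by exact: measurable_int hf.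
have ms := measurable_shift3 (of_pt h).
have fsh : leb3.-integrable setT ((EFin \o (f \o pt_of)) \o shift3 (of_pt h)).
  apply/integrableP; split; first exact: (measurableT_comp mf ms).
  have := @ge0_integral_pushforward _ _ _ _ _ _ ms leb3 setT
    (fun z => `|(f (pt_of z))%:E|%E) measurableT (measurableT_comp (@abse_measurable R setT) mf)
    (fun _ _ => abse_ge0 _).
  rewrite preimage_setT => E; rewrite -[X in (X < _)%E]E.
  rewrite (eq_measure_integral leb3) => [|A mA _]; last exact: lebesgue3_shift.
  by have /integrableP[_] := hf.
rewrite (integral_pushforward ms mf)//.
rewrite preimage_setT; apply: eq_integral => z _ /=.
by rewrite pt_of_shift of_ptK.
Qed.

(** The integrands occurring below are under control up to null sets only. *)
Definition ae_integrable (f : pt -> R) :=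
  exists2 f0, integrable3 f0 & aeL (fun x => f x = f0 x).

Lemma integrable3_ae f : integrable3 f -> ae_integrable f.
Proof. by exists f => //; exact: aeLW. Qed.

Lemma ae_integrable_eq f g : aeL (fun x => g x = f x) -> ae_integrable f ->
  ae_integrable g.
Proof.
move=> gf [f0 i0 e0]; exists f0 => //.
by apply: aeLS (aeL_and gf e0) => x [-> ->].
Qed.

Lemma ae_integrableD f g : ae_integrable f -> ae_integrable g ->
  ae_integrable (fun x => f x + g x).
Proof.
move=> [f0 fi fe] [g0 gi ge]; exists (fun x => f0 x + g0 x).
  exact: integrable3D.
by apply: aeLS (aeL_and fe ge) => x [-> ->].
Qed.

Lemma ae_integrableZ c f : ae_integrable f -> ae_integrable (fun x => c * f x).
Proof.
move=> [f0 fi fe]; exists (fun x => c * f0 x); first exact: integrable3Z.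
by apply: aeLS fe => x ->.
Qed.

Lemma ae_integrable0 : ae_integrable (fun=> 0).
Proof. by apply: integrable3_ae; exact: integrable0. Qed.

Lemma ae_integrable_sum (I : Type) (r : seq I) (P : pred I) (f : I -> pt -> R) :
  (forall i, P i -> ae_integrable (f i)) ->
  ae_integrable (fun x => \sum_(i <- r | P i) f i x).
Proof.
move=> hf; elim: r => [|i r ih].
  rewrite (_ : (fun _ => _) = fun=> 0); first exact: ae_integrable0.
  by apply/funext => x; rewrite big_nil.
have [Pi|Pi] := boolP (P i); last first.
  rewrite (_ : (fun _ => _) = fun x => \sum_(j <- r | P j) f j x) //.
  by apply/funext => x; rewrite big_cons (negbTE Pi).
rewrite (_ : (fun _ => _) = fun x => f i x + \sum_(j <- r | P j) f j x).
  by apply: ae_integrableD => //; exact: hf.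
by apply/funext => x; rewrite big_cons Pi.
Qed.

Lemma integD f g : ae_integrable f -> ae_integrable g ->
  integ (fun x => f x + g x) = integ f + integ g.
Proof.
move=> [f0 fi fe] [g0 gi ge].
rewrite (integ_ae fe) (integ_ae ge).
rewrite (@integ_ae _ (fun x => f0 x + g0 x)); last first.
  by apply: aeLS (aeL_and fe ge) => x [-> ->].
by rewrite /integ /int3 preimage_setT RintegralD.
Qed.

Lemma integZ c f : ae_integrable f -> integ (fun x => c * f x) = c * integ f.
Proof.
move=> [f0 fi fe]; rewrite (integ_ae fe).
rewrite (@integ_ae _ (fun x => c * f0 x)); last by apply: aeLS fe => x ->.
by rewrite /integ /int3 preimage_setT RintegralZl.
Qed.

Lemma integ0 : integ (fun=> 0) = 0.
Proof. by rewrite /integ /int3 preimage_setT Rintegral_cst// mul0r. Qed.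

Lemma ae_integrableN f : ae_integrable f -> ae_integrable (fun x => - f x).
Proof.
move=> /(ae_integrableZ (-1)); apply: ae_integrable_eq.
by apply: aeLW => x; rewrite mulN1r.
Qed.

Lemma integN f : ae_integrable f -> integ (fun x => - f x) = - integ f.
Proof.
by move=> hf; rewrite -mulN1r -integZ//; apply: eq_integ => x; rewrite mulN1r.
Qed.

Lemma ae_integrableB f g : ae_integrable f -> ae_integrable g ->
  ae_integrable (fun x => f x - g x).
Proof. by move=> hf hg; apply: ae_integrableD => //; exact: ae_integrableN. Qed.

Lemma integB f g : ae_integrable f -> ae_integrable g ->
  integ (fun x => f x - g x) = integ f - integ g.
Proof.
by move=> hf hg; rewrite integD ?integN//; exact: ae_integrableN.
Qed.

Lemma integ_sum (I : Type) (r : seq I) (P : pred I) (f : I -> pt -> R) :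
  (forall i, P i -> ae_integrable (f i)) ->
  integ (fun x => \sum_(i <- r | P i) f i x) = \sum_(i <- r | P i) integ (f i).
Proof.
move=> hf; elim: r => [|i r ih].
  by rewrite big_nil -[RHS]integ0; apply: eq_integ => x; rewrite big_nil.
rewrite big_cons; case: ifPn => Pi; last first.
  by rewrite -ih; apply: eq_integ => x; rewrite big_cons (negbTE Pi).
rewrite -ih -integD; last 2 first.
- exact: hf.
- exact: ae_integrable_sum.
by apply: eq_integ => x; rewrite big_cons Pi.
Qed.

(** Dominated convergence. *)
Lemma integ_cvg (fn : nat -> pt -> R) f g :
  (forall n, ae_integrable (fn n)) -> ae_integrable f -> ae_integrable g ->
  (forall n, aeL (fun x => `|fn n x| <= g x)) ->
  aeL (fun x => fn n x @[n --> \oo] --> f x) ->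
  integ (fn n) @[n --> \oo] --> integ f.
Proof.
move=> hfn [f0 fi fe] [g0 gi ge] fng fnf.
have [fn0 /all_and2[fni fne]] := choice (fun n => let: ex_intro2 a b c := hfn n in
  ex_intro (fun f0 => integrable3 f0 /\ aeL (fun x => fn n x = f0 x)) a (conj b c)).
rewrite (integ_ae fe).
rewrite (_ : (fun n => _) = (fun n => integ (fn0 n))); last first.
  by apply/funext => n; rewrite (integ_ae (fne n)).
have fneA := aeL_forallnat fne.
have C1 : {ae leb3, forall z, [set: T3] z ->
    (EFin \o (fn0 n \o pt_of)) z @[n --> \oo] --> (EFin \o (f0 \o pt_of)) z}.
  apply: (@filterS3 _ _ (ae_filter_ringOfSetsType leb3)) fneA fe fnf.
  move=> z h1 h2 h3 _ /=; apply/cvg_EFin; first by near=> n.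
  rewrite /comp /= -h2; apply: cvg_trans h3; apply: near_eq_cvg.
  by near=> n; rewrite h1.
have C2 : {ae leb3, forall z n, [set: T3] z ->
    (`|(EFin \o (fn0 n \o pt_of)) z| <= (EFin \o (g0 \o pt_of)) z)%E}.
  apply: (@filterS3 _ _ (ae_filter_ringOfSetsType leb3)) (aeL_forallnat fng) fneA ge.
  by move=> z h1 h2 h3 n _ /=; rewrite lee_fin -h2 -h3.
have [_ _] := @dominated_convergence _ T3 R leb3 setT measurableT
  (fun n => EFin \o (fn0 n \o pt_of)) (EFin \o (f0 \o pt_of)) (EFin \o (g0 \o pt_of))
  (fun n => measurable_int _ (fni n)) (measurable_int _ fi) C1 gi C2.
rewrite /integ /int3 !preimage_setT => h.
apply: fine_cvg; rewrite fineK; last exact: integrable_fin_num.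
exact: h.
Unshelve. all: by end_near.
Qed.
End Lebesgue3.

(** * Smooth cutoff functions *)

Section Smooth.
Context {R : realType}.
Local Notation pt := 'cV[R]_3.

(** The factors t^-n make the family stable under differentiation, see
   [is_derive_flat]. *)
Definition flat (n : nat) (t : R) : R :=
  if 0 < t then t^-1 ^+ n * expR (- t^-1) else 0.

Lemma flat_le0 n t : t <= 0 -> flat n t = 0.
Proof. by move=> t0; rewrite /flat ltNge t0. Qed.

Lemma flat_gt0 t : 0 < t -> 0 < flat 0 t.
Proof. by move=> t0; rewrite /flat t0 mul1r expR_gt0. Qed.

Lemma expr_le_expR (m : nat) (s : R) : 0 <= s ->
  s ^+ m.+1 <= m.+1%:R ^+ m.+1 * expR s.
Proof.
move=> s0; have m0 : 0 < m.+1%:R :> R by [].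
have -> : expR s = expR (s / m.+1%:R) ^+ m.+1.
  by rewrite -expRM_natl mulrCA divff ?mulr1// gt_eqF.
rewrite -exprMn; apply: lerXn2r; rewrite ?nnegrE//.
rewrite -ler_pdivrMl// mulrC; apply: le_trans (expR_ge1Dx _).
by rewrite lerDr.
Qed.

(** This bound gives the value and the derivative at 0. *)
Lemma flat_le (n : nat) (t : R) :
  `|flat n t| <= n.+2%:R ^+ n.+2 * `|t| ^+ 2.
Proof.
have [t0|t0] := leP t 0.
  by rewrite flat_le0// normr0 mulr_ge0.
rewrite /flat t0 (gtr0_norm t0).
have ti : 0 < t^-1 by rewrite invr_gt0.
rewrite -[X in _ * X ^+ 2]invrK; move: (t^-1) ti => s s0.
rewrite ger0_norm ?mulr_ge0 ?expR_ge0 ?exprn_ge0 ?(ltW s0)//.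
rewrite expRN ler_pdivrMr ?expR_gt0// mulrAC exprVn ler_pdivlMr ?exprn_gt0//.
by rewrite -exprD addn2; exact: expr_le_expR (ltW s0).
Qed.

Lemma is_derive_flat n (t : R) :
  is_derive t (1 : R) (flat n) (flat n.+2 t - n%:R * flat n.+1 t).
Proof.
have [t0|t0|->] := ltgtP t 0.
- apply: (@near_eq_is_derive _ _ _ (cst 0)).
    near=> x; rewrite /flat ifF//; apply/negbTE; rewrite -leNgt ltW//.
    by near: x; exact: lt_nbhsl.
  by rewrite !flat_le0 ?(ltW t0)// mulr0 subr0; exact: is_derive_cst.
- have tn0 : t != 0 by rewrite gt_eqF.
  have di : is_derive t (1 : R) (fun x : R => x^-1) (- t ^- 2).
    apply: DeriveDef; first by apply: derivableV.
    by rewrite deriveV// derive_id /GRing.scale /= mulr1.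
  have de : is_derive t (1 : R) (fun x : R => expR (- x^-1)) (expR (- t^-1) * t ^- 2).
    apply: (@is_derive1_comp _ expR (fun x => - x^-1)).
    have := is_deriveN di; rewrite opprK; exact.
  have dp m : is_derive t (1 : R) (fun x : R => x^-1 ^+ m) (- (m%:R * t^-1 ^+ m.+1)).
    elim: m => [|m ih].
      by rewrite mul0r oppr0; exact: is_derive_cst.
    apply: (@near_eq_is_derive _ _ _ ((fun x : R => x^-1) * (fun x : R => x^-1 ^+ m))).
      by near=> x; rewrite exprS.
    apply: (is_derive_eq (is_deriveM di ih)).
    have -> : t ^- 2 = t^-1 ^+ 2 by rewrite exprVn.
    by rewrite /GRing.scale /= !exprS expr0 -natr1; ring.
  apply: (@near_eq_is_derive _ _ _ ((fun x : R => x^-1 ^+ n) * (fun x : R => expR (- x^-1)))).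
    near=> x; rewrite /flat ifT//.
    by near: x; exact: lt_nbhsr.
  apply: (is_derive_eq (is_deriveM (dp n) de)).
  have -> : t ^- 2 = t^-1 ^+ 2 by rewrite exprVn.
  by rewrite /flat t0 /GRing.scale /= !exprS expr0; ring.
- rewrite !flat_le0// mulr0 subr0.
  have C : (fun h : R => h^-1 *: (flat n (h *: 1 + 0) - flat n 0)) @ 0^' --> 0.
    apply: norm_cvg0.
    apply: (@squeeze_cvgr _ _ _ _ (cst 0) (fun h : R => n.+2%:R ^+ n.+2 * `|h|)).
    + near=> h; rewrite normr_ge0 /= addr0 (flat_le0 n (lexx 0)) subr0 normrZ normfV.
      have h0 : h != 0 by near: h; exact: nbhs_dnbhs_neq.
      rewrite ler_pdivrMl ?normr_gt0// mulrCA -expr2 /GRing.scale /= mulr1.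
      exact: flat_le.
    + exact: cvg_cst.
    + rewrite -[X in _ --> X](mulr0 (n.+2%:R ^+ n.+2)); apply: cvgMr.
      rewrite -[X in _ --> X](normr0 R); apply: cvg_norm; exact: cvg_within.
  by apply: DeriveDef; [apply/cvg_ex; exists 0|exact/cvg_lim].
Unshelve. all: by end_near.
Qed.

Lemma differentiable_flat n t : differentiable (flat n) t.
Proof. by apply/derivable1_diffP; case: (is_derive_flat n t). Qed.

Lemma measurable_flat n : measurable_fun setT (flat n).
Proof.
apply: continuous_measurable_fun => t; apply: differentiable_continuous.
exact: differentiable_flat.
Qed.

Lemma aff_shift l (x u : pt) (h : R) :
  aff l (h *: u + x) = h * (l.1 *m u) 0 0 + aff l x.
Proof. by rewrite /aff mulmxDr -scalemxAr !mxE addrA. Qed.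

Lemma differentiable_aff (l : 'rV[R]_3 * R) x : differentiable (aff l) x.
Proof.
rewrite (_ : aff l = (\sum_(i < 3) (fun x : pt => l.1 0 i *: x i 0)) + cst l.2); last first.
  by apply/funext => y; rewrite affE /= fct_sumE.
apply: differentiableD => //; apply: differentiable_sum => i.
exact/differentiableZ/differentiable_coord.
Qed.

Lemma derive_aff (l : 'rV[R]_3 * R) x u : 'D_u (aff l) x = (l.1 *m u) 0 0.
Proof.
apply: cvg_lim => //; rewrite /=.
apply: cvg_trans (@cvg_cst _ _ _ (0^') _); apply: near_eq_cvg.
near=> h; have h0 : h != 0 by near: h; exact: nbhs_dnbhs_neq.
by rewrite aff_shift addrK /GRing.scale /= mulKf.
Unshelve. all: by end_near.
Qed.

(** Generators and operations chosen so that the class is stable under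
   differentiation: smoothness of its members then needs no estimate. *)
Inductive smooth : (pt -> R) -> Prop :=
| smooth_flat n l : smooth (fun x => flat n (aff l x))
| smooth_aff l : smooth (aff l)
| smooth_cst c : smooth (fun=> c)
| smoothD f g : smooth f -> smooth g -> smooth (fun x => f x + g x)
| smoothM f g : smooth f -> smooth g -> smooth (fun x => f x * g x)
| smoothV f : smooth f -> (forall x, 0 < f x) -> smooth (fun x => (f x)^-1).

Lemma smooth_mfun f : smooth f -> mfun f.
Proof.
elim=> {f} [n l|l|c|f g _ mf _ mg|f g _ mf _ mg|f _ mf f0].
- by apply: mfun_comp (mfun_aff l); exact: measurable_flat.
- exact: mfun_aff.
- exact: mfun_cst.
- exact: mfunD.
- exact: mfunM.
- rewrite (_ : (fun _ => _) = (expR \o (fun t => - t) \o @ln R) \o f).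
    apply: mfun_comp => //; apply: measurableT_comp; last exact: measurable_ln.
    exact: (measurableT_comp (@measurable_expR R) (@oppr_measurable R setT)).
  by apply/funext => x; rewrite /= expRN lnK// posrE.
Qed.

Lemma smooth_differentiable f : smooth f -> forall x, differentiable f x.
Proof.
elim=> {f} [n l|l|c|f g _ df _ dg|f g _ df _ dg|f _ df f0] x.
- by apply: differentiable_comp; [exact: differentiable_aff|exact: differentiable_flat].
- exact: differentiable_aff.
- exact: differentiable_cst.
- exact: differentiableD.
- exact: differentiableM.
- by apply: differentiableV => //; rewrite gt_eqF.
Qed.

Lemma smoothN f : smooth f -> smooth (fun x => - f x).
Proof.
move=> sf; rewrite (_ : (fun _ => _) = (fun x => (-1) * f x)); last first.
  by apply/funext => x; rewrite mulN1r.
by apply: smoothM => //; exact: smooth_cst.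
Qed.

Lemma smooth_derive f u : smooth f -> smooth (fun x => 'D_u f x).
Proof.
elim=> {f} [n l|l|c|f g sf df sg dg|f g sf df sg dg|f sf df f0].
- rewrite (_ : (fun _ => _) = fun x => (flat n.+2 (aff l x) +
    (- n%:R) * flat n.+1 (aff l x)) * (l.1 *m u) 0 0); last first.
    apply/funext => x.
    have da := differentiable_aff l x.
    have df := differentiable_flat n (aff l x).
    rewrite deriveE; last exact: differentiable_comp da df.
    rewrite diff_comp// /= -(deriveE _ da) derive_aff.
    rewrite deriv1E; last by case: (is_derive_flat n (aff l x)).
    have -> : derive1 (flat n) (aff l x) = flat n.+2 (aff l x) - n%:R * flat n.+1 (aff l x).
      by rewrite derive1E; case: (is_derive_flat n (aff l x)).
    by rewrite mulNr /GRing.scale /= mulrC.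
  apply: smoothM; last exact: smooth_cst.
  apply: smoothD; first exact: smooth_flat.
  by apply: smoothM; [exact: smooth_cst|exact: smooth_flat].
- have -> : (fun x : pt => 'D_u (aff l) x) = fun=> (l.1 *m u) 0 0.
    by apply/funext => x; exact: derive_aff.
  exact: smooth_cst.
- have -> : (fun x : pt => 'D_u (fun=> c) x) = fun=> 0; last exact: smooth_cst.
  by apply/funext => x; exact: derive_cst.
- rewrite (_ : (fun _ => _) = fun x => 'D_u f x + 'D_u g x); first exact: smoothD.
  apply/funext => x; apply: deriveD; exact/diff_derivable/smooth_differentiable.
- rewrite (_ : (fun _ => _) = fun x => f x * 'D_u g x + g x * 'D_u f x).
    by apply: smoothD; exact: smoothM.
  apply/funext => x; apply: deriveM; exact/diff_derivable/smooth_differentiable.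
- rewrite (_ : (fun _ => _) = fun x => - ((f x)^-1 * (f x)^-1) * 'D_u f x).
    by apply: smoothM => //; apply: smoothN; apply: smoothM; exact: smoothV.
  apply/funext => x; rewrite deriveV ?gt_eqF//; last exact/diff_derivable/smooth_differentiable.
  by rewrite /GRing.scale /= expr2 invfM.
Qed.

Lemma smooth_Cn f n : smooth f -> Cn n f.
Proof.
elim: n f => [|n ih] f sf /=.
  by move=> x; exact/differentiable_continuous/smooth_differentiable.
split; first exact: smooth_differentiable.
by move=> u; apply: ih; exact: smooth_derive.
Qed.

Lemma smooth_prod (I : Type) (r : seq I) (f : I -> pt -> R) :
  (forall i, smooth (f i)) -> smooth (fun x => \prod_(i <- r) f i x).
Proof.
move=> sf; elim: r => [|i r ih].
  rewrite (_ : (fun _ => _) = fun=> 1); first exact: smooth_cst.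
  by apply/funext => x; rewrite big_nil.
rewrite (_ : (fun _ => _) = fun x => f i x * \prod_(j <- r) f j x).
  exact: smoothM.
by apply/funext => x; rewrite big_cons.
Qed.

End Smooth.

(** ** Cutoffs of polyhedra *)

Section Cutoffs.
Context {R : realType}.
Local Notation pt := 'cV[R]_3.
Implicit Types (ls : seq ('rV[R]_3 * R)) (f : pt -> R).

Definition cbox (lo hi : pt) : set pt :=
  [set x | forall i, lo i 0 <= x i 0 <= hi i 0].

Lemma cbox_compact lo hi : compact (cbox lo hi).
Proof.
have -> : cbox lo hi = (fun w : 'rV[R]_3 => w^T) @`
    [set w : 'rV[R]_3 | forall i, `[lo i 0, hi i 0]%classic (w ord0 i)].
  apply/seteqP; split => [x hx|_ [w hw <-] i].
    by exists x^T; [move=> i /=; rewrite in_itv/= mxE; exact: hx|rewrite trmxK].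
  by have := hw i; rewrite /= in_itv/= mxE.
apply: continuous_compact; last first.
  apply: (@rV_compact R 3 (fun i => `[lo i 0, hi i 0]%classic)) => i.
  exact: segment_compact.
apply: continuous_subspaceT => w A [P hP PA].
exists (fun i j => P j i) => [i j /=|v hv]; first by have := hP j i; rewrite mxE.
by apply: PA => i j; rewrite mxE; exact: hv.
Qed.

Lemma smooth_continuous f : smooth f -> continuous f.
Proof. by move=> sf x; exact/differentiable_continuous/smooth_differentiable. Qed.

Lemma smooth_bounded f lo hi : smooth f ->
  exists C, forall x, cbox lo hi x -> `|f x| <= C.
Proof.
move=> sf.
have /compact_bounded[C [_ hC]] : compact (f @` cbox lo hi).
  apply: continuous_compact; last exact: cbox_compact.
  by apply: continuous_subspaceT; exact: smooth_continuous.
exists (C + 1) => x hx; apply: (hC (C + 1)); first by rewrite ltrDl.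
by exists x.
Qed.

(** Directional derivatives as derivatives of functions of one variable. *)
Lemma is_derive_line f (x e : pt) (s : R) : derivable f (s *: e + x) e ->
  is_derive s (1 : R) (fun s : R => f (s *: e + x)) ('D_e f (s *: e + x)).
Proof.
move=> dv.
have E : (fun h : R => h^-1 *: (f ((h *: 1 + s) *: e + x) - f (s *: e + x))) =
    (fun h : R => h^-1 *: (f (h *: e + (s *: e + x)) - f (s *: e + x))).
  by apply/funext => h; rewrite [h *: 1]mulr1 scalerDl addrA.
apply: DeriveDef; first by rewrite /derivable E.
by rewrite /derive E.
Qed.

Lemma smooth_lipschitz f lo hi (e : pt) : smooth f ->
  exists2 C, 0 <= C & forall x h, 0 <= h ->
    cbox lo hi x -> cbox lo hi (x + h *: e) -> `|f (x + h *: e) - f x| <= C * h.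
Proof.
move=> sf; have [C hC] := smooth_bounded lo hi (smooth_derive e sf).
exists (Num.max C 0); first by rewrite le_max lexx orbT.
have dv x s : derivable f (s *: e + x) e.
  exact/diff_derivable/smooth_differentiable.
move=> x h h0 bx bxh.
have [|c ch] := @MVT_segment R (fun s => f (s *: e + x))
    (fun s => 'D_e f (s *: e + x)) 0 h h0 (fun s _ => is_derive_line (dv x s)).
  apply: continuous_subspaceT => s; apply: differentiable_continuous.
  by apply/derivable1_diffP; case: (is_derive_line (dv x s)).
rewrite scale0r add0r subr0 [h *: e + x]addrC => ->.
rewrite normrM (ger0_norm h0) ler_wpM2r//.
apply: le_trans (_ : C <= _); last by rewrite le_max lexx.
apply: hC => i; have := bx i; have := bxh i.
move: ch; rewrite in_itv/= => /andP[c0 ch]; rewrite !mxE => /andP[a b] /andP[a' b'].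
by apply/andP; split; have [ei|ei] := leP 0 (e i 0); nra.
Qed.

Definition step (t : R) : R := flat 0 t / (flat 0 t + flat 0 (1 - t)).

Lemma flat0_ge0 (t : R) : 0 <= flat 0 t.
Proof.
have [/(flat_le0 0)->//|/flat_gt0/ltW//] := leP t 0.
Qed.

Lemma step_den_gt0 (t : R) : 0 < flat 0 t + flat 0 (1 - t).
Proof.
have [t0|t0] := leP t 0.
  by rewrite ltr_wpDl ?flat0_ge0// flat_gt0// subr_gt0 (le_lt_trans t0).
by rewrite ltr_pwDl ?flat0_ge0// flat_gt0.
Qed.

Lemma step_ge0 t : 0 <= step t.
Proof. by rewrite divr_ge0 ?flat0_ge0// ltW// step_den_gt0. Qed.

Lemma step_le1 t : step t <= 1.
Proof. by rewrite ler_pdivrMr ?step_den_gt0// mul1r lerDl flat0_ge0. Qed.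

Lemma step_le0 t : t <= 0 -> step t = 0.
Proof. by move=> t0; rewrite /step flat_le0// mul0r. Qed.

Lemma step_ge1 t : 1 <= t -> step t = 1.
Proof.
move=> t1; rewrite /step (@flat_le0 _ _ (1 - t)) ?subr_le0// addr0 divff//.
by rewrite gt_eqF// flat_gt0// (lt_le_trans _ t1).
Qed.

Lemma aff_scale l (c d : R) x : aff (c *: l.1, c * l.2 + d) x = c * aff l x + d.
Proof. by rewrite /aff /= -scalemxAl mxE mulrDr addrA. Qed.

(** Smooth approximation from inside of the indicator function of the open
   polyhedron where all the [l] of [ls] are positive. *)
Definition cut n ls (x : pt) : R :=
  \prod_(l <- ls) step (n.+1%:R * aff l x - 1).

Lemma smooth_cut n ls : smooth (cut n ls).
Proof.
apply: smooth_prod => l; pose m := n.+1%:R : R.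
have -> : (fun x : pt => step (m * aff l x - 1)) = (fun x =>
    flat 0 (aff (m *: l.1, m * l.2 - 1) x) *
    (flat 0 (aff (m *: l.1, m * l.2 - 1) x) +
     flat 0 (aff (- m *: l.1, - m * l.2 + 2) x))^-1).
  apply/funext => x; rewrite !aff_scale /step; congr (_ / (_ + flat 0 _)); ring.
apply: smoothM; first exact: smooth_flat.
apply: smoothV; first by apply: smoothD; exact: smooth_flat.
move=> x; rewrite !aff_scale.
have -> : - m * aff l x + 2 = 1 - (m * aff l x - 1) by ring.
exact: step_den_gt0.
Qed.

Lemma cut_ge0 n ls x : 0 <= cut n ls x.
Proof. by apply: prodr_ge0 => l _; exact: step_ge0. Qed.

Lemma cut_le1 n ls x : cut n ls x <= 1.
Proof. by apply: prodr_ile1 => l _; rewrite step_ge0 step_le1. Qed.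

Lemma cut_neq0 n ls x : cut n ls x != 0 ->
  {in ls, forall l, n.+1%:R^-1 <= aff l x}.
Proof.
move=> h l lls; rewrite leNgt; apply: contra h => al.
rewrite /cut (big_rem l)//= step_le0 ?mul0r// subr_le0.
by rewrite -ler_pdivlMl// mulr1 ltW.
Qed.

Lemma cut_eq1 n ls x : {in ls, forall l, 2 * n.+1%:R^-1 <= aff l x} ->
  cut n ls x = 1.
Proof.
move=> h; rewrite /cut big_seq big1// => l /h al; apply: step_ge1.
rewrite lerBrDr -ler_pdivrMl//; apply: le_trans al.
by rewrite mulrC.
Qed.

Definition polyhedron ls : set pt := [set x | {in ls, forall l, 0 < aff l x}].

Lemma polyhedron_unif ls x : polyhedron ls x ->
  exists2 d, 0 < d & {in ls, forall l, d <= aff l x}.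
Proof.
elim: ls => [|l ls ih] h; first by exists 1.
have [|d d0 hd] := ih; first by move=> k kls; apply: h; rewrite inE kls orbT.
exists (Num.min d (aff l x)); first by rewrite lt_min d0 h// inE eqxx.
move=> k; rewrite inE => /predU1P[->|/hd dk]; first by rewrite ge_min lexx orbT.
by rewrite ge_min dk.
Qed.

Lemma cut_cvg ls x : polyhedron ls x -> \forall n \near \oo, cut n ls x = 1.
Proof.
move=> /polyhedron_unif[d d0 hd].
near=> n; apply: cut_eq1 => l /hd; apply: le_trans.
rewrite mulrC ler_pdivrMl// -ler_pdivrMr//.
have : 2 / d < n%:R by near: n; exact: nbhs_infty_gtr.
by move=> /ltW /le_trans; apply; rewrite ler_nat.
Unshelve. all: by end_near.
Qed.

Lemma closed_aff_ge l (c : R) : closed [set x | c <= aff l x].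
Proof.
have -> : [set x | c <= aff l x] = aff l @^-1` [set y | c <= y] by [].
apply: (@closed_comp _ _ (aff l)); last exact: closed_ge.
by move=> x _; exact/differentiable_continuous/differentiable_aff.
Qed.

(** The support is kept away from the faces by [c], hence compact. *)
Lemma test_fun_polyhedron (U : set pt) ls (c : R) lo hi psi :
  smooth psi -> 0 < c ->
  (forall x, psi x != 0 -> {in ls, forall l, c <= aff l x}) ->
  (forall x, polyhedron ls x -> U x /\ cbox lo hi x) ->
  test_fun U psi.
Proof.
move=> spsi c0 hpsi hU; split; first by move=> n; exact: smooth_Cn.
pose K := [set x | {in ls, forall l, c <= aff l x}].
have KP x : K x -> polyhedron ls x.
  by move=> Kx l /Kx; exact: lt_le_trans.
exists K; split.
- apply: (subclosed_compact _ (@cbox_compact lo hi)); last first.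
    by move=> x /KP /hU[].
  have -> : K = \bigcap_(l in [set` ls]) [set x | c <= aff l x].
    by apply/seteqP; split => x h l lls; exact: h.
  by apply: closed_bigI => l _; exact: closed_aff_ge.
- by move=> x /KP /hU[].
- by move=> x Kx; apply: contra_notP Kx => /eqP; exact: hpsi.
Qed.

End Cutoffs.

(** * Integration by parts *)

Section IntegrationByParts.
Context {R : realType}.
Local Notation pt := 'cV[R]_3.
Implicit Types (f g : pt -> R) (lo hi : pt).

(** A limit almost everywhere is measurable once modified on the null set of
   divergence. *)
Lemma ae_mfun_cvg (fn : nat -> pt -> R) f : (forall n, mfun (fn n)) ->
  aeL (fun x => fn n x @[n --> \oo] --> f x) ->
  exists2 f0, mfun f0 & aeL (fun x => f x = f0 x).
Proof.
move=> mfn [N [mN N0 fnf]].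
pose A : set pt := [set x | ~ N (of_pt x)].
have mA : mset A.
  rewrite /mset (_ : pt_of @^-1` A = ~` N); first exact: measurableC.
  by apply/seteqP; split => z /=; rewrite /A/= pt_ofK.
exists (fun x => \1_A x * f x).
  apply: (measurable_fun_cvg (h := fun n => (fun x => \1_A x * fn n x) \o pt_of)).
    by move=> n; apply: mfunM => //; exact: mfun_indic.
  move=> z _; apply: (cvg_trans (G := (\1_A (pt_of z) * fn n (pt_of z)) @[n --> \oo])).
    by apply: near_eq_cvg; near=> n.
  rewrite /=; have [zN|zN] := pselect (N z); last first.
    by apply: cvgMr; apply: contrapT => h; apply: zN; exact: fnf.
  have -> : \1_A (pt_of z) = 0 :> R.
    by rewrite indicE memNset// /A/= pt_ofK; apply.
  by apply: cvg_near_cst; near=> n; rewrite !mul0r.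
exists N; split => // z /=; apply: contra_notP => zN.
by rewrite indicE mem_set ?mul1r// /A/= pt_ofK.
Unshelve. all: by end_near.
Qed.

Lemma integ_cvg_bounded (fn : nat -> pt -> R) f lo hi C :
  (forall n, mfun (fn n)) -> (forall n x, `|fn n x| <= C) ->
  (forall n x, ~ obox lo hi x -> fn n x = 0) ->
  aeL (fun x => fn n x @[n --> \oo] --> f x) ->
  ae_integrable f /\ integ (fn n) @[n --> \oo] --> integ f.
Proof.
move=> mfn fnC fn0 fnf.
have C0 : 0 <= C by apply: le_trans (fnC 0%N 0).
have ifn n : integrable3 (fn n).
  exact: (integrable3_bounded (mfn n) (fnC n) (fn0 n)).
have [f0 mf0 ff0] := ae_mfun_cvg mfn fnf.
pose b := \1_(obox lo hi) : pt -> R.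
(* Truncation makes a limit that is bounded almost everywhere bounded. *)
pose f1 := fun x => b x * Num.max (- C) (Num.min C (f0 x)).
have if1 : ae_integrable f1.
  apply: integrable3_ae; apply: (@integrable3_bounded _ _ lo hi C).
  - apply: mfunM; first exact: mfun_indic (mset_obox _ _).
    apply: measurable_maxr; first exact: measurable_cst.
    by apply: measurable_minr; first exact: measurable_cst.
  - move=> x; rewrite /f1 /b indicE; case: (_ \in _); rewrite ?mul0r ?normr0//.
    rewrite mul1r ler_norml le_max lexx /= ge_max ge_min lexx andbT.
    by rewrite lerNl (le_trans _ C0)// oppr_le0.
  - by move=> x h; rewrite /f1 /b indicE memNset// mul0r.
have ff1 : aeL (fun x => f x = f1 x).
  apply: aeLS (aeL_and fnf ff0) => x [fnfx ffx].
  have fC : `|f x| <= C.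
    apply: (closed_cvg (fun y => y <= C) (@closed_le _ C) _ _ (cvg_norm fnfx)).
    by near=> n; exact: fnC.
  rewrite /f1 /b indicE; have [bx|bx] := pselect (obox lo hi x).
    rewrite mem_set// mul1r -ffx; move: fC; rewrite ler_norml => /andP[h1 h2].
    by rewrite min_r// max_r.
  rewrite memNset// mul0r; apply/esym; move: fnfx; apply: cvg_unique => //.
  rewrite (_ : (fun n => _) = fun=> 0); first exact: cvg_cst.
  by apply/funext => n; exact: fn0.
have fi := ae_integrable_eq ff1 if1.
split=> //.
apply: (@integ_cvg _ fn f (fun x => C * b x)) => //.
- by move=> n; exact: integrable3_ae.
- apply: ae_integrableZ; apply: integrable3_ae.
  exact: (integrable3_indic (@mset_obox _ lo hi) (@subset_refl _ _)).
- move=> n; apply: aeLW => x; rewrite /b indicE.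
  have [bx|bx] := pselect (obox lo hi x); first by rewrite mem_set// mulr1.
  by rewrite fn0// normr0 mulr_ge0.
Unshelve. all: by end_near.
Qed.

Local Notation e i := (delta_mx i 0 : pt).

(** Half-open in the direction [i], so that translates in this direction can be
   glued together. *)
Definition slab lo hi (i : 'I_3) (a b : R) : set pt :=
  [set x | forall j, if j == i then a <= x j 0 < b
                     else lo j 0 < x j 0 < hi j 0].

Lemma shiftE (x : pt) (t : R) i j :
  (x + t *: e i) j 0 = x j 0 + t * (j == i)%:R.
Proof. by rewrite !mxE eqxx andbT. Qed.

Lemma slab_shift lo hi i a b t x :
  \1_(slab lo hi i a b) (x + t *: e i) =
  \1_(slab lo hi i (a - t) (b - t)) x :> R.
Proof.
rewrite !indicE; congr (_%:R); congr (nat_of_bool _).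
apply/idP/idP; rewrite !inE => h j; have := h j; rewrite shiftE;
  case: eqP => _; rewrite ?mulr0 ?addr0// mulr1.
- by rewrite lerBlDr ltrBrDr.
- by rewrite lerBlDr ltrBrDr.
Qed.

Lemma slab_split lo hi i a b c x : a <= b -> b <= c ->
  \1_(slab lo hi i a c) x =
  \1_(slab lo hi i a b) x + \1_(slab lo hi i b c) x :> R.
Proof.
move=> ab bc.
have [h|h] := pselect (forall j, j != i -> lo j 0 < x j 0 < hi j 0); last first.
  by rewrite !indicE !memNset ?addr0// => h'; apply: h => j ji; have := h' j;
    rewrite (negbTE ji).
have E a' b' : (x \in slab lo hi i a' b') = (a' <= x i 0 < b').
  apply/idP/idP; rewrite inE; first by move=> /(_ i); rewrite eqxx.
  by move=> h' j; case: eqP => [->|/eqP /h].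
rewrite !indicE !E; have [xb|xb] := ltP (x i 0) b.
  by rewrite (lt_le_trans xb bc) addr0.
by rewrite (le_trans ab xb) add0r.
Qed.

Lemma mset_slab lo hi i a b : mset (slab lo hi i a b).
Proof.
apply: mset_fin_bigcap => j; rewrite /mset -[X in measurable X]setTI.
case: (j == i).
  have -> : pt_of @^-1` [set x : pt | a <= x j 0 < b] =
    ((fun x : pt => x j 0) \o pt_of) @^-1` `[a, b[ by apply/seteqP; split => z /=; rewrite in_itv.
  by apply: mfun_coord.
have -> : pt_of @^-1` [set x : pt | lo j 0 < x j 0 < hi j 0] =
    ((fun x : pt => x j 0) \o pt_of) @^-1` `]lo j 0, hi j 0[ by apply/seteqP; split => z /=; rewrite in_itv.
by apply: mfun_coord.
Qed.

Lemma aff_coord (i : 'I_3) (c : R) x : aff (delta_mx 0 i, c) x = x i 0 + c.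
Proof. by rewrite /aff /= -rowE mxE. Qed.

Lemma aeL_coord_neq (i : 'I_3) (c : R) : aeL (fun x : pt => x i 0 != c).
Proof.
have := @aeL_aff_neq0 R (delta_mx 0 i, - c).
have -> : (delta_mx 0 i, - c).1 != 0 :> 'rV[R]_3.
  by apply/eqP => /rowP/(_ i)/eqP; rewrite !mxE !eqxx /= oner_eq0.
by move=> /(_ isT); apply: aeLS => x; rewrite aff_coord subr_eq0.
Qed.

Lemma aeL_slab lo hi i :
  aeL (fun x => \1_(slab lo hi i (lo i 0) (hi i 0)) x = \1_(obox lo hi) x :> R).
Proof.
apply: aeLS (aeL_coord_neq i (lo i 0)) => x xi.
rewrite !indicE; congr (_%:R); congr (nat_of_bool _).
apply/idP/idP; rewrite !inE => h j; have := h j.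
  case: eqP => // -> /andP[h1 ->]; rewrite andbT lt_neqAle h1 andbT.
  by rewrite eq_sym.
by move=> /andP[h1 h2]; case: eqP => [<-|]; rewrite ?h2 ?h1 ?ltW.
Qed.

(** Translating the integral of [f (x + h *: e i)] by [h] leaves the integral of
   [f] over a box moved by [h], which loses a thin layer at the lower face and
   gains one at the upper face: the two layers compensate when [f] has the same
   values on both.  Thus difference quotients have mean zero, and they are
   bounded by the Lipschitz constant.  As the layers are as thin as
   the increment, it is enough to compare values at a distance less than [d] from
   the lower face. *)
Lemma integ_derive_box lo hi (i : 'I_3) f g (K C d : R) :
  mfun f ->
  (forall j, lo j 0 < hi j 0) -> 0 <= C -> 0 < d ->
  (forall x, cbox (lo - const_mx 1) (hi + const_mx 1) x -> `|f x| <= K) ->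
  (forall (x : pt) h, 0 <= h <= 1 -> cbox lo hi x ->
    `|f (x + h *: e i) - f x| <= C * h) ->
  (forall x : pt, (forall j, j != i -> lo j 0 < x j 0 < hi j 0) ->
    lo i 0 <= x i 0 < lo i 0 + d -> f (x + (hi i 0 - lo i 0) *: e i) = f x) ->
  aeL (fun x => obox lo hi x ->
    n.+1%:R * (f (x + n.+1%:R^-1 *: e i) - f x) @[n --> \oo] --> g x) ->
  ae_integrable (fun x => \1_(obox lo hi) x * g x) /\
  integ (fun x => \1_(obox lo hi) x * g x) = 0.
Proof.
move=> mf lohi C0 d0 fK fC fper fg.
pose B a b : pt -> R := \1_(slab lo hi i a b).
pose Bi := B (lo i 0) (hi i 0).
pose F n x := Bi x * (n.+1%:R * (f (x + n.+1%:R^-1 *: e i) - f x)).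
have n0 n : 0 < n.+1%:R :> R by [].
have h0 n : 0 <= (n.+1%:R^-1 : R) <= 1.
  by rewrite invr_ge0 ltW//= invf_le1// ler1n.
have mshift t : mfun (fun x => f (x + t *: e i)).
  rewrite /mfun; pose s := @shift3 R (of_pt (t *: e i)).
  apply: (eq_measurable_fun ((f \o pt_of) \o s)).
    by move=> z _; rewrite /= pt_of_shift of_ptK.
  exact: (measurableT_comp mf (@measurable_shift3 R _)).
have mB a b : mfun (B a b) by apply: mfun_indic; exact: mset_slab.
have mF n : mfun (F n).
  apply: mfunM; first exact: mB.
  apply: mfunM; first exact: mfun_cst.
  apply: mfunD; first exact: mshift.
  by apply: (measurableT_comp (@oppr_measurable R setT)).
have Bcbox x : slab lo hi i (lo i 0) (hi i 0) x -> cbox lo hi x.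
  move=> hx j; have := hx j; case: eqP => [->/andP[-> /ltW ->]//|_ /andP[]].
  by move=> /ltW -> /ltW ->.
have FC n x : `|F n x| <= C.
  rewrite /F /Bi /B indicE; have [bx|bx] := pselect (slab lo hi i (lo i 0) (hi i 0) x).
    rewrite mem_set// mul1r normrM (gtr0_norm (n0 n)) mulrC -ler_pdivlMr//.
    by apply: fC => //; exact: Bcbox.
  by rewrite memNset// mul0r normr0.
pose lo1 := lo - const_mx 1; pose hi1 := hi + const_mx 1.
have slab1 a b x : lo i 0 <= a -> b <= hi i 0 + 1 -> slab lo hi i a b x ->
    obox lo1 hi1 x.
  move=> la bh hx j; rewrite !mxE; have := hx j; have := lohi j.
  by case: eqP => [->|_] => h1 /andP[h2 h3]; apply/andP; split; lra.
have F0 n x : ~ obox lo1 hi1 x -> F n x = 0.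
  move=> hx; rewrite /F /Bi /B indicE memNset ?mul0r// => /slab1; apply: contra_not hx.
  by move=> h; apply: h => //; rewrite lerDl.
have Fg : aeL (fun x => F n x @[n --> \oo] --> \1_(obox lo hi) x * g x).
  apply: aeLS (aeL_and (aeL_slab lo hi i) fg) => x [Bx fgx].
  rewrite /F /Bi /B Bx indicE; have [bx|bx] := pselect (obox lo hi x).
    by apply: cvgMr; exact: fgx.
  by rewrite memNset//; apply: cvg_near_cst; near=> n; rewrite !mul0r.
have [gi Fcvg] := integ_cvg_bounded mF FC F0 Fg.
split=> //.
have Bfi a b : lo i 0 <= a -> b <= hi i 0 + 1 -> integrable3 (fun x => B a b x * f x).
  move=> la bh; apply: (@integrable3_bounded _ _ lo1 hi1 `|K|).
  - by apply: mfunM => //; exact: mB.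
  - move=> x; rewrite /B indicE; have [bx|bx] := pselect (slab lo hi i a b x).
      rewrite mem_set// mul1r; apply: le_trans (ler_norm K); apply: fK => j.
      by have /andP[/ltW -> /ltW ->] := slab1 _ _ _ la bh bx j.
    by rewrite memNset// mul0r normr0.
  - move=> x hx; rewrite /B indicE memNset ?mul0r// => /slab1; apply: contra_not hx.
    by apply.
have L0 : 0 < hi i 0 - lo i 0 by rewrite subr_gt0.
apply/esym; move: Fcvg; apply: cvg_unique => //.
apply: cvg_near_cst; near=> n.
pose h : R := n.+1%:R^-1.
have hn0 : 0 < h by rewrite invr_gt0.
have hd : h <= d by rewrite /h; apply: ltW; near: n; exact: (near_infty_natSinv_lt (PosNum d0)).
have hL : h <= hi i 0 - lo i 0.
  by rewrite /h; apply: ltW; near: n; exact: (near_infty_natSinv_lt (PosNum L0)).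
have h1 : h <= 1 by have /andP[] := h0 n.
have -> : integ (F n) = n.+1%:R *
    (integ (fun x => Bi x * f (x + h *: e i)) - integ (fun x => Bi x * f x)).
  have i1 : integrable3 (fun x => Bi x * f (x + h *: e i)).
    apply: (@integrable3_bounded _ _ lo1 hi1 `|K|).
    - by apply: mfunM => //; exact: mB.
    - move=> x; rewrite /Bi /B indicE.
      have [bx|bx] := pselect (slab lo hi i (lo i 0) (hi i 0) x).
        rewrite mem_set// mul1r; apply: le_trans (ler_norm K); apply: fK => j.
        rewrite shiftE !mxE; have := Bcbox _ bx j; have := lohi j.
        by case: eqP => [->|_] ? /andP[? ?]; apply/andP; split; rewrite /= ?mulr1n ?mulr0n ?mulr1 ?mulr0; lra.
      by rewrite memNset// mul0r normr0.
    - move=> x hx; rewrite /Bi /B indicE memNset ?mul0r// => /slab1; apply: contra_not hx.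
      by move=> hh; apply: hh => //; rewrite lerDl.
  have i2 : integrable3 (fun x => Bi x * f x) by apply: Bfi => //; rewrite lerDl.
  rewrite -integB; [|exact: integrable3_ae..].
  rewrite -integZ; last by apply: ae_integrableB; exact: integrable3_ae.
  by apply: eq_integ => x; rewrite /F mulrCA mulrBr.
rewrite (_ : integ _ - integ _ = 0) ?mulr0//; apply/eqP; rewrite subr_eq0; apply/eqP.
transitivity (integ (fun x => B (lo i 0 + h) (hi i 0 + h) x * f x)).
  rewrite -(@integ_shift _ (h *: e i) (fun x => B (lo i 0 + h) (hi i 0 + h) x * f x)).
    by apply: eq_integ => x; rewrite /B slab_shift !addrK.
  by apply: Bfi; [rewrite lerDl ltW|rewrite lerD2l].
have E : integ (fun x => B (lo i 0) (lo i 0 + h) x * f x) =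
         integ (fun x => B (hi i 0) (hi i 0 + h) x * f x).
  rewrite -(@integ_shift _ ((hi i 0 - lo i 0) *: e i)
    (fun x => B (hi i 0) (hi i 0 + h) x * f x)); last first.
    by apply: Bfi; [rewrite ltW|rewrite lerD2l].
  apply: eq_integ => x; rewrite /B slab_shift.
  have -> : hi i 0 - (hi i 0 - lo i 0) = lo i 0 by ring.
  have -> : hi i 0 + h - (hi i 0 - lo i 0) = lo i 0 + h by ring.
  rewrite !indicE; have [sx|sx] := pselect (slab lo hi i (lo i 0) (lo i 0 + h) x).
    rewrite mem_set// fper//.
      by move=> j ji; have := sx j; rewrite (negbTE ji).
    by have := sx i; rewrite eqxx => /andP[-> /=] /lt_le_trans; apply; rewrite lerD2l.
  by rewrite memNset// !mul0r.
have lh := lohi i.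
have i1 : ae_integrable (fun x => B (lo i 0) (lo i 0 + h) x * f x).
  by apply: integrable3_ae; apply: Bfi => //; lra.
have i2 : ae_integrable (fun x => B (hi i 0) (hi i 0 + h) x * f x).
  by apply: integrable3_ae; apply: Bfi => //; lra.
have i3 : ae_integrable (fun x => B (lo i 0 + h) (hi i 0 + h) x * f x).
  by apply: integrable3_ae; apply: Bfi => //; lra.
have i4 : ae_integrable (fun x => B (lo i 0) (hi i 0) x * f x).
  by apply: integrable3_ae; apply: Bfi => //; lra.
apply: (addrI (integ (fun x => B (lo i 0) (lo i 0 + h) x * f x))).
rewrite -integD// E -integD//; apply: eq_integ => x.
rewrite -!mulrDl; congr (_ * _); rewrite /Bi /B.
rewrite -slab_split; [|lra..].
by rewrite [RHS]addrC -slab_split; [|lra..].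
Unshelve. all: by end_near.
Qed.

End IntegrationByParts.

(** * Weak derivatives *)

Section WeakDerivatives.
Context {R : realType}.
Local Notation pt := 'cV[R]_3.
Local Notation e i := (delta_mx i 0 : pt).
Implicit Types (f g psi : pt -> R) (lo hi : pt) (ls : seq ('rV[R]_3 * R)).

Lemma ball_coord (x y : pt) (r : R) i : ball x r y -> `|x i 0 - y i 0| < r.
Proof. by case=> _ /(_ i 0). Qed.

Lemma coord_ball (x y : pt) (r : R) : 0 < r ->
  (forall i, `|x i 0 - y i 0| < r) -> ball x r y.
Proof. by move=> r0 h; split=> // i j; rewrite (ord1 j); exact: h. Qed.

Definition supp_in ls (c : R) psi :=
  forall x, psi x != 0 -> {in ls, forall l, c <= aff l x}.

Lemma supp_in0 ls c psi x : 0 < c -> supp_in ls c psi -> ~ polyhedron ls x ->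
  psi x = 0.
Proof.
move=> c0 h; apply: contra_notP => /eqP /h hx l /hx; exact: lt_le_trans.
Qed.

Lemma derive_supp_in ls c psi u x : 0 < c -> supp_in ls c psi ->
  ~ polyhedron ls x -> 'D_u psi x = 0.
Proof.
move=> c0 hpsi /existsNP[l /not_implyP[lls /negP]]; rewrite -leNgt => lx.
rewrite -(@derive_cst _ _ _ (0 : R) x u); apply: near_eq_derive.
have [/=] := @cvgr_lt _ _ (nbhs x) _ (aff l) _
  (differentiable_continuous (differentiable_aff l x)) c (le_lt_trans lx c0).
move=> r r0 hr; exists r => // y /hr /= yc.
by apply: contraTeq isT => /hpsi /(_ _ lls); rewrite leNgt yc.
Qed.

Lemma supp_inM ls c f g : supp_in ls c f -> supp_in ls c (fun x => f x * g x).
Proof. by move=> h x; rewrite mulf_eq0 negb_or => /andP[/h]. Qed.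

Lemma supp_in_cut n ls : supp_in ls n.+1%:R^-1 (cut n ls).
Proof. by move=> x; exact: cut_neq0. Qed.

Lemma quotient_cvg f i (x : pt) : derivable f x (e i) ->
  n.+1%:R * (f (x + n.+1%:R^-1 *: e i) - f x) @[n --> \oo] --> 'D_(e i) f x.
Proof.
move=> dv.
have h : (fun n : nat => (n.+1%:R^-1 : R)) @ \oo --> (0 : R)^'.
  move=> A [r /= r0 hr]; suff : \forall n \near \oo, A (n.+1%:R^-1) by [].
  near=> n.
  have n0 : (n.+1%:R^-1 : R) != 0 by rewrite invr_eq0.
  apply: hr => //=; rewrite sub0r normrN gtr0_norm//.
  by near: n; exact: (near_infty_natSinv_lt (PosNum r0)).
have := cvg_comp _ _ h dv; apply: cvg_trans; apply: near_eq_cvg.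
by near=> n; rewrite /= invrK [x + _]addrC.
Unshelve. all: by end_near.
Qed.

Lemma smooth_quotient f i x : smooth f ->
  n.+1%:R * (f (x + n.+1%:R^-1 *: e i) - f x) @[n --> \oo] --> 'D_(e i) f x.
Proof. by move=> sf; apply/quotient_cvg/diff_derivable/smooth_differentiable. Qed.

(** In a larger box the function vanishes near the faces. *)
Lemma integ_derive_smooth f i ls c lo hi : smooth f -> 0 < c ->
  supp_in ls c f -> (forall x, polyhedron ls x -> cbox lo hi x) ->
  (forall j, lo j 0 <= hi j 0) ->
  integ (fun x => 'D_(e i) f x) = 0.
Proof.
move=> sf c0 hf hls lohi.
pose lo1 := lo - const_mx 1; pose hi1 := hi + const_mx 1.
have f0 x : ~ cbox lo hi x -> f x = 0.
  by move=> hx; apply: (supp_in0 c0 hf) => /hls.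
have [K hK] := smooth_bounded (lo1 - const_mx 1) (hi1 + const_mx 1) sf.
have [C C0 hC] := smooth_lipschitz (lo1 - const_mx 1) (hi1 + const_mx 1) (e i) sf.
have lohi1 j : lo1 j 0 < hi1 j 0.
  by rewrite !mxE; have := lohi j; lra.
have hlip (x : pt) h : 0 <= h <= 1 -> cbox lo1 hi1 x -> `|f (x + h *: e i) - f x| <= C * h.
  move=> /andP[h0 h1] bx; apply: hC => // j; rewrite ?shiftE !mxE.
    by have /andP[] := bx j; rewrite !mxE; lra.
  have /andP[] := bx j; rewrite !mxE.
  by case: (j == i) => /=; rewrite ?mulr1 ?mulr0; lra.
have hper (x : pt) : (forall j, j != i -> lo1 j 0 < x j 0 < hi1 j 0) ->
    lo1 i 0 <= x i 0 < lo1 i 0 + 1 -> f (x + (hi1 i 0 - lo1 i 0) *: e i) = f x.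
  move=> _ /andP[h1 h2]; rewrite !f0//.
    by move=> /(_ i)/andP[]; move: h1 h2; rewrite !mxE; lra.
  move=> /(_ i)/andP[]; rewrite shiftE eqxx mulr1; move: h1 h2; rewrite !mxE.
  by have := lohi i; lra.
have [_ <-] := @integ_derive_box R lo1 hi1 i f (fun x => 'D_(e i) f x) K C 1
  (smooth_mfun sf) lohi1 C0 ltr01 hK hlip hper
  (aeLW (fun x _ => @smooth_quotient f i x sf)).
apply: eq_integ => x; rewrite indicE.
have [bx|bx] := pselect (obox lo1 hi1 x); first by rewrite mem_set// mul1r.
rewrite memNset// mul0r; apply: (derive_supp_in _ c0 hf) => /hls hx.
by apply: bx => j; rewrite !mxE; have /andP[] := hx j; lra.
Qed.

Lemma integrable3_mulb f psi (C : R) : integrable3 f -> mfun psi ->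
  (forall x, f x != 0 -> `|psi x| <= C) -> integrable3 (fun x => f x * psi x).
Proof.
move=> fi mpsi hC; apply: (@le_integrable3 _ _ (fun x => C * f x)).
- by apply: mfunM => //; exact: integrable3_mfun.
- move=> x; have [->|fx] := eqVneq (f x) 0; first by rewrite !(mul0r,mulr0).
  rewrite !normrM mulrC ler_wpM2r//; exact: le_trans (hC _ fx) (ler_norm _).
- exact: integrable3Z.
Qed.

Lemma integrable3_box_smooth lo hi f psi : smooth psi ->
  integrable3 (fun x => \1_(obox lo hi) x * f x) ->
  integrable3 (fun x => \1_(obox lo hi) x * (f x * psi x)).
Proof.
move=> spsi fi; have [C hC] := smooth_bounded lo hi spsi.
rewrite (_ : (fun _ => _) = fun x => (\1_(obox lo hi) x * f x) * psi x); last first.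
  by apply/funext => x; rewrite mulrA.
apply: (@integrable3_mulb _ _ C) => //; first exact: smooth_mfun.
move=> x; rewrite indicE; have [bx|bx] := pselect (obox lo hi x); last first.
  by rewrite memNset// mul0r eqxx.
by move=> _; apply: hC => j; have /andP[/ltW -> /ltW ->] := bx j.
Qed.

Lemma integrable3_norm f : integrable3 f -> integrable3 (fun x => `|f x|).
Proof.
move=> fi; apply: (le_integrable3 _ _ fi).
  by apply: mfun_comp; [exact: normr_measurable|exact: integrable3_mfun].
by move=> x; rewrite normr_id.
Qed.

Section Weak.
Variables (lo hi : pt) (w : pt -> R) (g : 'I_3 -> pt -> R).
Hypothesis lohi : forall j, lo j 0 < hi j 0.
Local Notation U := (obox lo hi).
Hypothesis gi : forall i, integrable3 (fun x => \1_U x * g i x).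
Hypothesis wg : forall i psi, smooth psi -> test_fun U psi ->
  integ (fun x => \1_U x * (w x * 'D_(e i) psi x)) =
  - integ (fun x => \1_U x * (g i x * psi x)).

Let gsum (u : pt) (x : pt) := \sum_i u i 0 * g i x.

Let gsumi u : integrable3 (fun x => \1_U x * gsum u x).
Proof.
have : integrable3 (fun x => \1_U x * (u (inord 0) 0 * g (inord 0) x) +
   \1_U x * (u (inord 1) 0 * g (inord 1) x) + \1_U x * (u (inord 2) 0 * g (inord 2) x)).
  do 2?apply: integrable3D; under [X in integrable3 X]funext do rewrite mulrCA;
   exact: integrable3Z.
apply: eq_integrable => // z _ /=.
by rewrite /gsum sum_ord3 !mulrDr.
Qed.

Lemma smooth_supported_integrable f ls : (forall x, polyhedron ls x -> U x) ->
  smooth f -> (forall x, ~ polyhedron ls x -> f x = 0) -> ae_integrable f.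
Proof.
move=> lsU sf f0; have [C hC] := smooth_bounded lo hi sf.
apply: integrable3_ae; apply: (@integrable3_bounded _ _ lo hi (Num.max C 0)).
- exact: smooth_mfun.
- move=> x; have [/lsU lx|lx] := pselect (polyhedron ls x); last first.
    by rewrite f0// normr0 le_max lexx orbT.
  by rewrite le_max hC// => j; have /andP[/ltW -> /ltW ->] := lx j.
- by move=> x hx; apply: f0 => /lsU.
Qed.

(** The product of [psi] by the affine function is smooth with the same support,
   so that it can be integrated by parts classically. *)
Lemma weak_derivative_affine (l : 'rV[R]_3 * R) ls c psi i :
  (forall x, polyhedron ls x -> U x) ->
  aeL (fun x => polyhedron ls x -> w x = aff l x) ->
  smooth psi -> 0 < c -> supp_in ls c psi ->
  integ (fun x => \1_U x * (g i x * psi x)) = l.1 0 i * integ psi.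
Proof.
move=> lsU wl spsi c0 hpsi.
have lsbox x : polyhedron ls x -> cbox lo hi x.
  by move=> /lsU hx j; have /andP[/ltW -> /ltW ->] := hx j.
have tpsi : test_fun U psi.
  by apply: (test_fun_polyhedron (lo := lo) (hi := hi) spsi c0 hpsi) => x hx; split;
    [exact: lsU|exact: lsbox].
apply: oppr_inj; rewrite -wg//.
have E : integ (fun x => \1_U x * (w x * 'D_(e i) psi x)) =
    integ (fun x => aff l x * 'D_(e i) psi x).
  apply: integ_ae; apply: aeLS wl => x hx; rewrite indicE.
  have [lx|lx] := pselect (polyhedron ls x).
    by rewrite (mem_set (lsU _ lx)) mul1r hx.
  by rewrite (derive_supp_in _ c0 hpsi lx) !mulr0.
rewrite E; pose F x := psi x * aff l x.
have sF : smooth F by apply: smoothM => //; exact: smooth_aff.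
have F0 := @integ_derive_smooth F i ls c lo hi sF c0 (supp_inM (g := aff l) hpsi) lsbox (fun j => ltW (lohi j)).
have bnd f := @smooth_supported_integrable f ls lsU.
rewrite -integZ; last first.
  by apply: bnd => // x; exact: (supp_in0 c0 hpsi).
rewrite -[LHS]subr0 -F0 -integB.
- rewrite -integN; last first.
    apply: ae_integrableZ; apply: bnd => // x; exact: (supp_in0 c0 hpsi).
  apply: eq_integ => x.
  have dpsi : derivable psi x (e i) by exact/diff_derivable/smooth_differentiable.
  have dl : derivable (aff l) x (e i) by exact/diff_derivable/differentiable_aff.
  rewrite [in X in _ - X]deriveM// derive_aff /GRing.scale /=.
  by rewrite -colE mxE; ring.
- apply: bnd.
    by apply: smoothM; [exact: smooth_aff|exact: smooth_derive].
  by move=> x lx; rewrite (derive_supp_in _ c0 hpsi lx) mulr0.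
- apply: bnd; first exact: smooth_derive.
  move=> x lx; exact: (derive_supp_in _ c0 (supp_inM (g := aff l) hpsi) lx).
Qed.

Lemma ae_integrable_box_smooth f psi : smooth psi ->
  ae_integrable (fun x => \1_U x * f x) ->
  ae_integrable (fun x => \1_U x * (f x * psi x)).
Proof.
move=> spsi [f0 f0i ff0].
have i1 : integrable3 (fun x => \1_U x * f0 x).
  apply: (le_integrable3 _ _ f0i).
    by apply: mfunM; [exact: mfun_indic (mset_obox _ _)|exact: integrable3_mfun].
  move=> x; rewrite normrM indicE; case: (_ \in _) => /=; rewrite ?mulr1n ?mulr0n.
    by rewrite normr1 mul1r.
  by rewrite normr0 mul0r.
apply: (ae_integrable_eq _ (integrable3_ae (integrable3_box_smooth spsi i1))).
apply: aeLS ff0 => x; rewrite indicE; case: (x \in U); last by rewrite !mul0r.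
by rewrite !mul1r => ->.
Qed.

(** One minus the product of the complements, instead of a sum: the pieces may
   overlap, and peeling off the factors one by one leaves functions each supported
   in one piece, see [covered_cons]. *)
Definition covered n (Ts : seq (('rV[R]_3 * R) * seq ('rV[R]_3 * R))) (x : pt) : R :=
  1 - \prod_(t <- Ts) (1 - cut n t.2 x).

Lemma covered_cons n t Ts x :
  covered n (t :: Ts) x = cut n t.2 x + (1 - cut n t.2 x) * covered n Ts x.
Proof. by rewrite /covered big_cons; ring. Qed.

Lemma covered_ge0 n Ts x : 0 <= covered n Ts x <= 1.
Proof.
have h t : 0 <= 1 - cut n t x <= 1.
  by rewrite subr_ge0 cut_le1 lerBlDr lerDl cut_ge0.
rewrite /covered subr_ge0 lerBlDr lerDl prodr_ge0 ?andbT; last first.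
  by move=> t _; have /andP[] := h t.2.
by apply: prodr_ile1 => t _; exact: h.
Qed.

Lemma smooth_covered n Ts : smooth (covered n Ts).
Proof.
have s1 t : smooth (fun x => 1 - cut n t x).
  by apply: smoothD; [exact: smooth_cst|apply/smoothN/smooth_cut].
apply: smoothD; first exact: smooth_cst.
by apply/smoothN/smooth_prod => t; exact: s1.
Qed.

(** The difference of [g] and [h] is orthogonal to the functions supported in one
   piece, hence to the functions [covered n Ts], which tend to 1 almost
   everywhere. *)
Lemma weak_derivative_pieces (Ts : seq (('rV[R]_3 * R) * seq ('rV[R]_3 * R))) (u : pt) (h : pt -> R) :
  (forall t, t \in Ts -> forall x, polyhedron t.2 x -> U x) ->
  (forall t, t \in Ts -> aeL (fun x => polyhedron t.2 x -> w x = aff t.1 x)) ->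
  (forall t, t \in Ts ->
    forall x, polyhedron t.2 x -> h x = (t.1.1 *m u) 0 0) ->
  aeL (fun x => U x -> exists2 t, t \in Ts & polyhedron t.2 x) ->
  ae_integrable (fun x => \1_U x * h x) ->
  integ (fun x => \1_U x * \sum_i u i 0 * g i x) = integ (fun x => \1_U x * h x).
Proof.
move=> TsU Tsw Tsh Tscov hi'.
have gsi := integrable3_ae (gsumi u).
have di : ae_integrable (fun x => \1_U x * (gsum u x - h x)).
  apply: (ae_integrable_eq _ (ae_integrableB gsi hi')).
  by apply: aeLW => x; rewrite mulrBr.
have piece t psi c : t \in Ts -> smooth psi -> 0 < c -> supp_in t.2 c psi ->
    integ (fun x => \1_U x * ((gsum u x - h x) * psi x)) = 0.
  move=> tTs spsi c0 hpsi.
  have wd i := @weak_derivative_affine t.1 t.2 c psi i (TsU _ tTs) (Tsw _ tTs) spsi c0 hpsi.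
  have gpi i : ae_integrable (fun x => \1_U x * (g i x * psi x)).
    by apply: ae_integrable_box_smooth => //; exact: integrable3_ae.
  have psi0 x : ~ polyhedron t.2 x -> psi x = 0 by exact: (supp_in0 c0 hpsi).
  have psii := smooth_supported_integrable (TsU _ tTs) spsi psi0.
  transitivity (integ (fun x => \sum_i u i 0 * (\1_U x * (g i x * psi x)) -
     (t.1.1 *m u) 0 0 * psi x)).
    apply: eq_integ => x.
    have [lx|lx] := pselect (polyhedron t.2 x); last first.
      by rewrite psi0// !mulr0 subr0 big1// => i _; rewrite !mulr0.
    rewrite indicE (mem_set (TsU _ tTs _ lx)) mul1r mulrBl (Tsh _ tTs _ lx).
    by rewrite /gsum mulr_suml; congr (_ - _); apply: eq_bigr => i _; rewrite mul1r mulrA.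
  rewrite integB; last 2 first.
  - by apply: ae_integrable_sum => i _; exact: ae_integrableZ.
  - exact: ae_integrableZ.
  rewrite integ_sum; last by move=> i _; exact: ae_integrableZ.
  rewrite integZ// mxE mulr_suml -sumrB big1// => i _.
  by rewrite integZ// wd; ring.
have all0 n chi Ts' : {subset Ts' <= Ts} -> smooth chi ->
    integ (fun x => \1_U x * ((gsum u x - h x) * (chi x * covered n Ts' x))) = 0.
  elim: Ts' chi => [|t Ts' ih] chi sub schi.
    rewrite -[RHS]integ0; apply: eq_integ => x.
    by rewrite /covered big_nil subrr !mulr0.
  have sc : smooth (fun x => chi x * (1 - cut n t.2 x)).
    apply: smoothM => //; apply: smoothD; first exact: smooth_cst.
    exact/smoothN/smooth_cut.
  have i1 : ae_integrable (fun x => \1_U x * ((gsum u x - h x) * (cut n t.2 x * chi x))).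
    by apply: ae_integrable_box_smooth => //; apply: smoothM => //; exact: smooth_cut.
  have i2 : ae_integrable (fun x => \1_U x *
      ((gsum u x - h x) * (chi x * (1 - cut n t.2 x) * covered n Ts' x))).
    by apply: ae_integrable_box_smooth => //; apply: smoothM => //; exact: smooth_covered.
  rewrite -[RHS]addr0 -[X in X + _](piece t (fun x => cut n t.2 x * chi x) n.+1%:R^-1).
  - rewrite -[X in _ + X](ih (fun x => chi x * (1 - cut n t.2 x)))//.
      rewrite -integD//; apply: eq_integ => x; rewrite covered_cons; ring.
    by move=> t' t'Ts; apply: sub; rewrite inE t'Ts orbT.
  - by apply: sub; rewrite inE eqxx.
  - by apply: smoothM => //; exact: smooth_cut.
  - by rewrite invr_gt0.
  - by apply: supp_inM; exact: supp_in_cut.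
have all1 n : integ (fun x => \1_U x * ((gsum u x - h x) * covered n Ts x)) = 0.
  rewrite -[RHS](all0 n (fun=> 1) Ts)//; last exact: smooth_cst.
  by apply: eq_integ => x; rewrite mul1r.
have [d0 d0i dd0] := di.
have lim : integ (fun x => \1_U x * ((gsum u x - h x) * covered n Ts x)) @[n --> \oo]
    --> integ (fun x => \1_U x * (gsum u x - h x)).
  apply: (@integ_cvg _ _ _ (fun x => `|d0 x|)) => //.
  - move=> n; apply: ae_integrable_box_smooth => //; exact: smooth_covered.
  - by apply/integrable3_ae/integrable3_norm.
  - move=> n; apply: aeLS dd0 => x <-; rewrite mulrA normrM -[leRHS]mulr1.
    by have /andP[c0 c1] := covered_ge0 n Ts x; rewrite ler_wpM2l// ger0_norm.
  - apply: aeLS Tscov => x hx; have [Ux|Ux] := pselect (U x); last first.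
      rewrite indicE memNset// mul0r; apply: cvg_near_cst.
      by near=> n; rewrite mul0r.
    have [t tTs tx] := hx Ux.
    apply: cvg_near_cst; near=> n; rewrite /covered.
    have c1 : cut n t.2 x = 1 by near: n; exact: cut_cvg.
    by rewrite (big_rem t)//= c1 subrr mul0r subr0 mulr1.
have : integ (fun x => \1_U x * (gsum u x - h x)) = 0.
  apply/esym; move: lim; apply: cvg_unique => //; apply: cvg_near_cst.
  by near=> n; rewrite all1.
move=> /eqP; rewrite (_ : (fun x => _) = (fun x => \1_U x * gsum u x - \1_U x * h x)).
  by rewrite integB// subr_eq0 => /eqP.
by apply/funext => x; rewrite mulrBr.
Unshelve. all: by end_near.
Qed.

Definition box_faces : seq ('rV[R]_3 * R) :=
  [seq (delta_mx 0 i, - lo i 0) | i : 'I_3] ++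
  [seq (- delta_mx 0 i, hi i 0) | i : 'I_3].

Lemma aff_Ncoord (i : 'I_3) (c : R) x : aff (- delta_mx 0 i, c) x = c - x i 0.
Proof. by rewrite /aff /= mulNmx -rowE !mxE addrC. Qed.

Lemma box_facesP (P : R -> Prop) x :
  {in box_faces, forall l, P (aff l x)} <->
  (forall i, P (x i 0 - lo i 0) /\ P (hi i 0 - x i 0)).
Proof.
split=> [h i|h l].
  split; first by rewrite -aff_coord; apply: h; rewrite mem_cat map_f ?mem_enum.
  by rewrite -aff_Ncoord; apply: h; rewrite mem_cat orbC map_f ?mem_enum.
rewrite mem_cat => /orP[|] /mapP[i _ ->]; rewrite ?aff_coord ?aff_Ncoord;
  by have [] := h i.
Qed.

Lemma polyhedron_box x : polyhedron box_faces x <-> U x.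
Proof.
rewrite /polyhedron /= (box_facesP (fun r => 0 < r)).
split=> h i; have := h i; first by case; rewrite !subr_gt0 => -> ->.
by move=> /andP[]; rewrite !subr_gt0.
Qed.

(** The cutoffs [psi n] of the box are 1 on the core for large [n].  Then their
   derivatives see [w] only where it equals the periodic function [V], and [w]
   can be replaced by [V] in the weak formulation.  Integrating by parts once
   more, the product of [V] by [1 - psi n] is periodic, so that no boundary term
   appears, and what remains is the integral of the derivative of [V] against
   [1 - psi n], which tends to 0. *)
Lemma weak_derivative_mean0 (V : pt -> R) (G : 'I_3 -> pt -> R) (K C d : R)
    (core : set pt) i :
  mfun V -> (forall x, `|V x| <= K) -> 0 <= C ->
  (forall x h, 0 <= h -> `|V (x + h *: e i) - V x| <= C * h) ->
  (forall x : pt, (forall j, j != i -> lo j 0 < x j 0 < hi j 0) ->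
    lo i 0 <= x i 0 < hi i 0 -> V (x + (hi i 0 - lo i 0) *: e i) = V x) ->
  aeL (fun x => U x ->
    n.+1%:R * (V (x + n.+1%:R^-1 *: e i) - V x) @[n --> \oo] --> G i x) ->
  0 < d -> (forall x, core x -> forall j, lo j 0 + d <= x j 0 <= hi j 0 - d) ->
  aeL (fun x => U x -> ~ core x -> w x = V x) ->
  integ (fun x => \1_U x * g i x) = 0.
Proof.
move=> mV VK C0 VC Vper VG d0 coreU wV.
pose psi n := cut n box_faces.
have L0 : 0 < hi i 0 - lo i 0 by rewrite subr_gt0.
have spsi n : smooth (psi n) by exact: smooth_cut.
have psisupp n : supp_in box_faces n.+1%:R^-1 (psi n) by exact: supp_in_cut.
have n0 n : 0 < n.+1%:R^-1 :> R by rewrite invr_gt0.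
have psi0 n (x : pt) : x i 0 < lo i 0 + n.+1%:R^-1 \/ hi i 0 <= x i 0 -> psi n x = 0.
  move=> h; apply: contrapT => /eqP /psisupp.
  move=> /(box_facesP (fun r => n.+1%:R^-1 <= r)) /(_ i)[].
  move=> h1 h2; have h1' : n.+1%:R^-1 <= x i 0 - lo i 0 by exact: h1.
  have h2' : n.+1%:R^-1 <= hi i 0 - x i 0 by exact: h2.
  have h3 := n0 n; move: (n.+1%:R^-1 : R) h1' h2' h3 h => a h1' h2' h3.
  by case=> h4; lra.
have tpsi n : test_fun U (psi n).
  apply: (@test_fun_polyhedron _ U box_faces n.+1%:R^-1 lo hi _ (spsi n) (n0 n) (psisupp n)) => x hx0.
  have hx : U x := proj1 (@polyhedron_box x) hx0.
  by split=> // j; have /andP[/ltW -> /ltW ->] := hx j.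
have [G_i _] : ae_integrable (fun x => \1_U x * G i x) /\ integ (fun x => \1_U x * G i x) = 0.
  apply: (@integ_derive_box R lo hi i V (G i) K C (hi i 0 - lo i 0)) => //.
  - by move=> x h /andP[h0 _] _; exact: VC.
  - by move=> x hx; rewrite addrC subrK => hi'; exact: Vper.
have Vi : ae_integrable (fun x => \1_U x * V x).
  apply/integrable3_ae/(@integrable3_bounded _ _ lo hi K).
  - by apply: mfunM => //; exact: mfun_indic (mset_obox _ _).
  - move=> x; rewrite indicE; case: (_ \in _) => /=; rewrite ?mulr1n ?mulr0n ?mul1r//.
    by rewrite mul0r normr0; apply: le_trans (VK x).
  - by move=> x hx; rewrite indicE memNset// mul0r.
have step1 n : integ (fun x => \1_U x * (V x * 'D_(e i) (psi n) x)) =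
    integ (fun x => \1_U x * (G i x * (1 - psi n x))).
  have i1 : ae_integrable (fun x => \1_U x * (V x * 'D_(e i) (psi n) x)).
    by apply: ae_integrable_box_smooth => //; exact: smooth_derive.
  have i2 : ae_integrable (fun x => \1_U x * (G i x * (1 - psi n x))).
    apply: ae_integrable_box_smooth => //; apply: smoothD; first exact: smooth_cst.
    exact: smoothN.
  apply/eqP; rewrite eq_sym -subr_eq0 -integB//; apply/eqP.
  have [C' C'0 hC'] := smooth_lipschitz (lo - const_mx 1) (hi + const_mx 1) (e i) (spsi n).
  have K0 : 0 <= K by apply: le_trans (VK 0).
  have sp01 x : 0 <= psi n x <= 1 by rewrite cut_ge0 cut_le1.
  have dmin : 0 < Num.min n.+1%:R^-1 (hi i 0 - lo i 0) by rewrite lt_min n0.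
  have A1 : mfun (fun x => V x * (1 - psi n x)).
    apply: mfunM => //; apply: smooth_mfun; apply: smoothD; first exact: smooth_cst.
    exact: smoothN.
  have A2 (x : pt) : cbox (lo - const_mx 1) (hi + const_mx 1) x ->
      `|V x * (1 - psi n x)| <= K.
    move=> _; rewrite normrM -[leRHS]mulr1; apply: ler_pM => //.
    by have /andP[? ?] := sp01 x; rewrite ger0_norm; lra.
  (* Lipschitz bound of a product, the one of [psi n] depending on n. *)
  have A3 (x : pt) h : 0 <= h <= 1 -> cbox lo hi x ->
      `|V (x + h *: e i) * (1 - psi n (x + h *: e i)) - V x * (1 - psi n x)| <=
      (C + K * C') * h.
    move=> /andP[h0 h1] bx; set x' := x + h *: e i.
    have -> : V x' * (1 - psi n x') - V x * (1 - psi n x) =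
      (V x' - V x) * (1 - psi n x') - V x * (psi n x' - psi n x) by ring.
    apply: le_trans (ler_normB _ _) _; rewrite [leRHS]mulrDl !normrM; apply: lerD.
      rewrite -[leRHS]mulr1; apply: ler_pM => //; first exact: VC.
      by have /andP[? ?] := sp01 x'; rewrite ger0_norm; lra.
    rewrite -mulrA; apply: ler_pM => //; apply: hC' => // j; rewrite ?shiftE !mxE.
      by have /andP[] := bx j; lra.
    by have /andP[] := bx j; case: (j == i) => /=; rewrite ?mulr1 ?mulr0; lra.
  have A4 (x : pt) : (forall j, j != i -> lo j 0 < x j 0 < hi j 0) ->
    lo i 0 <= x i 0 < lo i 0 + Num.min n.+1%:R^-1 (hi i 0 - lo i 0) ->
    V (x + (hi i 0 - lo i 0) *: e i) * (1 - psi n (x + (hi i 0 - lo i 0) *: e i)) =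
    V x * (1 - psi n x).
    move=> hx /andP[h1 h2].
    have m1 : Num.min n.+1%:R^-1 (hi i 0 - lo i 0) <= n.+1%:R^-1 by rewrite ge_min lexx.
    have m2 : Num.min n.+1%:R^-1 (hi i 0 - lo i 0) <= hi i 0 - lo i 0.
      by rewrite ge_min lexx orbT.
    rewrite Vper//; last by rewrite h1; apply: (lt_le_trans h2); rewrite -lerBrDl.
    rewrite (psi0 n x); last by left; apply: (lt_le_trans h2); rewrite lerD2l.
    by rewrite psi0//; right; rewrite shiftE eqxx mulr1; lra.
  have A5 : aeL (fun x => U x -> m.+1%:R *
      (V (x + m.+1%:R^-1 *: e i) * (1 - psi n (x + m.+1%:R^-1 *: e i)) -
       V x * (1 - psi n x)) @[m --> \oo] -->
      G i x * (1 - psi n x) - V x * 'D_(e i) (psi n) x).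
    apply: aeLS VG => x hx Ux; have {hx}cV := hx Ux.
    have cp := @smooth_quotient (psi n) i x (spsi n).
    pose q1 m := m.+1%:R * (V (x + m.+1%:R^-1 *: e i) - V x).
    pose q2 m := m.+1%:R * (psi n (x + m.+1%:R^-1 *: e i) - psi n x).
    have c0 : (m.+1%:R^-1 : R) @[m --> \oo] --> (0 : R) by exact: cvg_harmonic.
    have cc : (q1 m * (1 - psi n x) - V x * q2 m - m.+1%:R^-1 * (q1 m * q2 m)) @[m --> \oo]
        --> G i x * (1 - psi n x) - V x * 'D_(e i) (psi n) x - 0 * (G i x * 'D_(e i) (psi n) x).
      apply: cvgB; first by apply: cvgB; [exact: cvgMl|exact: cvgMr].
      by apply: cvgM => //; exact: cvgM.
    move: cc; rewrite mul0r subr0; apply: cvg_trans; apply: near_eq_cvg; near=> m.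
    have m0 : m.+1%:R != 0 :> R by [].
    by rewrite /q1 /q2; field; rewrite nat1r.
  have [_ E0] := @integ_derive_box R lo hi i _ _ K (C + K * C') _ A1 lohi
    (addr_ge0 C0 (mulr_ge0 K0 C'0)) dmin A2 A3 A4 A5.
  by rewrite -[RHS]E0; apply: eq_integ => x /=; rewrite [RHS]mulrBr.
have step2 : \forall n \near \oo, integ (fun x => \1_U x * (g i x * psi n x)) =
    - integ (fun x => \1_U x * (G i x * (1 - psi n x))).
  near=> n; apply: oppr_inj; rewrite -wg// opprK -step1; apply: integ_ae.
  have nd : 2 * n.+1%:R^-1 < d.
    rewrite mulrC -ltr_pdivlMr//; near: n.
    have d20 : 0 < d / 2 by rewrite divr_gt0.
    exact: (near_infty_natSinv_lt (PosNum d20)).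
  apply: aeLS wV => x hx; rewrite indicE.
  have [Ux|Ux] := pselect (U x); last by rewrite memNset// !mul0r.
  rewrite mem_set// !mul1r; have [cx|/(hx Ux) -> //] := pselect (core x).
  suff -> : 'D_(e i) (psi n) x = 0 by rewrite !mulr0.
  rewrite -(@derive_cst _ _ _ (1 : R) x (e i)); apply: near_eq_derive.
  have d'0 : 0 < d - 2 * n.+1%:R^-1 by rewrite subr_gt0.
  apply/nbhs_ballP; exists (d - 2 * n.+1%:R^-1) => // y hy.
  apply: cut_eq1; apply/(box_facesP (fun r => 2 * n.+1%:R^-1 <= r)) => j.
  have := ball_coord j hy; rewrite ltr_norml => /andP[h1 h2].
  have /andP[h3 h4] := coreU _ cx j.
  by move: (2 * _) h1 h2 => a h1 h2; split; lra.
have [g0 G0i gg0] := G_i.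
have lim1 : integ (fun x => \1_U x * (g i x * psi n x)) @[n --> \oo] -->
    integ (fun x => \1_U x * g i x).
  apply: (@integ_cvg _ _ _ (fun x => `|\1_U x * g i x|)) => //.
  - by move=> n; apply: ae_integrable_box_smooth => //; exact: integrable3_ae.
  - exact: integrable3_ae.
  - exact/integrable3_ae/integrable3_norm.
  - move=> n; apply: aeLW => x; rewrite mulrA normrM -[leRHS]mulr1.
    by rewrite ler_wpM2l// ger0_norm ?cut_ge0// cut_le1.
  - apply: aeLW => x; have [Ux|Ux] := pselect (U x); last first.
      rewrite indicE memNset// mul0r; apply: cvg_near_cst.
      by near=> n; rewrite mul0r.
    apply: cvg_near_cst; near=> n.
    have -> : psi n x = 1; last by rewrite mulr1.
    by near: n; apply: cut_cvg; exact: (proj2 (@polyhedron_box x)).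
have lim2 : integ (fun x => \1_U x * (G i x * (1 - psi n x))) @[n --> \oo] --> integ (fun=> 0).
  apply: (@integ_cvg _ _ _ (fun x => `|g0 x|)) => //.
  - move=> n; apply: ae_integrable_box_smooth => //; apply: smoothD; first exact: smooth_cst.
    exact: smoothN.
  - exact: ae_integrable0.
  - exact/integrable3_ae/integrable3_norm.
  - move=> n; apply: aeLS gg0 => x <-; rewrite mulrA normrM -[leRHS]mulr1.
    rewrite ler_wpM2l// ger0_norm ?subr_ge0 ?cut_le1// lerBlDr lerDl.
    exact: cut_ge0.
  - apply: aeLW => x; have [Ux|Ux] := pselect (U x); last first.
      rewrite indicE memNset//; apply: cvg_near_cst.
      by near=> n; rewrite mul0r.
    apply: cvg_near_cst; near=> n.
    have -> : psi n x = 1; last by rewrite subrr !mulr0.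
    by near: n; apply: cut_cvg; exact: (proj2 (@polyhedron_box x)).
apply/esym; move: lim1; apply: cvg_unique => //.
have lim3 : - integ (fun x => \1_U x * (G i x * (1 - psi n x))) @[n --> \oo] --> (0 : R).
  by rewrite -oppr0 -integ0; exact: cvgN.
by apply: cvg_trans lim3; apply: near_eq_cvg; apply: filterS step2 => n ->.
Unshelve. all: by end_near.
Qed.

End Weak.

End WeakDerivatives.

(** * Tetrahedra *)

Section Barycentric.
Context {R : realType}.
Local Notation pt := 'cV[R]_3.
Local Notation tet := ('I_4 -> 'cV[R]_3).
Implicit Types (T : tet) (l : 'rV[R]_3 * R) (x : pt).

Lemma aff_convex l (I : finType) (w : I -> R) (T : I -> pt) : \sum_i w i = 1 ->
  aff l (\sum_i w i *: T i) = \sum_i w i * aff l (T i).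
Proof.
move=> w1; under [RHS]eq_bigr do rewrite /aff mulrDr.
rewrite big_split /= -mulr_suml w1 mul1r /aff mulmx_sumr summxE; congr (_ + _).
by apply: eq_bigr => i _; rewrite -scalemxAr mxE.
Qed.

(** The barycentric coordinates of a nondegenerate tetrahedron are affine on the
   whole space. *)
Record barycentric T (beta : 'I_4 -> 'rV[R]_3 * R) : Prop := {
  bary_sum : forall x, \sum_j aff (beta j) x = 1;
  bary_comb : forall x, \sum_j aff (beta j) x *: T j = x;
  bary_vertex : forall i j, aff (beta j) (T i) = (i == j)%:R }.

Lemma nondegenerate_barycentric T : Defs.nondegenerate T -> exists beta, barycentric T beta.
Proof.
rewrite /Defs.nondegenerate; set E := (X in \det X) => E0.
have EU : E \in unitmx by rewrite unitmxE unitfE.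
pose r k := row k (invmx E).
pose mu k : 'rV[R]_3 * R := (r k, - (r k *m T ord0) 0 0).
have muE k x : aff (mu k) x = (invmx E *m (x - T ord0)) k 0.
  by rewrite /aff /mu /r /= -!row_mul mulmxBr !mxE.
(* [mu] gives the coordinates in the basis of the edges issued from the vertex
   0, the coordinate of which is the complement to 1 of their sum. *)
pose beta j := if unlift ord0 j is Some k then mu k
  else (- \sum_k (mu k).1, 1 - \sum_k (mu k).2).
have b0 x : aff (beta ord0) x = 1 - \sum_k aff (mu k) x.
  rewrite /beta unlift_none /aff /= mulNmx mulmx_suml mxE summxE.
  by rewrite big_split /=; ring.
have bS k x : aff (beta (lift ord0 k)) x = aff (mu k) x by rewrite /beta liftK.
have muT k m : aff (mu k) (T (lift ord0 m)) = (m == k)%:R.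
  rewrite muE; have -> : T (lift ord0 m) - T ord0 = col m E.
    by apply/colP => i; rewrite !mxE.
  by rewrite colE mulmxA mulVmx// mul1mx !mxE eqxx andbT eq_sym.
have mu0 k : aff (mu k) (T ord0) = 0 by rewrite muE subrr mulmx0 mxE.
exists beta; split.
- move=> x; rewrite big_ord_recl b0; under [X in _ + X]eq_bigr do rewrite bS.
  by rewrite subrK.
- move=> x; rewrite big_ord_recl b0; under [X in _ + X]eq_bigr do rewrite bS.
  rewrite scalerBl scale1r scaler_suml -addrA -sumrN -big_split /=.
  under eq_bigr do rewrite addrC -scalerBr muE.
  rewrite -[RHS](subrKC (T ord0)); congr (_ + _).
  rewrite -[RHS]mul1mx -(mulmxV EU) -mulmxA.
  apply/colP => i; rewrite summxE mxE; apply: eq_bigr => k _.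
  by rewrite !mxE mulrC.
- move=> i j; case: (unliftP ord0 j) => [m|] ->; case: (unliftP ord0 i) => [n|] ->.
  + by rewrite bS muT (inj_eq (@lift_inj _ ord0)).
  + by rewrite bS mu0.
  + rewrite b0 (bigD1 n)//= muT eqxx big1 ?addr0 ?subrr// => k kn.
    by rewrite muT eq_sym (negbTE kn).
  + by rewrite b0 big1 ?subr0.
Qed.

Section WithBarycentric.
Variables (T : tet) (beta : 'I_4 -> 'rV[R]_3 * R).
Hypothesis hb : barycentric T beta.

Lemma bary_weights (w : 'I_4 -> R) j : \sum_i w i = 1 ->
  aff (beta j) (\sum_i w i *: T i) = w j.
Proof.
move=> w1; rewrite aff_convex// (bigD1 j)//= (bary_vertex hb) eqxx mulr1.
by rewrite big1 ?addr0// => i ij; rewrite (bary_vertex hb) (negbTE ij) mulr0.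
Qed.

Definition bary_faces := [seq beta j | j : 'I_4].

Lemma tetra_polyhedron x : tetra T x <-> polyhedron bary_faces x.
Proof.
split=> [[w [w0 w1 ->]] l /mapP[j _ ->]|h].
  by rewrite bary_weights//; have := w0 j.
exists (fun j => aff (beta j) x); split; rewrite ?(bary_sum hb) ?(bary_comb hb)//.
by move=> i /=; apply: h; rewrite map_f ?mem_enum.
Qed.

Lemma bary_nonconstant j : (beta j).1 != 0.
Proof.
apply/eqP => bj; have [i ij] : exists i : 'I_4, i != j.
  by case: (unliftP ord0 j) => [m|] ->; [exists ord0|exists ord_max].
have := bary_vertex hb i j; have := bary_vertex hb j j.
rewrite /aff bj !mul0mx !mxE eqxx (negbTE ij) !add0r => ->.
by move/eqP; rewrite oner_eq0.
Qed.

Lemma closure_tetra_ge0 x j : closure (tetra T) x -> 0 <= aff (beta j) x.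
Proof.
have cl := @closed_aff_ge R (beta j) 0.
move=> /(closureS (B := [set x | 0 <= aff (beta j) x])) h.
have {h} := h _; rewrite -(closure_id _).1//; apply.
move=> y /tetra_polyhedron /(_ (beta j)) => h; apply: ltW; apply: h.
by rewrite map_f ?mem_enum.
Qed.

(** The boundary lies in the zero sets of the barycentric coordinates. *)
Lemma closure_tetra_ae : aeL (fun x => closure (tetra T) x -> tetra T x).
Proof.
have h : aeL (fun x => forall j : 'I_4, aff (beta j) x != 0).
  by apply: aeL_forallcount => j; apply: aeL_aff_neq0; exact: bary_nonconstant.
apply: aeLS h => x hx cx; apply/tetra_polyhedron => l /mapP[j _ ->].
by rewrite lt_neqAle eq_sym hx closure_tetra_ge0.
Qed.

Lemma affine_on_tetra (A : 'M[R]_3) (b : pt) x :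
  A *m x + b = \sum_j aff (beta j) x *: (A *m T j + b).
Proof.
under eq_bigr do rewrite scalerDr; rewrite big_split /= -scaler_suml (bary_sum hb) scale1r.
congr (_ + _); rewrite -{1}(bary_comb hb x) mulmx_sumr.
by apply: eq_bigr => j _; rewrite -scalemxAr.
Qed.

End WithBarycentric.

Lemma open_polyhedron (ls : seq ('rV[R]_3 * R)) : open (polyhedron ls).
Proof.
elim: ls => [|l ls ih].
  rewrite (_ : polyhedron _ = setT); first exact: openT.
  by apply/seteqP; split=> x.
rewrite (_ : polyhedron _ = [set x | 0 < aff l x] `&` polyhedron ls).
  apply: openI => //; apply: (@open_comp _ _ (aff l) [set y | 0 < y]).
    by move=> x _; exact/differentiable_continuous/differentiable_aff.
  exact: open_gt.
apply/seteqP; split => x.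
  by move=> h; split; [apply: h; rewrite inE eqxx|move=> m mls; apply: h; rewrite inE mls orbT].
by move=> [h1 h2] m; rewrite inE => /predU1P[->//|/h2].
Qed.

Lemma open_tetra T : Defs.nondegenerate T -> open (tetra T).
Proof.
move=> /nondegenerate_barycentric[beta hb].
rewrite (_ : tetra T = polyhedron (bary_faces beta)); first exact: open_polyhedron.
by apply/seteqP; split => x /(tetra_polyhedron hb).
Qed.

Lemma continuous_coords (f : pt -> pt) :
  (forall i, continuous (fun x => f x i 0)) -> continuous f.
Proof.
move=> cf x B [P hP PB].
have h : \forall y \near x, forall i : 'I_3, P i 0 (f y i 0).
  by apply: (@filter_forall _ _ (fun (i : 'I_3) y => P i 0 (f y i 0)) (nbhs x)) => i;
      apply: cf; exact: hP.
by apply: filterS h => y hy; apply: PB => i j; rewrite (ord1 j).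
Qed.

(** Nothing is known of [f] outside of [O]. *)
Lemma diff_affine_near (f : pt -> pt) (A : 'M[R]_3) (b x u : pt) (O : set pt) :
  open O -> O x -> (forall y, O y -> f y = A *m y + b) -> 'd f x u = A *m u.
Proof.
move=> Oo Ox fO.
have cA : continuous (mulmx A : pt -> pt).
  apply: continuous_coords => i.
  rewrite (_ : (fun z => _) = aff (row i A, 0)).
    by move=> z; exact/differentiable_continuous/differentiable_aff.
  by apply/funext => z; rewrite /aff /= -row_mul addr0 [RHS]mxE.
have [r r0 hr] : exists2 r : R, 0 < r & ball x r `<=` O.
  by have /nbhs_ballP[r r0 hr] := open_nbhs_nbhs (conj Oo Ox); exists r.
have -> : 'd f x = mulmx A :> (pt -> pt); last by [].
apply: diff_unique => //; apply/eqaddoP => _ /posnumP[e]; near=> h.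
have Ohx : O (h + x).
  apply: hr; rewrite -ball_normE /= opprD addrCA addrN addr0 normrN.
  by near: h; exact: (@nbhs0_lt _ pt r r0).
rewrite /= !fctE /= fO// (fO x Ox) mulmxDr.
rewrite (_ : _ - _ = 0) ?normr0 ?mulr_ge0//.
by move: (A *m h) (A *m x) => p q; apply/colP => i; rewrite !mxE; ring.
Unshelve. all: by end_near.
Qed.

Lemma mset_tetra T : Defs.nondegenerate T -> mset (tetra T).
Proof.
move=> /nondegenerate_barycentric[beta hb].
rewrite (_ : tetra T = [set x | forall j : 'I_4, 0 < aff (beta j) x]).
  by apply: mset_fin_bigcap => j; apply: mset_gt0; exact: mfun_aff.
apply/seteqP; split => x.
  by move=> /(tetra_polyhedron hb) h j; apply: h; rewrite map_f ?mem_enum.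
by move=> h; apply/(tetra_polyhedron hb) => l /mapP[j _ ->].
Qed.

End Barycentric.

(** ** Type A decompositions *)

Section Kuhn.
Context {R : realType}.
Variable k : nat.
Hypothesis k0 : (0 < k)%N.
Local Notation pt := 'cV[R]_3.
Local Notation tet := ('I_4 -> 'cV[R]_3).
Local Notation xl := (@xl R k).
Local Notation typeA := (@typeA R k).
Local Notation eps := (@eps R k).

Lemma eps_gt0 : 0 < eps. Proof. by rewrite /eps invr_gt0 ltr0n. Qed.

Lemma xlE l i : xl l i 0 = eps * (l i 0)%:~R.
Proof. by rewrite !mxE. Qed.

Lemma typeAE l eta s j i : typeA l eta s j i 0 =
  eps * ((l i 0)%:~R + (s i < j)%N%:R * (eta i 0)%:~R).
Proof.
rewrite /typeA xlE mxE intrD; congr (_ * (_ + _)).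
by case: ifP => _; rewrite ?mul1r ?mul0r.
Qed.

Lemma typeA_nondegenerate (l eta : site) s : \prod_i eta i 0 != 0 ->
  Defs.nondegenerate (typeA l eta s).
Proof.
move=> eta0; rewrite /Defs.nondegenerate.
pose N : 'M[R]_3 := \matrix_(a, b) (a <= b)%N%:R.
pose dv : 'rV[R]_3 := \row_i (eps * (eta i 0)%:~R).
(* Up to the order of the coordinates, the edges form a triangular matrix. *)
rewrite [X in \det X](_ : _ = diag_mx dv *m row_perm s N); last first.
  apply/matrixP => i j; rewrite [LHS]mxE.
  have -> : forall a b : pt, (a - b) i 0 = a i 0 - b i 0 by move=> a b; rewrite !mxE.
  rewrite !typeAE lift0 ltnS ltn0 mul_diag_mx !mxE /=.
  by case: (s i <= j)%N => /=; ring.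
rewrite det_mulmx det_diag row_permE det_mulmx det_perm.
have -> : \det N = 1.
  rewrite -det_tr det_trig; last first.
    by apply/is_trig_mxP => i j ij; rewrite !mxE leqNgt ij.
  by rewrite big1// => i _; rewrite !mxE leqnn.
rewrite mulr1 mulf_neq0 ?signr_eq0//.
apply/prodf_neq0 => i _; rewrite mxE.
apply: mulf_neq0; first by rewrite gt_eqF// eps_gt0.
rewrite intr_eq0.
by move/prodf_neq0: eta0 => /(_ i isT).
Qed.

Lemma sorting_perm (u : 'I_3 -> R) : injective u ->
  exists s : 'S_3, forall i j, (s i < s j)%N = (u j < u i).
Proof.
move=> u_inj.
pose S i := [set j | u i < u j]%SET.
have Slt i : (#|S i| < 3)%N.
  rewrite -[X in (_ < X)%N](card_ord 3) -cardsT proper_card//.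
  apply/properP; split; first exact: finset.subsetT.
  by exists i; rewrite ?inE// ltxx.
have Smono i j : u j < u i -> (#|S i| < #|S j|)%N.
  move=> ji; apply: proper_card; apply/properP; split.
    by apply/fintype.subsetP => m; rewrite !inE; exact: lt_trans.
  by exists i; rewrite inE// ltxx.
pose r i := Ordinal (Slt i).
have r_inj : injective r.
  move=> i j /(congr1 val) /= ij; apply: u_inj.
  by have [/Smono|/Smono|//] := ltgtP (u i) (u j); rewrite ij ltnn.
exists (perm r_inj) => i j.
have -> : (perm r_inj i < perm r_inj j)%N = (#|S i| < #|S j|)%N by rewrite !permE.
by have [/Smono|/Smono|/u_inj ->] := ltgtP (u i) (u j);
  [move=> /ltnW; rewrite leqNgt => /negbTE|move=> ->|rewrite ltnn].
Qed.

(** The tetrahedron of the decomposition containing a point is found by sorting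
   the coordinates of the point relative to the bond volume. *)
Lemma typeA_cover (l eta : site) (x : pt) (u : 'I_3 -> R) : injective u ->
  (forall i, 0 < u i < 1) ->
  (forall i, x i 0 = eps * ((l i 0)%:~R + u i * (eta i 0)%:~R)) ->
  exists s, tetra (typeA l eta s) x.
Proof.
move=> /sorting_perm[s hs] u01 xu; exists s.
have [r rE] : exists r : nat -> R, forall i : 'I_3, r i = u (s^-1%g i).
  by exists (fun n => u (s^-1%g (inord n))) => i; rewrite inord_val.
have rs i : r (s i) = u i by rewrite rE permK.
have r01 (n : nat) : (n < 3)%N -> 0 < r n < 1.
  by move=> n3; rewrite (rE (Ordinal n3)).
have r_lt (n : nat) : (n.+1 < 3)%N -> r n.+1 < r n.
  move=> n3; rewrite (rE (Ordinal n3)) (rE (Ordinal (ltnW n3))) -hs !permKV.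
  exact: ltnSn.
(* The coordinates in decreasing order, preceded by 1 and followed by 0; their
   successive differences are the barycentric coordinates. *)
pose tau (n : nat) : R :=
  if n is n'.+1 then (if (n' < 3)%N then r n' else 0) else 1.
have tauS i : tau (s i).+1 = u i by rewrite /tau ltn_ord rs.
have tau_lt (n : nat) : (n < 4)%N -> tau n.+1 < tau n.
  case: n => [|[|[|[|//]]]] _; rewrite /tau /=; last by have /andP[] := r01 2%N isT.
  - by have /andP[] := r01 0%N isT.
  - exact: r_lt.
  - exact: r_lt.
have tau0 : tau 0%N = 1 by [].
have tau4 : tau 4%N = 0 by [].
clearbody tau; pose w (j : 'I_4) := tau j - tau j.+1.
have wS (n m : nat) : (n < m)%N -> \sum_(n <= j < m) (tau j - tau j.+1) = tau n - tau m.
  move=> nm; rewrite -[RHS]opprB -(telescope_sumr tau (ltnW nm)) -sumrN.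
  by apply: eq_bigr => j _; rewrite opprB.
exists w; split.
- by move=> j /=; rewrite subr_gt0 tau_lt.
- rewrite -(big_mkord xpredT (fun j => tau j - tau j.+1)) wS//.
  by rewrite tau0 tau4 subr0.
- apply/colP => i; rewrite summxE xu.
  have -> : \sum_j (w j *: typeA l eta s j) i 0 =
    eps * ((l i 0)%:~R * (\sum_j w j) + (\sum_j w j * (s i < j)%N%:R) * (eta i 0)%:~R).
    transitivity (\sum_j (eps * (l i 0)%:~R * w j +
        eps * (eta i 0)%:~R * (w j * (s i < j)%N%:R))).
      by apply: eq_bigr => j _; rewrite mxE typeAE; ring.
    by rewrite big_split -!mulr_sumr /=; ring.
  have -> : \sum_j w j = 1.
    rewrite -(big_mkord xpredT (fun j => tau j - tau j.+1)) wS//.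
    by rewrite tau0 tau4 subr0.
  suff -> : \sum_j w j * (s i < j)%N%:R = u i by rewrite mulr1.
  rewrite -(big_mkord xpredT (fun j => (tau j - tau j.+1) * (s i < j)%N%:R)).
  rewrite (@big_cat_nat _ _ _ (s i).+1)//=; last by rewrite ltnS ltnW// ltn_ord.
  rewrite big_nat big1 ?add0r; last first.
    by move=> j; rewrite ltnS => /andP[_ ji]; rewrite ltnNge ji mulr0.
  rewrite big_nat (eq_bigr (fun j => tau j - tau j.+1)); last first.
    by move=> j /andP[ij _]; rewrite ij mulr1.
  rewrite -big_nat wS ?tauS; last by rewrite ltnS ltn_ord.
  by rewrite tau4 subr0.
Qed.

(** The coordinates for which the bond volume is the unit cube, whatever the
   signs of the components of [eta]. *)
Definition rel_coord (l eta : site) (i : 'I_3) : 'rV[R]_3 * R :=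
  ((eps * (eta i 0)%:~R)^-1 *: delta_mx 0 i, - (l i 0)%:~R / (eta i 0)%:~R).

Lemma rel_coordE (l eta : site) i (x : pt) : eta i 0 != 0 ->
  x i 0 = eps * ((l i 0)%:~R + aff (rel_coord l eta i) x * (eta i 0)%:~R).
Proof.
move=> ei; have e0 := eps_gt0; rewrite /aff /= -scalemxAl -rowE !mxE.
have ei' : (eta i 0)%:~R != 0 :> R by rewrite intr_eq0.
by field; rewrite ei' gt_eqF.
Qed.

Lemma bond_rel (l eta : site) (x : pt) : \prod_i eta i 0 != 0 -> bond R k l eta x <->
  forall i, 0 < aff (rel_coord l eta i) x < 1.
Proof.
move=> eta0; have e0 := eps_gt0.
have ei0 i : eta i 0 != 0 by move/prodf_neq0: eta0 => /(_ i isT).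
have E i : (Num.min (xl l i 0) (xl (l + eta) i 0) < x i 0 <
    Num.max (xl l i 0) (xl (l + eta) i 0)) = (0 < aff (rel_coord l eta i) x < 1).
  rewrite !xlE [(l + eta) i 0]mxE intrD (rel_coordE l x (ei0 i)).
  move: (aff _ _) => u; move: ((l i 0)%:~R : R) => a.
  have [e1|e1] : ((eta i 0)%:~R < 0 :> R) \/ (0 < (eta i 0)%:~R :> R).
    by rewrite ltrz0 ltr0z; case: ltgtP (ei0 i); [left|right|].
  - move: ((eta i 0)%:~R : R) e1 => b b0.
    have h : eps * (a + b) < eps * a by rewrite ltr_pM2l// gtrDl.
    rewrite min_r ?ltW// max_l ?ltW// !ltr_pM2l// ltrD2l gtrDl.
    have -> : (b < u * b) = (u < 1) by apply/idP/idP => ?; nra.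
    have -> : (u * b < 0) = (0 < u) by apply/idP/idP => ?; nra.
    by rewrite andbC.
  - move: ((eta i 0)%:~R : R) e1 => b b0.
    have h : eps * a < eps * (a + b) by rewrite ltr_pM2l// ltrDl.
    rewrite min_l ?ltW// max_r ?ltW// !ltr_pM2l// ltrD2l ltrDl.
    by rewrite gtr_pMl// pmulr_lgt0.
by split=> h i; have := h i; rewrite E.
Qed.

(** Points with two equal relative coordinates lie on finitely many planes. *)
Lemma bond_typeA_ae (l eta : site) : \prod_i eta i 0 != 0 ->
  aeL (fun x => bond R k l eta x -> exists s, tetra (typeA l eta s) x).
Proof.
move=> eta0; have e0 := eps_gt0.
have ei0 i : eta i 0 != 0 by move/prodf_neq0: eta0 => /(_ i isT).
pose df (p : 'I_3 * 'I_3) : 'rV[R]_3 * R :=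
  ((rel_coord l eta p.1).1 - (rel_coord l eta p.2).1,
   (rel_coord l eta p.1).2 - (rel_coord l eta p.2).2).
have dfE p x : aff (df p) x = aff (rel_coord l eta p.1) x - aff (rel_coord l eta p.2) x.
  by rewrite /aff /= mulmxBl !mxE; ring.
have h : aeL (fun x => forall p : 'I_3 * 'I_3, p.1 != p.2 -> aff (df p) x != 0).
  apply: aeL_forallcount => p; have [pp|pp] := eqVneq p.1 p.2.
    by apply: aeLW.
  apply: aeLS (aeL_aff_neq0 (l := df p) _) => // ; apply/eqP => /rowP/(_ p.1).
  rewrite !mxE !eqxx (negbTE pp) mulr0 subr0 mulr1 => /eqP.
  by rewrite invr_eq0 mulf_eq0 gt_eqF//= intr_eq0 (negbTE (ei0 _)).
apply: aeLS h => x hx /(bond_rel _ _ eta0) bx.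
apply: (@typeA_cover l eta x (fun i => aff (rel_coord l eta i) x)) => //.
  move=> i j /eqP; rewrite -subr_eq0 -(dfE (i, j)) => ij.
  by apply/eqP; apply: contraTT ij => /(hx (i, j)).
by move=> i; exact: rel_coordE.
Qed.

(** The main diagonal is an edge of each of the tetrahedra of the type A
   decomposition: this is why the difference quotient of a bond is the
   directional derivative of the interpolant all over the bond volume. *)
Lemma typeA_edge (l eta : site) s (A : 'M[R]_3) (b : pt) (v : site -> pt) :
  (forall j m, typeA l eta s j = xl m -> A *m typeA l eta s j + b = v m) ->
  A *m real_vec eta = Dbar k eta v l.
Proof.
move=> h; have e0 := eps_gt0.
have t0 : typeA l eta s ord0 = xl l.
  by apply/colP => i; rewrite typeAE xlE ltn0 mul0r addr0.
have t3 : typeA l eta s ord_max = xl (l + eta).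
  by apply/colP => i; rewrite typeAE xlE ltn_ord mul1r [(l + eta) i 0]mxE intrD.
rewrite /Dbar -(h _ _ t0) -(h _ _ t3) t0 t3 opprD addrACA subrr addr0 -mulmxBr.
have -> : xl (l + eta) - xl l = eps *: real_vec eta.
  by apply/colP => i; rewrite !mxE intrD; ring.
by rewrite -scalemxAr scalerA mulVf ?scale1r// gt_eqF.
Qed.

End Kuhn.

(** * The periodic piecewise affine interpolant *)

Section Hat.
Context {R : realType}.
Local Notation pt := 'cV[R]_3.
Implicit Types (z : pt).

(** The largest of the coordinates and 0.  The function [hat] below is expressed
   with it in order to have its piecewise affinity reduced to the monotonicity of
   the coordinates along the edge paths of the tetrahedra. *)
Definition upper z : R := Num.max 0
  (Num.max (z (inord 0) 0) (Num.max (z (inord 1) 0) (z (inord 2) 0))).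

Lemma forall_ord3 (P : 'I_3 -> Prop) :
  (forall i, P i) <-> [/\ P (inord 0), P (inord 1) & P (inord 2)].
Proof.
split=> [h|[h0 h1 h2]]; first by split; exact: h.
by case; case=> [|[|[|//]]] lt;
  [move: h0|move: h1|move: h2]; congr P; apply: val_inj; rewrite /= inordK.
Qed.

Lemma upper_le z c : (upper z <= c) <-> 0 <= c /\ forall i, z i 0 <= c.
Proof.
rewrite /upper !ge_max (forall_ord3 (fun i => z i 0 <= c)); split.
  by move=> /and4P[].
by case=> -> [-> -> ->].
Qed.

Lemma upper_ge0 z : 0 <= upper z. Proof. by rewrite /upper le_max lexx. Qed.

Lemma coord_le_upper z i : z i 0 <= upper z.
Proof. by have [/(_ (lexx _))[_ /(_ i)]] := upper_le z (upper z). Qed.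

Lemma mfun_upper (f : pt -> pt) : (forall i, mfun (fun x => f x i 0)) ->
  mfun (fun x => upper (f x)).
Proof.
move=> mf; apply: measurable_maxr; first exact: mfun_cst.
apply: measurable_maxr; first exact: mf.
by apply: measurable_maxr; exact: mf.
Qed.

Lemma upper_lipschitz z z' (d : R) : (forall i, `|z i 0 - z' i 0| <= d) ->
  `|upper z - upper z'| <= d.
Proof.
move=> h; have d0 : 0 <= d by apply: le_trans (h (inord 0)).
rewrite ler_distlC; apply/andP; split.
  rewrite lerBlDr; apply/upper_le; split; first by rewrite addr_ge0// upper_ge0.
  move=> i; have := h i; rewrite ler_distlC => /andP[h1 h2].
  by have := coord_le_upper z' i; lra.
apply/upper_le; split; first by rewrite addr_ge0// upper_ge0.
move=> i; have := h i; rewrite ler_distlC => /andP[h1 h2].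
by have := coord_le_upper z i; lra.
Qed.

(** The hat function of the vertex 0 in the conforming triangulation of the
   space by the type A decompositions of the unit cubes. *)
Definition hat z : R := Num.max 0 (1 - (upper z + upper (- z))).

Lemma mfun_hat (f : pt -> pt) : (forall i, mfun (fun x => f x i 0)) ->
  mfun (fun x => hat (f x)).
Proof.
move=> mf; apply: measurable_maxr; first exact: mfun_cst.
apply: (@mfunD R (fun=> 1) (fun x => - (upper (f x) + upper (- f x)))).
  exact: mfun_cst.
apply: (measurableT_comp (@oppr_measurable R setT)).
apply: (@mfunD R (fun x => upper (f x)) (fun x => upper (- f x))).
  exact: mfun_upper.
apply: mfun_upper => i.
rewrite (_ : (fun x => _) = (fun x => - f x i 0)); last first.
  by apply/funext => x; rewrite mxE.
exact: (measurableT_comp (@oppr_measurable R setT) (mf i)).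
Qed.

Lemma hat_ge0 z : 0 <= hat z. Proof. by rewrite /hat le_max lexx. Qed.

Lemma hat_le1 z : hat z <= 1.
Proof.
by rewrite /hat ge_max ler01 lerBlDr lerDl addr_ge0// upper_ge0.
Qed.

Lemma hat_lipschitz z z' (d : R) : (forall i, `|z i 0 - z' i 0| <= d) ->
  `|hat z - hat z'| <= 2 * d.
Proof.
move=> h; have h1 := upper_lipschitz h.
have h2 : `|upper (- z) - upper (- z')| <= d.
  by apply: upper_lipschitz => i; rewrite !mxE -opprD normrN; exact: h.
have d0 : 0 <= d by apply: le_trans (h (inord 0)).
move: h1 h2; rewrite /hat !ler_norml => /andP[a1 a2] /andP[b1 b2].
move: (upper z) (upper z') (upper (- z)) (upper (- z')) a1 a2 b1 b2.
move=> a b c e a1 a2 b1 b2; rewrite /Num.max.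
by case: ifP => /negP h3; case: ifP => /negP h4; apply/andP; split; lra.
Qed.

Lemma hat0 : hat 0 = 1.
Proof.
rewrite /hat oppr0 (_ : upper 0 = 0) ?addr0 ?subr0 ?max_r//.
by rewrite /upper !mxE !maxxx.
Qed.

Lemma hat_eq0 z i : 1 <= `|z i 0| -> hat z = 0.
Proof.
move=> zi; rewrite /hat max_l// subr_le0.
have h1 := coord_le_upper z i; have h2 := coord_le_upper (- z) i.
have h3 := upper_ge0 z; have h4 := upper_ge0 (- z).
move: h2 zi; rewrite mxE; case: (ler0P (z i 0)) => ? ? ?; lra.
Qed.

(** A maximum is additive as long as the same argument realizes it. *)
Lemma upper_comonotone (Z : 'I_4 -> pt) (w : 'I_4 -> R) :
  (forall j, 0 <= w j) ->
  (exists i, forall j, upper (Z j) = Z j i 0) \/ (forall j, upper (Z j) = 0) ->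
  upper (\sum_j w j *: Z j) = \sum_j w j * upper (Z j).
Proof.
move=> w0 h; apply/eqP; rewrite eq_le; apply/andP; split.
  apply/upper_le; split; first by apply: sumr_ge0 => j _; rewrite mulr_ge0// upper_ge0.
  move=> i; rewrite summxE; apply: ler_sum => j _; rewrite mxE ler_wpM2l//.
  exact: coord_le_upper.
case: h => [[i hi]|h0]; last first.
  by rewrite big1 ?upper_ge0// => j _; rewrite h0 mulr0.
apply: le_trans (coord_le_upper _ i); rewrite summxE; apply: ler_sum => j _.
by rewrite mxE hi.
Qed.

(** Among the coordinates of the base point [n], take a largest one, and among
   those one of lowest rank for [rho].  It remains the largest along the path, since
   each coordinate is raised at most by 1 and those of lower rank first. *)
Lemma upper_chain (n : 'I_3 -> int) (q : 'I_4 -> 'I_3 -> bool) (rho : 'I_3 -> 'I_3)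
    (Z : 'I_4 -> pt) :
  (forall j i m, (rho i <= rho m)%N -> q j m -> q j i) ->
  (forall j i, Z j i 0 = (n i + (q j i)%:Z)%:~R) ->
  (exists i, forall j, upper (Z j) = Z j i 0) \/ (forall j, upper (Z j) = 0).
Proof.
move=> hq hZ.
(* Lexicographic comparison: the factor 3 exceeds the differences of ranks. *)
pose key i : int := n i * 3 - (rho i)%:Z.
have [i hi] : exists i, forall m, key m <= key i.
  by case: (Order.TotalTheory.arg_maxP key (erefl true : xpredT (ord0 : 'I_3)))
    => i _ hi; exists i => m; exact: hi.
have lexi m : (n m < n i) \/ (n m = n i /\ (rho i <= rho m)%N).
  have := hi m; rewrite /key => h.
  have r1 := ltn_ord (rho i); have r2 := ltn_ord (rho m).
  lia.
have [ni|ni] := leP 0 (n i); [left; exists i|right] => j; apply/eqP; rewrite eq_le.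
  rewrite coord_le_upper andbT; apply/upper_le; rewrite !hZ; split.
    by rewrite ler0z addr_ge0.
  move=> m; rewrite hZ ler_int.
  have [nm|[-> rm]] := lexi m.
    by case: (q j m); case: (q j i); lia.
  rewrite lerD2l; have := hq j _ _ rm.
  by case: (q j m) => [/(_ isT) ->//|_]; case: (q j i).
rewrite upper_ge0 andbT; apply/upper_le; split=> // m; rewrite hZ lerz0.
by have [nm|[nm _]] := lexi m; case: (q j m); lia.
Qed.

(** Only the two maxima and the truncation at 0 can break affinity.  By
   [upper_chain] the maxima do not.  The quantity truncated is nonnegative at all
   the vertices if 0 is one of them, and nonpositive at all of them if not. *)
Lemma hat_affine (n : site) (s : 'S_3) (w : 'I_4 -> R) (Z : 'I_4 -> pt) :
  (forall j, 0 <= w j) -> \sum_j w j = 1 ->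
  (forall j i, Z j i 0 = (n i 0 + ((s i < j)%N : nat)%:Z)%:~R) ->
  hat (\sum_j w j *: Z j) = \sum_j w j * hat (Z j).
Proof.
move=> w0 w1 hZ.
have E1 : upper (\sum_j w j *: Z j) = \sum_j w j * upper (Z j).
  apply: upper_comonotone => //.
  apply: (@upper_chain (fun i => n i 0) (fun j i => (s i < j)%N) s) => //.
  by move=> j i m; exact: leq_ltn_trans.
have E2 : upper (- \sum_j w j *: Z j) = \sum_j w j * upper (- Z j).
  rewrite -sumrN; under eq_bigr do rewrite -scalerN.
  apply: upper_comonotone => //.
  apply: (@upper_chain (fun i => - n i 0 - 1) (fun j i => ~~ (s i < j)%N)
    (fun i => rev_ord (s i))).
    move=> j i m /=; rewrite !subSS -!leqNgt => h jm; apply: (leq_trans jm).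
    by have := ltn_ord (s m); have := ltn_ord (s i); lia.
  by move=> j i; rewrite mxE hZ -intrN; congr (_%:~R); case: (s i < j)%N => /=; lia.
rewrite /hat E1 E2 -big_split /=; under eq_bigr do rewrite -mulrDr.
have [[j0 hj0]|none] := pselect (exists j, Z j = 0).
  have D1 j : upper (Z j) + upper (- Z j) <= 1.
    have hn i : n i 0 = - ((s i < j0)%N : nat)%:Z.
      have := hZ j0 i; rewrite hj0 mxE => /esym/eqP; rewrite intr_eq0 => /eqP.
      by lia.
    have [jj|jj] := leqP j0 j.
      rewrite -[leRHS]addr0; apply: lerD; apply/upper_le; split=> // i.
        rewrite hZ hn (ler_int _ _ 1); move: jj.
        by case: ltnP; case: ltnP; lia.
      rewrite mxE hZ hn -intrN lerz0; move: jj.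
      by case: ltnP; case: ltnP; lia.
    rewrite -[leRHS]add0r; apply: lerD; apply/upper_le; split=> // i.
      rewrite hZ hn lerz0; move: jj.
      by case: ltnP; case: ltnP; lia.
    rewrite mxE hZ hn -intrN (ler_int _ _ 1); move: jj.
    by case: ltnP; case: ltnP; lia.
  rewrite max_r; last first.
    by rewrite subr_ge0 -w1; apply: ler_sum => j _; rewrite ler_piMr.
  rewrite -{1}w1 -sumrB; apply: eq_bigr => j _.
  by rewrite max_r ?mulrBr ?mulr1// subr_ge0.
have D1 j : 1 <= upper (Z j) + upper (- Z j).
  have [i zi] : exists i, Z j i 0 != 0.
    apply: contra_notP none => h; exists j; apply/colP => i; rewrite mxE.
    by apply/eqP/negP => /negP hi; apply: h; exists i.
  have h1 := coord_le_upper (Z j) i; have h2 := coord_le_upper (- Z j) i.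
  have h3 := upper_ge0 (Z j); have h4 := upper_ge0 (- Z j).
  move: h2 zi h1; rewrite mxE hZ intr_eq0; move: (_ + _)%R => a h2 a0 h1.
  have [a1|a1] : (1 <= a) \/ (1 <= - a) by lia.
    have h5 : (1 : R) <= a%:~R by rewrite ler1z.
    lra.
  have h5 : (1 : R) <= - a%:~R by rewrite -intrN ler1z.
  lra.
rewrite max_l; last first.
  by rewrite subr_le0 -w1; apply: ler_sum => j _; rewrite ler_peMr.
by rewrite big1// => j _; rewrite max_l ?mulr0// subr_le0.
Qed.

End Hat.

Section Interpolant.
Context {R : realType}.
Variable k : nat.
Hypothesis k0 : (0 < k)%N.
Local Notation pt := 'cV[R]_3.
Local Notation e i := (delta_mx i 0 : pt).
Implicit Types (v : site -> R).

Definition site_box (N : nat) : set site := [set l | forall i, `|l i 0| <= N%:Z].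

Lemma finite_site_box N : finite_set (site_box N).
Proof.
pose f (g : {ffun 'I_3 -> 'I_(N + N).+1}) : site := \col_i ((g i)%:Z - N%:Z).
apply: (@sub_finite_set _ _ (f @` setT)); last exact/finite_image/finite_finset.
move=> l hl; exists [ffun i => inord (absz (l i 0 + N%:Z))] => //.
apply/colP => i; rewrite mxE ffunE inordK; have := hl i; lia.
Qed.

Definition hat_at (x : pt) (l : site) : R := hat (k%:R *: x - real_vec l).

(** A finite sum, so that measurability and Lipschitz bounds are immediate; the
   truncation is not felt by the points considered, see [interpolant_all]. *)
Definition interpolant v N (x : pt) : R :=
  \sum_(l \in site_box N) v l * hat_at x l.

Lemma interpolantE v N x : interpolant v N x =
  \sum_(l <- fset_set (site_box N)) v l * hat_at x l.
Proof. by rewrite /interpolant fsbig_finite//; exact: finite_site_box. Qed.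

Lemma mfun_interpolant v N : mfun (interpolant v N).
Proof.
rewrite (_ : interpolant v N = fun x =>
  \sum_(l <- fset_set (site_box N)) v l * hat_at x l); last first.
  by apply/funext => x; exact: interpolantE.
apply: mfun_sum => l; apply: mfunM; first exact: mfun_cst.
apply: mfun_hat => i.
rewrite (_ : (fun x : pt => _) = fun x : pt => k%:R * x i 0 + - (l i 0)%:~R).
  apply: mfunD; last exact: mfun_cst.
  by apply: mfunM; [exact: mfun_cst|exact: mfun_coord].
by apply/funext => x; rewrite !mxE.
Qed.

Lemma interpolant_bounded v N : exists K, forall x, `|interpolant v N x| <= K.
Proof.
exists (\sum_(l <- fset_set (site_box N)) `|v l|) => x.
rewrite interpolantE; apply: le_trans (ler_norm_sum _ _ _) _.
apply: ler_sum => l _; rewrite normrM ler_piMr//.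
by rewrite ger0_norm ?hat_le1// hat_ge0.
Qed.

Lemma interpolant_lipschitz v N : exists2 C, 0 <= C & forall (x : pt) h i, 0 <= h ->
  `|interpolant v N (x + h *: e i) - interpolant v N x| <= C * h.
Proof.
exists ((\sum_(l <- fset_set (site_box N)) `|v l|) * (2 * k%:R)).
  by rewrite mulr_ge0// sumr_ge0.
move=> x h i h0; rewrite !interpolantE -sumrB.
apply: le_trans (ler_norm_sum _ _ _) _; rewrite -mulrA mulr_suml.
apply: ler_sum => l _; rewrite -mulrBr normrM ler_wpM2l//.
rewrite -mulrA; apply: hat_lipschitz => j; rewrite !mxE eqxx andbT.
rewrite opprB addrA subrK mulrDr addrAC subrr add0r normrM normr_nat.
rewrite ler_wpM2l//; case: (j == i); rewrite ?mulr1 ?mulr0 ?normr0// ger0_norm//.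
Qed.

Lemma hat_at_site (l m : site) : hat_at (xl k l) m = (l == m)%:R.
Proof.
have kn0 : k%:R != 0 :> R by rewrite pnatr_eq0 -lt0n.
have E : k%:R *: xl k l - real_vec m = real_vec (l - m) :> pt.
  by apply/colP => i; rewrite !mxE /eps mulrA divff// mul1r intrB.
rewrite /hat_at E; have [->|lm] := eqVneq l m.
  by rewrite subrr /real_vec map_mx0 hat0.
have [i li] : exists i, l i 0 != m i 0.
  apply: contrapT => h; move/eqP: lm; apply; apply/colP => i.
  by apply/eqP/negP => /negP hi; apply: h; exists i.
apply: (@hat_eq0 _ _ i); rewrite !mxE -intr_norm ler1z.
by move: (l i 0) (m i 0) li => a b; lia.
Qed.

Lemma hat_at_neq0 x l i : hat_at x l != 0 -> `|k%:R * x i 0 - (l i 0)%:~R| < 1.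
Proof.
rewrite ltNge; apply: contra => h; apply/eqP/(@hat_eq0 _ _ i).
by rewrite !mxE.
Qed.

Lemma interpolant_all v N (x : pt) : (forall i, k%:R * `|x i 0| + 1 <= N%:R) ->
  interpolant v N x = \sum_(l \in [set: site]) v l * hat_at x l.
Proof.
move=> hx; apply: fsbig_widen => // l [_ /= hl].
apply: contrapT => /eqP; rewrite mulf_eq0 negb_or => /andP[_ hl0].
apply: hl => i; have := hat_at_neq0 i hl0; have := hx i => h1 h2.
have : `|(l i 0)%:~R| <= N%:R :> R.
  have -> : (l i 0)%:~R = k%:R * x i 0 - (k%:R * x i 0 - (l i 0)%:~R) :> R by ring.
  apply: le_trans (ler_normB _ _) _; rewrite normrM normr_nat.
  by apply: le_trans h1; rewrite lerD2l ltW.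
by rewrite -intr_norm -[N%:R]/((N%:Z)%:~R) ler_int.
Qed.

Lemma interpolant_periodic v N (x : pt) i (P : int) (L : R) :
  k%:R * L = P%:~R ->
  (forall l, v (l + P *: delta_mx i 0) = v l) ->
  (forall j, k%:R * `|x j 0| + 1 <= N%:R) ->
  (forall j, k%:R * `|(x + L *: e i) j 0| + 1 <= N%:R) ->
  interpolant v N (x + L *: e i) = interpolant v N x.
Proof.
move=> LP vP h1 h2; rewrite !interpolant_all//.
rewrite (reindex_fsbigT (fun l : site => l + P *: delta_mx i 0))/=; last first.
  by exists (fun l => l - P *: delta_mx i 0) => l; rewrite ?addrK ?subrK.
apply: eq_fsbigr => l _; rewrite vP; congr (_ * _); rewrite /hat_at; congr (hat _).
apply/colP => j; rewrite !mxE eqxx andbT intrD intrM mulrDr mulrA LP.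
by case: (j == i); rewrite /= ?mulr1 ?mulr0; ring.
Qed.

Lemma cell_tetE (l : site) (s : 'S_3) j : cell_tet k l s j =
  xl k (\col_i (l i 0 + ((s i < j)%N : nat)%:Z)) :> pt.
Proof.
rewrite /cell_tet /typeA; congr (xl k _); apply/colP => i; rewrite !mxE.
by case: ifP.
Qed.

(** The hat functions are affine on the tetrahedron and take the value 0 or 1 at
   its vertices. *)
Lemma interpolant_affine v N (l : site) (s : 'S_3) (w : 'I_4 -> R) :
  (forall j, 0 <= w j) -> \sum_j w j = 1 ->
  (forall j, site_box N (\col_i (l i 0 + ((s i < j)%N : nat)%:Z))) ->
  interpolant v N (\sum_j w j *: cell_tet k l s j) =
  \sum_j w j * v (\col_i (l i 0 + ((s i < j)%N : nat)%:Z)).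
Proof.
move=> w0 w1 hN; rewrite interpolantE.
pose p j : site := \col_i (l i 0 + ((s i < j)%N : nat)%:Z).
have kn0 : k%:R != 0 :> R by rewrite pnatr_eq0 -lt0n.
have E m : hat_at (\sum_j w j *: cell_tet k l s j) m =
    \sum_j w j * (p j == m)%:R.
  rewrite -(eq_bigr _ (fun j _ => congr1 (fun r => w j * r) (hat_at_site (p j) m))).
  rewrite /hat_at.
  have -> : k%:R *: (\sum_j w j *: cell_tet k l s j) - real_vec m =
      \sum_j w j *: (k%:R *: xl k (p j) - real_vec m) :> pt.
    under [RHS]eq_bigr do rewrite scalerBr; rewrite big_split /= sumrN -scaler_suml w1 scale1r.
    congr (_ - _); rewrite scaler_sumr; apply: eq_bigr => j _.
    by rewrite cell_tetE [LHS]scalerA mulrC -scalerA.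
  apply: (@hat_affine _ (l - m) s) => // j i; rewrite !mxE /eps mulrA divff// mul1r.
  by rewrite -intrB; congr (_%:~R); rewrite addrAC.
under eq_bigr do rewrite E mulr_sumr.
rewrite exchange_big /=; apply: eq_bigr => j _.
rewrite (bigD1_seq (p j)) ?fset_uniq//=; last first.
  have fb := @finite_site_box N; rewrite in_fset_set// inE; exact: hN.
rewrite eqxx mulr1 mulrC big1 ?addr0// => m mp.
by rewrite eq_sym (negbTE mp) !mulr0.
Qed.

End Interpolant.

(** * Piecewise constant integrands *)

Section Pieces.
Context {R : realType}.
Local Notation pt := 'cV[R]_3.
Local Notation tet := ('I_4 -> 'cV[R]_3).
Implicit Types (T : tet) (f h : pt -> R).

Lemma is_derive_sum_seq (I : eqType) (s : seq I) (f : I -> R -> R) (df : I -> R) (t : R) :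
  {in s, forall i, is_derive t (1 : R) (f i) (df i)} ->
  is_derive t (1 : R) (fun x => \sum_(i <- s) f i x) (\sum_(i <- s) df i).
Proof.
elim: s => [_|i s ih h].
  rewrite big_nil (_ : (fun x => _) = cst 0); first exact: is_derive_cst.
  by apply/funext => x; rewrite big_nil.
rewrite big_cons (_ : (fun x => _) = f i + (fun x => \sum_(i <- s) f i x)).
  apply: is_deriveD; first by apply: h; rewrite inE eqxx.
  by apply: ih => j js; apply: h; rewrite inE js orbT.
by apply/funext => x; rewrite big_cons.
Qed.

Lemma tetra_bounded T x i : tetra T x -> `|x i 0| < \sum_j `|T j i 0| + 1.
Proof.
move=> [w [w0 w1 ->]]; rewrite summxE ltr_pwDr//.
apply: le_trans (ler_norm_sum _ _ _) _; apply: ler_sum => j _.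
rewrite mxE normrM ler_piMl//; have wj m : 0 <= w m by apply: ltW; exact: w0.
by rewrite ger0_norm// -w1 (bigD1 j)//= lerDl sumr_ge0.
Qed.

Lemma integrable3_indic_tetra (E : set pt) T : mset E -> Defs.nondegenerate T ->
  integrable3 (\1_(E `&` tetra T) : pt -> R).
Proof.
move=> mE nT.
pose hi : pt := \col_i (\sum_j `|T j i 0| + 1).
apply: (@integrable3_indic R _ (- hi) hi).
  by apply: measurableI => //; exact: mset_tetra.
by move=> x [_ tx] i; rewrite !mxE -ltr_norml tetra_bounded.
Qed.

(** The pieces may overlap: the part of each piece outside of the previous
   ones gives its weight. *)
Lemma piecewise_constant_integral (r : seq tet) (E : set pt) : mset E ->
  {in r, forall T, Defs.nondegenerate T} ->
  exists2 cs : seq (R * tet), {in cs, forall p, p.2 \in r} &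
  forall f a, {in r, forall T, forall x, E x -> tetra T x -> f x = a T} ->
  aeL (fun x => E x -> {in r, forall T, ~ tetra T x} -> f x = 0) ->
  ae_integrable (fun x => \1_E x * f x) /\
  integ (fun x => \1_E x * f x) = \sum_(p <- cs) p.1 * a p.2.
Proof.
elim: r E => [|T r ih] E mE nr.
  exists [::] => // f a _ f0.
  have f0' : aeL (fun x => \1_E x * f x = 0).
    apply: aeLS f0 => x h; rewrite indicE; have [/set_mem Ex|_] := boolP (x \in E).
      by rewrite h ?mulr0.
    by rewrite mul0r.
  split; first exact: ae_integrable_eq f0' ae_integrable0.
  by rewrite big_nil (integ_ae f0') integ0.
have nT : Defs.nondegenerate T by apply: nr; rewrite inE eqxx.
have mE1 : mset (E `\` tetra T) by apply: measurableD => //; exact: mset_tetra.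
have [cs csr ihcs] := ih _ mE1 (fun S Sr => nr S (mem_behead (s := T :: r) Sr)).
exists ((integ \1_(E `&` tetra T), T) :: cs).
  move=> p; rewrite inE => /predU1P[->|/csr pr]; rewrite inE ?eqxx//.
  by rewrite pr orbT.
move=> f a fa f0.
have [||i1 E1] := ihcs f a _ _.
- by move=> S Sr x [Ex _]; apply: fa => //; rewrite inE Sr orbT.
- apply: aeLS f0 => x h [Ex nTx] hr; apply: h => // S.
  by rewrite inE => /predU1P[->//|/hr].
have i2 := integrable3_ae (integrable3_indic_tetra mE nT).
have fE x : \1_E x * f x = a T * \1_(E `&` tetra T) x + \1_(E `\` tetra T) x * f x.
  rewrite !indicE in_setI in_setD; have [/set_mem Ex|_] := boolP (x \in E); last first.
    by rewrite /= !mul0r mulr0 addr0.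
  have [/set_mem Tx|_] := boolP (x \in tetra T) => /=.
    by rewrite mul0r addr0 mulr1 mul1r (fa T)// inE eqxx.
  by rewrite mulr0 add0r.
have i3 := ae_integrableZ (a T) i2.
split; first by apply: ae_integrable_eq (ae_integrableD i3 i1); exact: aeLW.
rewrite (eq_integ fE) integD// integZ// E1 big_cons /=.
by rewrite mulrC.
Qed.

(** One list of weights serves for all the integrands that are constant on the
   pieces and vanish outside of them: the derivative of an integral is then the
   one of a finite linear combination. *)
Lemma int3_pieces (S : set tet) (A : set pt) : finite_set S ->
  (forall T, S T -> Defs.nondegenerate T) -> (forall T, S T -> tetra T `<=` A) ->
  exists2 cs : seq (R * tet), {in cs, forall p, S p.2} &
  forall g b, (forall T, S T -> forall x, tetra T x -> g x = b T) ->
  aeL (fun x => A x -> (forall T, S T -> ~ tetra T x) -> g x = 0) ->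
  ae_integrable (fun x => \1_A x * g x) /\
  int3 A g = \sum_(p <- cs) p.1 * b p.2.
Proof.
move=> /finite_seqP[r ->] nS SA.
have [//|cs csr hcs] := @piecewise_constant_integral r setT measurableT.
exists cs => [p /csr//|g b gb g0].
have [||h1 h2] := hcs (fun x => \1_A x * g x) b.
- by move=> T Tr x _ Tx; rewrite indicE mem_set ?mul1r; [exact: gb Tr x Tx|exact: SA Tr x Tx].
- apply: aeLS g0 => x gx _ nx; rewrite indicE.
  by have [/set_mem/gx->//|_] := boolP (x \in A); rewrite ?mulr0 ?mul0r.
have e1 x : \1_setT x * (\1_A x * g x) = \1_A x * g x by rewrite indicT mul1r.
rewrite int3E -h2 (eq_integ e1); split=> //.
by apply: ae_integrable_eq h1; apply: aeLW => x; rewrite e1.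
Qed.

(** Differentiation under the integral sign, for integrands that are constant
   on finitely many tetrahedra. *)
Lemma is_derive_int3_pieces (S : set tet) (A : set pt) (f : R -> pt -> R) h
    (a : R -> tet -> R) (da : tet -> R) : finite_set S ->
  (forall T, S T -> Defs.nondegenerate T) -> (forall T, S T -> tetra T `<=` A) ->
  (forall T, S T -> forall x, tetra T x -> (forall t, f t x = a t T) /\ h x = da T) ->
  (forall T, S T -> is_derive (0 : R) (1 : R) (a^~ T) (da T)) ->
  aeL (fun x => A x -> (forall T, S T -> ~ tetra T x) ->
    (forall t, f t x = 0) /\ h x = 0) ->
  is_derive (0 : R) (1 : R) (fun t => int3 A (f t)) (int3 A h).
Proof.
move=> fS nS SA Sf Sa S0; have [cs csS hcs] := int3_pieces fS nS SA.
have [|_ ->] := hcs h da (fun T ST x Tx => (Sf T ST x Tx).2).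
  by apply: aeLS S0 => x hx Ax /(hx Ax)[].
rewrite (_ : (fun t => _) = fun t => \sum_(p <- cs) p.1 * a t p.2).
  by apply: is_derive_sum_seq => p pcs; apply: is_deriveZ; exact: Sa (csS p pcs).
apply/funext => t; apply: (hcs (f t) (a t) _ _).2.
  by move=> T ST x Tx; exact: (Sf T ST x Tx).1.
by apply: aeLS S0 => x hx Ax /(hx Ax)[].
Qed.

Lemma weak_derivative_tets (lo hi : pt) (w : pt -> R) (g : 'I_3 -> pt -> R)
    (S : set tet) (u : pt) h :
  (forall i, integrable3 (fun x => \1_(obox lo hi) x * g i x)) ->
  (forall i psi, smooth psi -> test_fun (obox lo hi) psi ->
    integ (fun x => \1_(obox lo hi) x * (w x * 'D_(delta_mx i 0 : pt) psi x)) =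
    - integ (fun x => \1_(obox lo hi) x * (g i x * psi x))) ->
  (forall j, lo j 0 < hi j 0) -> finite_set S ->
  (forall T, S T -> Defs.nondegenerate T) ->
  (forall T, S T -> tetra T `<=` obox lo hi) ->
  (forall T, S T -> exists2 l : 'rV[R]_3 * R,
    aeL (fun x => tetra T x -> w x = aff l x) &
    forall x, tetra T x -> h x = (l.1 *m u) 0 0) ->
  aeL (fun x => obox lo hi x -> exists2 T, S T & tetra T x) ->
  ae_integrable (fun x => \1_(obox lo hi) x * h x) ->
  integ (fun x => \1_(obox lo hi) x * \sum_i u i 0 * g i x) =
  integ (fun x => \1_(obox lo hi) x * h x).
Proof.
move=> gi wg lohi /finite_seqP[r ->] nS SU Sw Scov hint.
have C T : exists t : ('rV[R]_3 * R) * seq ('rV[R]_3 * R), T \in r ->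
    [/\ forall x, tetra T x <-> polyhedron t.2 x,
      aeL (fun x => tetra T x -> w x = aff t.1 x) &
      forall x, tetra T x -> h x = (t.1.1 *m u) 0 0].
  have [Tr|_] := boolP (T \in r); last by exists ((0, 0), [::]).
  have [l wl hl] := Sw T Tr.
  have [beta hb] := nondegenerate_barycentric (nS T Tr).
  by exists (l, bary_faces beta) => _; split=> // x; exact: tetra_polyhedron.
have [t tP] := choice C.
apply: (@weak_derivative_pieces R lo hi w g lohi gi wg (map t r)) => //.
- by move=> _ /mapP[T Tr ->] x; have [tx _ _] := tP T Tr; move=> /tx; exact: SU.
- move=> _ /mapP[T Tr ->]; have [tx wt _] := tP T Tr.
  by apply: aeLS wt => x h1 /tx.
- by move=> _ /mapP[T Tr ->] x; have [tx _ ht] := tP T Tr; move=> /tx; exact: ht.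
- apply: aeLS Scov => x h1 /h1[T Tr Tx]; exists (t T); first exact: map_f.
  by have [tx _ _] := tP T Tr; apply/tx.
Qed.

End Pieces.

(** * Regions and bond volumes *)

Section Topology.
Context {R : realType}.
Local Notation pt := 'cV[R]_3.
Local Notation tet := ('I_4 -> 'cV[R]_3).
Implicit Types (T : tet) (x : pt).

(** Moving from [y] towards the interior point [c] makes the functionals
   positive. *)
Lemma polyhedron_closure (ls : seq ('rV[R]_3 * R)) (c y : pt) : polyhedron ls c ->
  {in ls, forall l, 0 <= aff l y} -> closure (polyhedron ls) y.
Proof.
move=> hc hy B /nbhs_ballP[r /= r0 hB].
pose S : R := \sum_i `|c i 0 - y i 0|.
have S0 : 0 <= S by rewrite sumr_ge0.
have [t [t0 t1 tS]] : exists t : R, [/\ 0 < t, t <= 1 & t * S < r].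
  have rS : 0 < r + S by lra.
  exists (r / (r + S)); split; first by rewrite divr_gt0.
    by rewrite ler_pdivrMr// mul1r lerDl.
  by rewrite mulrAC ltr_pdivrMr// ltr_pM2l// ltrDr.
exists (y + t *: (c - y)); split.
  move=> l ls_l; have -> : aff l (y + t *: (c - y)) = (1 - t) * aff l y + t * aff l c.
    rewrite /aff mulmxDr -scalemxAr mulmxBr.
    by move: (l.1 *m c) (l.1 *m y) => p q; rewrite !mxE; ring.
  have := hy l ls_l; have := hc l ls_l; move: (aff l y) (aff l c) => a b b0 a0.
  have h1 : 0 <= (1 - t) * a by rewrite mulr_ge0// subr_ge0.
  have h2 : 0 < t * b by rewrite mulr_gt0.
  by lra.
apply: hB; apply: coord_ball => // i; rewrite !mxE opprD addNKr normrN normrM gtr0_norm//.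
apply: le_lt_trans tS; rewrite ler_pM2l// /S (bigD1 i)//= lerDl sumr_ge0//.
Qed.

Lemma obox_closure (lo hi c y : pt) : obox lo hi c ->
  (forall i, lo i 0 <= y i 0 <= hi i 0) -> closure (obox lo hi) y.
Proof.
move=> /polyhedron_box hc hy.
have -> : obox lo hi = polyhedron (box_faces lo hi).
  by apply/seteqP; split=> x /polyhedron_box.
apply: polyhedron_closure hc _; apply/(box_facesP _ _ (fun r => 0 <= r)) => i.
by rewrite !subr_ge0; have /andP[-> ->] := hy i.
Qed.

Lemma open_obox (lo hi : pt) : open (obox lo hi).
Proof.
have -> : obox lo hi = polyhedron (box_faces lo hi).
  by apply/seteqP; split=> x /polyhedron_box.
exact: open_polyhedron.
Qed.

Lemma closure_tetra_vertex T j : Defs.nondegenerate T -> closure (tetra T) (T j).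
Proof.
move=> /nondegenerate_barycentric[beta hb].
have -> : tetra T = polyhedron (bary_faces beta).
  by apply/seteqP; split=> x /(tetra_polyhedron hb).
apply: (@polyhedron_closure _ (\sum_i 4^-1 *: T i)).
  apply/(tetra_polyhedron hb); exists (fun=> 4^-1); split=> //.
    by move=> i /=; rewrite invr_gt0.
  by rewrite sumr_const card_ord -[_ *+ 4]mulr_natr mulVf.
by move=> l /mapP[i _ ->]; rewrite (bary_vertex hb) ler0n.
Qed.

Lemma aeL_forall_finite (I : eqType) (S : set I) (P : I -> pt -> Prop) : finite_set S ->
  (forall i, S i -> aeL (P i)) -> aeL (fun x => forall i, S i -> P i x).
Proof.
move=> /finite_seqP[s ->]; elim: s => [_|i s ih h].
  by apply: aeLW => x i.
have h1 : aeL (P i) by apply: h; rewrite /= inE eqxx.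
have h2 : aeL (fun x => forall j, [set` s] j -> P j x).
  by apply: ih => j /= js; apply: h; rewrite /= inE js orbT.
apply: aeLS (aeL_and h1 h2) => x [Pi Ps] j /=.
by rewrite inE => /predU1P[->//|/Ps].
Qed.

(** Closure commutes with finite unions. *)
Lemma closure_pieces_ae (S : set tet) : finite_set S ->
  (forall T, S T -> Defs.nondegenerate T) ->
  aeL (fun x => closure (\bigcup_(T in S) tetra T) x -> exists2 T, S T & tetra T x).
Proof.
move=> fS nS.
have h : aeL (fun x => forall T, S T -> closure (tetra T) x -> tetra T x).
  apply: aeL_forall_finite => // T /nS /nondegenerate_barycentric[beta hb].
  exact: closure_tetra_ae hb.
apply: aeLS h => x hx cx.
have cl : closed (\bigcup_(T in S) closure (tetra T)).
  by apply: closed_bigcup => // T _; exact: closed_closure.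
have : (\bigcup_(T in S) closure (tetra T)) x.
  move/closure_id: cl => ->; apply: closure_subset cx => y [T ST Ty].
  by exists T => //; exact: subset_closure.
by move=> [T ST /(hx T ST)]; exists T.
Qed.

Lemma compact_aff_margin (K : set pt) (ls : seq ('rV[R]_3 * R)) : compact K ->
  K `<=` polyhedron ls ->
  exists2 d, 0 < d & forall x, K x -> {in ls, forall l, d <= aff l x}.
Proof.
move=> cK; elim: ls => [_|l ls ih Kls]; first by exists 1.
have [|d1 d10 hd1] := ih.
  by move=> x /Kls h m mls; apply: h; rewrite inE mls orbT.
have cl : closed (aff l @` K).
  apply: compact_closed; first exact: Rhausdorff.
  apply: continuous_compact => //; apply: continuous_subspaceT => x.
  exact/differentiable_continuous/differentiable_aff.
have n0 : ~ (aff l @` K) 0.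
  by move=> [x /Kls/(_ l)]; rewrite inE eqxx => /(_ isT) h h0; move: h; rewrite h0 ltxx.
have [d2 /= d20 hd2] : exists2 d : R, 0 < d & ball (0 : R) d `<=` ~` (aff l @` K).
  have /nbhs_ballP[d d0 hd] := open_nbhs_nbhs (conj (closed_openC cl) n0).
  by exists d.
exists (Num.min d1 d2); first by rewrite lt_min d10.
move=> x Kx m; rewrite inE => /predU1P[->|mls]; rewrite ge_min; last first.
  by rewrite hd1.
apply/orP; right; rewrite leNgt; apply/negP => lt.
apply: (hd2 (aff l x)); last by exists x.
rewrite -ball_normE /= sub0r normrN gtr0_norm//.
by apply: (Kls x Kx); rewrite inE eqxx.
Qed.

End Topology.

(** ** Bond volumes and coverings *)

Section Geometry.
Context {R : realType}.
Variables (k : nat) (M : 'I_3 -> nat).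
Hypothesis k0 : (0 < k)%N.
Hypothesis M0 : forall i, (0 < M i)%N.
Local Notation pt := 'cV[R]_3.
Local Notation tet := ('I_4 -> 'cV[R]_3).
Local Notation Om := (@Omega R M).
Local Notation xl := (@xl R k).
Local Notation eps := (@eps R k).
Local Notation typeA := (@typeA R k).
Local Notation bond := (bond R k).

Definition omega_lo : pt := \col_i (1 - (M i)%:R).
Definition omega_hi : pt := \col_i (M i)%:R.
Local Notation U := (obox omega_lo omega_hi).

Lemma omega_lohi i : omega_lo i 0 < omega_hi i 0.
Proof.
have h : 1 <= (M i)%:R :> R by rewrite ler1n.
by rewrite !mxE; lra.
Qed.

Lemma Omega_cbox : Om = cbox omega_lo omega_hi.
Proof. by apply/seteqP; split=> x h i; have := h i; rewrite !mxE. Qed.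

Lemma obox_Omega : U `<=` Om.
Proof. by move=> x h i; have /andP[] := h i; rewrite !mxE => /ltW -> /ltW ->. Qed.

Lemma Omega_interior : Om° = U.
Proof.
apply/seteqP; split; last by move: obox_Omega; rewrite (open_subsetE _ (@open_obox R _ _)).
move=> x /nbhs_ballP[r /= r0 hr] i.
have r2 : 0 < r / 2 by rewrite divr_gt0.
have h (s : R) : `|s| = r / 2 -> Om (x + s *: delta_mx i 0).
  move=> sr; apply: hr; apply: coord_ball => // j.
  rewrite !mxE opprD addNKr normrN normrM sr.
  apply: (@le_lt_trans _ _ (r / 2)); last by rewrite gtr_pMr// invf_lt1// ltr1n.
  by rewrite ler_piMr ?(ltW r2)//; case: (_ && _); rewrite ?normr0 ?normr1.
have := h (- (r / 2)) _ i; rewrite normrN (gtr0_norm r2) => /(_ erefl).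
have := h (r / 2) _ i; rewrite (gtr0_norm r2) => /(_ erefl).
by rewrite !mxE !eqxx /= !mulr1; lra.
Qed.

Lemma compact_Omega : compact Om.
Proof. by rewrite Omega_cbox; exact: cbox_compact. Qed.

Lemma closed_Omega : closed Om.
Proof. exact: compact_closed (@norm_hausdorff _ _) compact_Omega. Qed.

(** Large enough for the sites interpolated on [Om] and on its translates by
   one period in a coordinate direction. *)
Definition site_bound : nat := (k * \sum_i 3 * M i).+1.

Lemma site_bound_ge (x : pt) i : `|x i 0| <= 3 * (M i)%:R ->
  k%:R * `|x i 0| + 1 <= site_bound%:R.
Proof.
move=> hx; rewrite /site_bound -[X in _ <= X]natr1 lerD2r natrM ler_wpM2l//.
by apply: le_trans hx _; rewrite -natrM ler_nat (bigD1 i)//= leq_addr.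
Qed.

Lemma Omega_bound x i : Om x -> k%:R * `|x i 0| + 1 <= site_bound%:R.
Proof.
move=> /(_ i) hx; apply: site_bound_ge; rewrite ler_norml.
by have : 0 <= (M i)%:R :> R by []; lra.
Qed.

Lemma lat_site_box l : lat R k M l -> site_box site_bound l.
Proof.
move=> hl i; have := Omega_bound i hl; rewrite xlE normrM gtr0_norm ?eps_gt0//.
rewrite mulrA /Defs.eps divff ?pnatr_eq0 ?gtn_eqF// mul1r -intr_norm -intrD1.
rewrite (_ : site_bound%:R = (site_bound%:Z)%:~R :> R)// ler_int => h.
by apply: le_trans h; rewrite lerDl.
Qed.

Lemma bond_obox l eta : bond l eta =
  obox (\col_i Num.min (xl l i 0) (xl (l + eta) i 0))
       (\col_i Num.max (xl l i 0) (xl (l + eta) i 0)).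
Proof. by apply/seteqP; split=> x h i; have := h i; rewrite !mxE. Qed.

Section Bonds.
Variable eta : site.
Hypothesis eta0 : \prod_i eta i 0 != 0.

Let ei0 i : eta i 0 != 0. Proof. by move/prodf_neq0: eta0 => /(_ i isT). Qed.
Let eiR i : (eta i 0)%:~R != 0 :> R. Proof. by rewrite intr_eq0. Qed.

Lemma aff_rel_coord l i (x : pt) :
  aff (rel_coord k l eta i) x = (k%:R * x i 0 - (l i 0)%:~R) / (eta i 0)%:~R.
Proof.
have kR : k%:R != 0 :> R by rewrite pnatr_eq0 gtn_eqF.
rewrite [in RHS](@rel_coordE R k k0 l eta i x)// /Defs.eps.
by field; rewrite kR eiR.
Qed.

Lemma bond_nonempty l : bond l eta !=set0.
Proof.
exists (\col_i (eps * ((l i 0)%:~R + 2^-1 * (eta i 0)%:~R))).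
apply/(bond_rel k0 _ _ eta0) => i; rewrite aff_rel_coord mxE /Defs.eps mulrA divff; last first.
  by rewrite pnatr_eq0 gtn_eqF.
by rewrite mul1r addrAC subrr add0r mulfK//; apply/andP; split; lra.
Qed.

Lemma closure_bond_xl l : closure (bond l eta) (xl l).
Proof.
have [c] := bond_nonempty l; rewrite bond_obox => hc; apply: obox_closure hc _ => i.
by rewrite !mxE ge_min le_max lexx.
Qed.

(** The projection of the base point onto [Om] lies in the closed bond volume,
   because [x] does and is on the other side of the faces of [Om] involved. *)
Lemma bond_meets_bdry l x : bond l eta x -> U x -> ~ lat R k M l ->
  closure (bond l eta) `&` bdry Om !=set0.
Proof.
move=> bx Ux nl.
pose y : pt := \col_i Num.max (omega_lo i 0) (Num.min (omega_hi i 0) (xl l i 0)).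
have lohi := omega_lohi.
exists y; split.
  move: (bx); rewrite bond_obox => bx'; apply: obox_closure bx' _ => i.
  rewrite [y i 0]mxE mxE [X in _ <= _ <= X]mxE.
  have /andP[d1 d2] := Ux i; have /andP[b1 b2] := bx i.
  apply/andP; split.
    by rewrite le_max; apply/orP; right; rewrite le_min (ltW (lt_trans b1 d2)) ge_min lexx.
  rewrite ge_max (ltW (lt_trans d1 b2)); apply: le_trans (_ : xl l i 0 <= _).
    by rewrite ge_min lexx orbT.
  by rewrite le_max lexx.
split.
  apply: subset_closure; rewrite Omega_cbox => i; rewrite ![y i 0]mxE.
  by rewrite le_max lexx ge_max (ltW (lohi i)) ge_min lexx.
rewrite Omega_interior => Uy; apply: nl; rewrite /lat /= Omega_cbox => i.
have := Uy i; rewrite ![y i 0]mxE lt_max ltxx lt_min gt_max gt_min ltxx /=.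
by move=> /andP[/andP[_ /ltW ->] /andP[_ /ltW ->]].
Qed.

(** In relative coordinates the vertices are 0 or 1, with both values occurring at
   the ends of the main diagonal. *)
Lemma typeA_sub_bond l s : tetra (typeA l eta s) `<=` bond l eta.
Proof.
move=> _ [w [w0 w1 ->]]; apply/(bond_rel k0 _ _ eta0) => i; rewrite aff_convex//.
have E j : aff (rel_coord k l eta i) (typeA l eta s j) = (s i < j)%N%:R.
  rewrite aff_rel_coord typeAE /Defs.eps mulrA divff ?mul1r; last first.
    by rewrite pnatr_eq0 gtn_eqF.
  by rewrite addrAC subrr add0r mulfK.
under eq_bigr do rewrite E.
apply/andP; split.
  rewrite (bigD1 ord_max)//= ltn_ord mulr1 ltr_wpDr//; last exact: w0.
  by apply: sumr_ge0 => j _; rewrite mulr_ge0//; apply: ltW; exact: w0.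
rewrite -[ltRHS]w1 (bigD1 ord0)//= ?ltn0 mulr0 add0r [ltRHS](bigD1 ord0)//=.
rewrite ltr_pwDl//; first exact: w0.
apply: ler_sum => j _; apply: ler_piMr; last by rewrite lern1 leq_b1.
by apply: ltW; exact: w0.
Qed.

(** The relative coordinates for two bond volumes of one covering differ by
   integers. *)
Lemma coset_disjoint r l l' x : in_coset eta r l -> in_coset eta r l' ->
  bond l eta x -> bond l' eta x -> l = l'.
Proof.
move=> hl hl' /(bond_rel k0 _ _ eta0) bx /(bond_rel k0 _ _ eta0) bx'.
apply/colP => i; have /dvdzP[q hq] := hl i; have /dvdzP[q' hq'] := hl' i.
have := bx i; have := bx' i; rewrite !aff_rel_coord.
have -> : l i 0 = r i 0 + q * eta i 0 by rewrite -hq addrC subrK.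
have -> : l' i 0 = r i 0 + q' * eta i 0 by rewrite -hq' addrC subrK.
rewrite !intrD !intrM !opprD !addrA !mulrBl !mulfK//.
move: (_ / _) (_ / _) => z1 z2 h1 h2; congr (_ + _ * _).
have a1 : q%:~R < (q' + 1)%:~R :> R by rewrite intrD; lra.
have a2 : q'%:~R < (q + 1)%:~R :> R by rewrite intrD; lra.
by move: a1 a2; rewrite !ltr_int; lia.
Qed.

(** The bond volume is found from the integral parts of the coordinates relative
   to the one issued from [r]; only lattice planes are missed. *)
Lemma coset_cover r :
  aeL (fun x : pt => exists2 l, in_coset eta r l & bond l eta x).
Proof.
have kR : k%:R != 0 :> R by rewrite pnatr_eq0 gtn_eqF.
have h : aeL (fun x : pt => forall p : 'I_3 * int, x p.1 0 != eps * p.2%:~R).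
  by apply: aeL_forallcount => p; exact: aeL_coord_neq.
apply: aeLS h => x hx.
pose z i : R := (k%:R * x i 0 - (r i 0)%:~R) / (eta i 0)%:~R.
exists (\col_i (r i 0 + Num.floor (z i) * eta i 0)).
  by move=> i; rewrite mxE addrAC subrr add0r dvdz_mull.
apply/(bond_rel k0 _ _ eta0) => i; rewrite aff_rel_coord mxE intrD intrM opprD addrA mulrBl mulfK//.
rewrite -/(z i); have /andP[f1 f2] := floor_itv (z i); move: f2; rewrite intrD => f2.
rewrite subr_gt0 lt_neqAle f1 andbT ltrBlDr [1 + _]addrC f2 andbT.
apply: contraNneq (hx (i, r i 0 + Num.floor (z i) * eta i 0)) => fz /=.
rewrite intrD intrM fz /z divfK// addrC subrK /Defs.eps mulrA mulVf ?mul1r//.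
Qed.

Lemma integ_bond l : integrable3 (\1_(bond l eta) : pt -> R) /\
  integ (\1_(bond l eta)) = eps ^+ 3 * `|\prod_i eta i 0|%:~R.
Proof.
have e0 : 0 < eps := eps_gt0 k0.
rewrite bond_obox; set lo := (X in obox X _); set hi := (X in obox _ X).
have lohi i : lo i 0 <= hi i 0 by rewrite !mxE ge_min le_max lexx.
have m := mset_obox lo hi.
split; first exact: (integrable3_indic m (@subset_refl _ _)).
have -> : integ (\1_(obox lo hi)) = fine (lebesgue3 (pt_of @^-1` obox lo hi)).
  rewrite /integ /int3 /Rintegral; congr fine.
  by rewrite preimage_setT (integral_indic _ measurableT) ?setIT.
rewrite measure_obox//= normr_prod rmorph_prod /=.
transitivity (\prod_i (eps * `|eta i 0|%:~R)); last first.
  by rewrite big_split /= prodr_const card_ord.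
apply: eq_bigr => i _; rewrite !mxE.
have -> (a b : R) : Num.max a b - Num.min a b = `|b - a|.
  rewrite /Num.max /Num.min; case: ltP => h.
    by rewrite gtr0_norm// subr_gt0.
  by rewrite ler0_norm ?opprB// subr_le0.
by rewrite -mulrBr intrD addrAC subrr add0r normrM (gtr0_norm e0) intr_norm.
Qed.

End Bonds.

End Geometry.

(** * Interpolation on lattice tetrahedra *)

Section LatticeTetrahedra.
Context {R : realType}.
Variable k : nat.
Hypothesis k0 : (0 < k)%N.
Local Notation pt := 'cV[R]_3.
Local Notation tet := ('I_4 -> 'cV[R]_3).
Local Notation xl := (@xl R k).
Implicit Types (T : tet) (x u : pt) (m : 'I_4 -> site).

Lemma bary_direction T beta u : barycentric T beta ->
  \sum_i ((beta i).1 *m u) 0 0 *: T i = u.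
Proof.
move=> hb; have E i : ((beta i).1 *m u) 0 0 = aff (beta i) u - aff (beta i) 0.
  by rewrite /aff mulmx0 [X in _ - (X + _)]mxE add0r addrK.
under eq_bigr do rewrite E scalerBl.
by rewrite sumrB !(bary_comb hb) subr0.
Qed.

Lemma affine_interp_bary T beta m (v : site -> pt) (f : pt -> pt) :
  barycentric T beta -> (forall i, T i = xl (m i)) -> affine_interp k v T f ->
  forall x, tetra T x -> f x = \sum_i aff (beta i) x *: v (m i).
Proof.
move=> hb Tm [A [b [fE fv]]] x Tx; rewrite fE// (affine_on_tetra hb).
by apply: eq_bigr => i _; rewrite (fv i (m i)).
Qed.

Lemma affine_interp_diff T beta m (v : site -> pt) (f : pt -> pt) :
  barycentric T beta -> open (tetra T) -> (forall i, T i = xl (m i)) ->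
  affine_interp k v T f -> forall x u, tetra T x ->
  'd f x u = \sum_i ((beta i).1 *m u) 0 0 *: v (m i).
Proof.
move=> hb To Tm [A [b [fE fv]]] x u Tx; rewrite (diff_affine_near u To Tx fE).
have -> : A *m u = (A *m u + b) - (A *m 0 + b) by rewrite mulmx0 add0r addrK.
rewrite !(affine_on_tetra hb) -sumrB; apply: eq_bigr => i _.
rewrite -scalerBl (fv i (m i))//; congr (_ *: _).
by rewrite /aff mulmx0 [X in _ - (X + _)]mxE add0r addrK.
Qed.

(** The gradient is a fixed linear combination of the vertex values, so that it
   depends affinely on [t], with the same slope [z] for all interpolants. *)
Lemma lattice_gradient T (eta : site) (v : site -> pt) : Defs.nondegenerate T ->
  range T `<=` range xl ->
  exists z : pt, forall (F : 'M[R]_3) (t : R) (y : site -> pt) (f : pt -> pt),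
    (forall l, y l = F *m xl l + t *: v l) -> affine_interp k y T f ->
    forall x, tetra T x -> 'd f x (real_vec eta) = F *m real_vec eta + t *: z.
Proof.
move=> nT Tr; have [beta hb] := nondegenerate_barycentric nT.
have /choice[m Tm] : forall i, exists l, T i = xl l.
  by move=> i; have [|l _ <-] := Tr (T i); [exists i|exists l].
exists (\sum_i ((beta i).1 *m real_vec eta) 0 0 *: v (m i)) => F t y f yE fT x Tx.
rewrite (affine_interp_diff hb (open_tetra nT) Tm fT)//.
under eq_bigr do rewrite yE scalerDr -Tm.
rewrite big_split /=; congr (_ + _).
  rewrite -{2}(bary_direction (real_vec eta) hb) mulmx_sumr.
  by apply: eq_bigr => i _; rewrite scalemxAr.
by rewrite scaler_sumr; apply: eq_bigr => i _; rewrite !scalerA mulrC.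
Qed.

Variable M : 'I_3 -> nat.
Local Notation Om := (@Omega R M).
Local Notation Nb := (site_bound k M).

(** Vertices are in the closure of the tetrahedron, hence in [Om].  The index [j]
   is a natural number: beyond 3 the path has ended. *)
Lemma cell_sites T (l : site) (s : 'S_3) : Defs.nondegenerate T -> tetra T `<=` Om ->
  range T = range (cell_tet k l s) ->
  forall j : nat, site_box Nb (\col_i (l i 0 + ((s i < j)%N : nat)%:Z)).
Proof.
move=> nT TO rT j.
have hv i : Om (T i).
  have := @closure_tetra_vertex R T i nT; move/(closure_subset TO).
  by move/closure_id: (@closed_Omega R M) => <-.
pose j' : 'I_4 := inord (minn j 3).
have -> : (\col_i (l i 0 + ((s i < j)%N : nat)%:Z)) =
   \col_i (l i 0 + ((s i < j')%N : nat)%:Z).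
  apply/colP => i; rewrite !mxE inordK; last by rewrite ltnS geq_minr.
  by rewrite leq_min ltn_ord andbT.
apply: (@lat_site_box R) => //; rewrite /lat /= -cell_tetE.
have [i _ <-] : range T (cell_tet k l s j') by rewrite rT; exists j'.
exact: hv.
Qed.

(** The tetrahedra of the decompositions of the bond volumes are only known to have
   the same set of vertices as those of the cells: the weights are transported along
   the correspondence [p] of the vertices. *)
Lemma cell_interpolant T beta (l : site) (s : 'S_3) : Defs.nondegenerate T ->
  barycentric T beta -> tetra T `<=` Om -> range T = range (cell_tet k l s) ->
  exists2 m, (forall i, T i = xl (m i)) & forall (v : site -> R) x, tetra T x ->
    interpolant k v Nb x = \sum_i aff (beta i) x * v (m i).
Proof.
move=> nT hb TO rT; have /choice[p Tp] : forall i, exists j, cell_tet k l s j = T i.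
  by move=> i; have [j _ <-] : range (cell_tet k l s) (T i); [rewrite -rT; exists i|exists j].
pose c (j : 'I_4) : site := \col_i (l i 0 + ((s i < j)%N : nat)%:Z).
exists (c \o p); first by move=> i; rewrite -Tp cell_tetE.
move=> v x Tx.
pose w i := aff (beta i) x.
have w0 i : 0 <= w i by apply: closure_tetra_ge0 hb _ _ _; exact: subset_closure.
pose w' j := \sum_(i | p i == j) w i.
have E (V : nmodType) (g : 'I_4 -> 'I_4 -> V) :
    \sum_i g i (p i) = \sum_j \sum_(i | p i == j) g i j.
  rewrite (partition_big p xpredT)//=; apply: eq_bigr => j _.
  by apply: eq_bigr => i /eqP ->.
have {1}-> : x = \sum_j w' j *: cell_tet k l s j.
  rewrite -[LHS](bary_comb hb); under [LHS]eq_bigr do rewrite -Tp.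
  rewrite (E _ (fun i j => aff (beta i) x *: cell_tet k l s j)).
  by apply: eq_bigr => j _; rewrite scaler_suml.
rewrite interpolant_affine//.
- under eq_bigr do rewrite mulr_suml.
  by rewrite -(E _ (fun i j => w i * v (c j))).
- by move=> j; apply: sumr_ge0.
- by rewrite -(E _ (fun i _ => w i)) (bary_sum hb).
- exact: cell_sites rT.
Qed.

Lemma TT_tetra T : TT k M T -> [/\ Defs.nondegenerate T, tetra T `<=` Om &
  exists l s, range T = range (cell_tet k l s)].
Proof.
move=> [l [s [cO ->]]].
have e0 : \prod_i (const_mx 1 : site) i 0 != 0.
  by rewrite big1 ?oner_eq0// => i _; rewrite mxE.
split; first exact: typeA_nondegenerate.
  by apply: subset_trans cO; exact: typeA_sub_bond.
by exists l, s.
Qed.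

Lemma affine_interp_interpolant T (l : site) (s : 'S_3) (v : site -> pt)
    (f : pt -> pt) (lam : 'rV[R]_3) : Defs.nondegenerate T ->
  tetra T `<=` Om -> range T = range (cell_tet k l s) -> affine_interp k v T f ->
  forall x, tetra T x ->
  (lam *m f x) 0 0 = interpolant k (fun l => (lam *m v l) 0 0) Nb x.
Proof.
move=> nT TO rT fT x Tx; have [beta hb] := nondegenerate_barycentric nT.
have [m Tm ->//] := cell_interpolant nT hb TO rT.
rewrite (affine_interp_bary hb Tm fT)// mulmx_sumr summxE.
by apply: eq_bigr => i _; rewrite -scalemxAr mxE.
Qed.

(** The quotients are eventually constant, the interpolant being affine on the
   open tetrahedron. *)
Lemma interpolant_quotient T (v : site -> R) x (i : 'I_3) : TT k M T -> tetra T x ->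
  cvgn (fun n => n.+1%:R * (interpolant k v Nb (x + n.+1%:R^-1 *: delta_mx i 0) -
    interpolant k v Nb x)).
Proof.
move=> /TT_tetra[nT TO [l [s rT]]] Tx; have [beta hb] := nondegenerate_barycentric nT.
have [m _ Vm] := cell_interpolant nT hb TO rT.
pose a : 'rV[R]_3 * R := (\sum_j v (m j) *: (beta j).1, \sum_j v (m j) * (beta j).2).
have Va y : tetra T y -> interpolant k v Nb y = aff a y.
  move=> Ty; rewrite Vm// /aff /= mulmx_suml summxE -big_split /=.
  by apply: eq_bigr => j _; rewrite -scalemxAl /aff; move: (_ *m y) => p; rewrite [in RHS]mxE; ring.
apply/cvg_ex; exists ((a.1 *m (delta_mx i 0 : pt)) 0 0).
apply: cvg_near_cst.
have [r r0 hr] : exists2 r : R, 0 < r & ball x r `<=` tetra T.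
  by have /nbhs_ballP[r r0 hr] := open_nbhs_nbhs (conj (open_tetra nT) Tx); exists r.
near=> n.
rewrite !Va//; last first.
  apply: hr; apply: coord_ball => // j; rewrite !mxE opprD addNKr normrN normrM.
  rewrite ger0_norm ?invr_ge0//; apply: (@le_lt_trans _ _ n.+1%:R^-1).
    by rewrite ler_piMr ?invr_ge0//; case: (_ && _); rewrite ?normr0 ?normr1.
  by near: n; exact: near_infty_natSinv_lt (PosNum r0).
rewrite /aff mulmxDr -scalemxAr; move: (a.1 *m (delta_mx i 0 : pt)) (a.1 *m x) => p q.
have : n.+1%:R != 0 :> R by rewrite pnatr_eq0.
by rewrite !mxE; move: (n.+1%:R : R) => c c0; field.
Unshelve. all: by end_near.
Qed.

Lemma finite_TT : finite_set (@TT R k M).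
Proof.
apply: (@sub_finite_set _ _
  ((fun p : site * {perm 'I_3} => cell_tet k p.1 p.2) @`
    (site_box Nb `*` [set: {perm 'I_3}]))).
  move=> T TT_T; have [nT TO _] := TT_tetra TT_T; have [l [s [_ TE]]] := TT_T.
  exists (l, s); last by rewrite TE.
  split=> //=; have := @cell_sites T l s nT TO; rewrite TE => /(_ erefl 0%N).
  by congr (site_box _ _); apply/colP => i; rewrite mxE ltn0 addr0.
apply: finite_image; apply: finite_setX; first exact: (finite_site_box k0).
exact: finite_finset.
Qed.

Lemma region_pieces (O : set pt) : region k M O -> exists S : set tet,
  [/\ finite_set S, S `<=` TT k M, forall T, S T -> tetra T `<=` O &
   aeL (fun x => closure O x -> exists2 T, S T & tetra T x)].
Proof.
move=> [S [ST ->]].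
have fS : finite_set S by apply: sub_finite_set ST _; exact: finite_TT.
have nS T : S T -> Defs.nondegenerate T by move=> /ST /TT_tetra[].
exists S; split=> //.
- move=> T hT; rewrite -(open_subsetE _ (open_tetra (nS T hT))).
  by move=> x Tx; apply: subset_closure; exists T.
- apply: aeLS (closure_pieces_ae fS nS) => x h cx; apply: h.
  have := closure_subset (@interior_subset _ _) cx.
  by move/closure_id: (@closed_closure _ (\bigcup_(T in S) tetra T)) => <-.
Qed.

End LatticeTetrahedra.

Section SobolevFunctions.
Context {R : realType}.
Local Notation pt := 'cV[R]_3.

(** On a set of finite measure, from |f| <= 1 + f^2. *)
Lemma in_L2_integrable (lo hi : pt) f : in_L2 (obox lo hi) f ->
  integrable3 (fun x : pt => \1_(obox lo hi) x * f x).
Proof.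
rewrite /in_L2 => h; have := Lfun2_integrable_sqr h.
have mf := set_mem (sub_Lfun_mfun h).
set F := _ \_ _ in h mf *.
have E x : F (of_pt x) = \1_(obox lo hi) x * f x.
  rewrite indicE; have [bx|bx] := pselect (obox lo hi x).
    by rewrite mem_set// mul1r /F patchT /= ?of_ptK// inE /= of_ptK.
  by rewrite memNset// mul0r /F patchN// notin_setE /= of_ptK.
move=> h2; apply: (@le_integrable3 R _ (fun x => \1_(obox lo hi) x + F (of_pt x) ^+ 2)).
- rewrite /mfun (_ : _ \o _ = F)//; apply/funext => z /=.
  by rewrite -E pt_ofK.
- move=> x; rewrite -E [leRHS]ger0_norm ?addr_ge0 ?sqr_ge0//.
  have := E x; rewrite indicE; have [bx|bx] := boolP (x \in obox lo hi) => FE.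
    by move: (F _) => y; have := sqr_ge0 (`|y| - 1); rewrite -[y ^+ 2]real_normK ?num_real//=; move: `|y| => z; nra.
  by rewrite FE mul0r normr0 expr0n addr0.
- apply: integrable3D.
    exact: (integrable3_indic (@mset_obox _ lo hi) (@subset_refl _ _)).
  rewrite /integrable3 (_ : (fun x => _) \o pt_of = fun z => F z ^+ 2)//.
  by apply/funext => z /=; rewrite pt_ofK.
Qed.

(** Passing to one scalar function at once: [lam] will be the differential of the
   potential. *)
Lemma weak_derivative_row (lo hi : pt) (w : pt -> pt) (lam : 'rV[R]_3) :
  (forall c : 'I_3, in_H1 (obox lo hi) (fun x => w x c 0)) ->
  exists g : 'I_3 -> pt -> R,
   (forall i, integrable3 (fun x => \1_(obox lo hi) x * g i x)) /\
   (forall i psi, smooth psi -> test_fun (obox lo hi) psi ->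
    integ (fun x => \1_(obox lo hi) x *
      ((lam *m w x) 0 0 * 'D_(delta_mx i 0 : pt) psi x)) =
    - integ (fun x => \1_(obox lo hi) x * (g i x * psi x))).
Proof.
move=> wH; have wi c : integrable3 (fun x => \1_(obox lo hi) x * w x c 0).
  by apply: in_L2_integrable; have [] := wH c.
have /choice[g hg] : forall p : 'I_3 * 'I_3, exists g : pt -> R,
    integrable3 (fun x => \1_(obox lo hi) x * g x) /\
    forall psi, test_fun (obox lo hi) psi ->
      int3 (obox lo hi) (fun x => w x p.1 0 * 'D_(delta_mx p.2 0 : pt) psi x) =
      - int3 (obox lo hi) (fun x => g x * psi x).
  move=> [c i]; have [_ /(_ i)[g [g2 gE]]] := wH c.
  by exists g; split=> //; exact: in_L2_integrable.
exists (fun i x => \sum_c lam 0 c * g (c, i) x); split=> [i|i psi spsi tpsi].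
  have : integrable3 (fun x => \sum_(c <- [:: inord 0; inord 1; inord 2])
      lam 0 c * (\1_(obox lo hi) x * g (c, i) x)).
    have h c : integrable3 (fun x => lam 0 c * (\1_(obox lo hi) x * g (c, i) x)).
      by apply: integrable3Z; exact: (hg (c, i)).1.
    under [X in integrable3 X]eq_fun do rewrite !big_cons big_nil addr0.
    by do 2?apply: integrable3D.
  congr (integrable3 _); apply/funext => x; rewrite !big_cons big_nil addr0 sum_ord3.
  by ring.
transitivity (\sum_c lam 0 c * int3 (obox lo hi) (fun x => w x c 0 * 'D_(delta_mx i 0 : pt) psi x)).
  under [RHS]eq_bigr do rewrite int3E.
  have h c : ae_integrable (fun x => \1_(obox lo hi) x * (w x c 0 * 'D_(delta_mx i 0 : pt) psi x)).
    by apply: integrable3_ae; apply: integrable3_box_smooth => //; exact: smooth_derive.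
  under [RHS]eq_bigr do rewrite -integZ//.
  rewrite -integ_sum; last by move=> c _; exact: ae_integrableZ.
  apply: eq_integ => x; rewrite mxE mulr_suml mulr_sumr.
  by apply: eq_bigr => c _; ring.
have h c : ae_integrable (fun x => \1_(obox lo hi) x * (g (c, i) x * psi x)).
  by apply: integrable3_ae; apply: integrable3_box_smooth => //; exact: (hg (c, i)).1.
under [LHS]eq_bigr do rewrite (hg (_, i)).2// mulrN int3E -integZ//.
rewrite sumrN -integ_sum; last by move=> c _; exact: ae_integrableZ.
congr (- _); apply: eq_integ => x; rewrite mulr_suml mulr_sumr.
by apply: eq_bigr => c _; ring.
Qed.

End SobolevFunctions.

(** * The mean of the coupled gradient vanishes on each covering *)

Section Coupled.
Context {R : realType}.
Variables (k : nat) (M : 'I_3 -> nat).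
Hypothesis k0 : (0 < k)%N.
Hypothesis M0 : forall i, (0 < M i)%N.
Local Notation pt := 'cV[R]_3.
Local Notation tet := ('I_4 -> 'cV[R]_3).
Local Notation Om := (@Omega R M).
Local Notation U := (obox (@omega_lo R M) (@omega_hi R M)).
Local Notation xl := (@xl R k).
Local Notation bond := (bond R k).
Local Notation lat := (lat R k M).
Variables (Oa Os : set pt).
Hypothesis regOa : region k M Oa.
Hypothesis regOs : region k M Os.
Hypothesis disj : Oa `&` Os = set0.
Hypothesis cover : Om = closure Oa `|` closure Os.
Hypothesis Oa_int : closure Oa `<=` Om°.
Variable eta : site.
Hypothesis eta0 : \prod_i eta i 0 != 0.
Hypothesis dist : forall l, closure (bond l eta) `&` closure Oa !=set0 ->
  closure (bond l eta) `<=` Om°.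
Variable D : site -> site -> set tet.
Local Notation bond_a l := (bond_a k Oa l eta).
Local Notation bond_b l := (bond_b k M Os l eta).
Local Notation bond_G l := (bond_G k M Oa Os l eta).
Hypothesis admD : forall l, bond_G l -> admissible_decomposition k M Oa Os D l eta.

Lemma region_sub_U O : region k M O -> O `<=` Om -> O `<=` U.
Proof.
move=> [S [_ ->]] OO; rewrite -(@Omega_interior R M) -open_subsetE//.
exact: open_interior.
Qed.

Lemma Oa_sub_U : Oa `<=` U.
Proof.
apply: region_sub_U => //; rewrite cover => x Ox; left; exact: subset_closure.
Qed.

Lemma Os_sub_U : Os `<=` U.
Proof.
apply: region_sub_U => //; rewrite cover => x Ox; right; exact: subset_closure.
Qed.

Lemma disjP x : Oa x -> Os x -> False.
Proof. by move=> h1 h2; have : (Oa `&` Os) x by []; rewrite disj. Qed.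

(** Bond volumes carrying a contribution of the atomistic region. *)
Definition active (l : site) : Prop := bond_a l \/ bond_G l.

(** A bond volume meeting the atomistic region stays away from the boundary of
   [Om], by [dist]. *)
Lemma bond_meets_Oa (l : site) (x : pt) : bond l eta x -> Oa x ->
  [/\ lat l, ~ bond_b l & active l].
Proof.
move=> bx ax; have sub : closure (bond l eta) `<=` Om°.
  by apply: dist; exists x; split; exact: subset_closure.
have hl : lat l by apply: interior_subset; apply: sub; exact: closure_bond_xl.
have nb : ~ bond_b l.
  by move=> [/(_ _ bx)/(disjP ax)//|[y [/sub yO [_ /(_ yO)]]]].
by split=> //; have [ha|ha] := pselect (bond_a l); [left|right].
Qed.

Lemma bond_a_lat (l : site) : bond_a l -> lat l /\ bond l eta `<=` Oa.
Proof.
move=> ha; have sub : bond l eta `<=` Oa by move=> x /subset_closure /ha.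
split=> //; have [x bx] := @bond_nonempty R k k0 eta eta0 l.
by have [] := bond_meets_Oa bx (sub _ bx).
Qed.

Lemma active_lat l : active l -> lat l.
Proof. by move=> [/bond_a_lat[]|[]]. Qed.

Lemma finite_active : finite_set active.
Proof.
apply: (@sub_finite_set _ _ (site_box (site_bound k M))).
  by move=> l /active_lat; exact: lat_site_box.
exact: (finite_site_box k0).
Qed.

Lemma finite_bond_a : finite_set [set l | bond_a l].
Proof. by apply: sub_finite_set finite_active => l; left. Qed.

Lemma finite_bond_G : finite_set [set l | bond_G l].
Proof. by apply: sub_finite_set finite_active => l; right. Qed.

(** The pieces of the bond volume on which its energy is counted. *)
Definition bond_pieces (l : site) : set tet :=
  [set T | decomp_near_a k M Oa Os D l eta T /\ tetra T `<=` Oa].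

Lemma bond_piecesP l T : bond_pieces l T ->
  [/\ Defs.nondegenerate T, tetra T `<=` bond l eta, tetra T `<=` Oa &
   range T `<=` range xl].
Proof.
move=> [[[hG DT]|[ha [s ->]]] TO].
  have [[_ /(_ T DT)[nT Tb] _ _] _ _ /(_ T DT TO) hr _] := admD hG.
  by split.
split=> //; first exact: typeA_nondegenerate.
  exact: typeA_sub_bond.
by move=> _ [j _ <-]; rewrite /typeA; eexists.
Qed.

Lemma finite_bond_pieces l : finite_set (bond_pieces l).
Proof.
have [hG|hG] := pselect (bond_G l).
  have [[fD _ _ _] _ _ _ _] := admD hG.
  apply: sub_finite_set fD => T [[[]//|[ha _]] _].
  by have [_ /(_ ha)] := hG.
apply: (@sub_finite_set _ _ ((@typeA R k l eta) @` [set: {perm 'I_3}])).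
  by move=> T [[[]//|[ha [s ->]]] _]; exists s.
by apply: finite_image; exact: finite_finset.
Qed.

Lemma bond_D_ae l : bond_G l ->
  aeL (fun x => bond l eta x -> exists2 T, D l eta T & tetra T x).
Proof.
move=> hG; have [[fD nD _ cD] _ _ _ _] := admD hG.
have h := closure_pieces_ae fD (fun T DT => (nD T DT).1).
apply: aeLS h => x hx bx; apply: hx.
have : (\bigcup_(T in D l eta) closure (tetra T)) x by rewrite cD; exact: subset_closure.
move=> [T DT cx]; apply: closure_subset cx; exact: bigcup_sup.
Qed.

Lemma bond_pieces_ae :
  aeL (fun x => forall l, bond l eta x -> Oa x -> exists2 T, bond_pieces l T & tetra T x).
Proof.
apply: aeL_forallcount => l.
have [ha|ha] := pselect (bond_a l).
  apply: aeLS (bond_typeA_ae k0 l eta0) => x hx /hx[s Tx] _; exists (typeA k l eta s) => //.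
  split; first by right; split=> //; exists s.
  by apply: subset_trans (bond_a_lat ha).2; exact: typeA_sub_bond.
have [hG|hG] := pselect (bond_G l); last first.
  by apply: aeLW => x bx ax; have [_ _ []] := bond_meets_Oa bx ax.
apply: aeLS (bond_D_ae hG) => x hx /hx[T DT Tx] ax; exists T => //.
have [_ hs _ _ _] := admD hG; have [TO|TO] := hs T DT.
  by split=> //; left.
by have := disjP ax (TO _ Tx).
Qed.

(** ** One covering *)

Variables (ybar : (site -> pt) -> pt -> pt)
  (yint : site -> site -> (site -> pt) -> pt -> pt).
Hypothesis ybarP : forall y, deformation k M y -> is_overline k M Os y (ybar y).
Hypothesis yintP : forall l, bond_G l -> forall y, deformation k M y ->
  is_bond_interp k D l eta y (yint l eta y).
Variable v : site -> pt.
Hypothesis Vv : in_V k M v.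
Variable lam : 'rV[R]_3.

Section Covering.
Variables (r : site) (w : pt -> pt).
Hypothesis wP : is_vm k M Oa Os ybar yint eta r v w.
Hypothesis wH : forall c : 'I_3, in_H1 Om° (fun x => w x c 0).

Local Notation V := (interpolant k (fun l => (lam *m v l) 0 0) (site_bound k M)).

Lemma in_V_deformation : deformation k M v.
Proof. by exists 0, v; split=> // l; rewrite mul0mx add0r. Qed.

Lemma ybar_interpolant T x : TT k M T -> tetra T `<=` Os -> tetra T x ->
  (lam *m ybar v x) 0 0 = V x.
Proof.
move=> TT_T TO Tx; have [_ hy] := ybarP in_V_deformation.
have [nT TOm [l [s rT]]] := TT_tetra k0 TT_T.
by apply: (affine_interp_interpolant k0 lam nT TOm rT (hy _ TT_T TO)).
Qed.

(** Both [ybar v] and, by the choice of the decompositions, the functions of the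
   interface bond volumes interpolate on tetrahedra of the lattice cells there.  A
   bond volume of neither kind issued from outside of [Om] crosses the boundary. *)
Lemma vm_interpolant_Os : aeL (fun x => Os x -> (lam *m w x) 0 0 = V x).
Proof.
have [S [fS STT SO Scov]] := region_pieces k0 regOs.
have hG : aeL (fun x => forall l, bond_G l -> bond l eta x -> exists2 T, D l eta T & tetra T x).
  apply: aeL_forallcount => l; have [h|h] := pselect (bond_G l); last by apply: aeLW.
  by apply: aeLS (bond_D_ae h).
apply: aeLS (aeL_and Scov (aeL_and (coset_cover k0 eta0 r) hG)).
move=> x [xS [[l hl bx] xG]] sx; have Ux := Os_sub_U sx.
have [wa wG wb] := wP hl.
have [ha|ha] := pselect (bond_a l).
  by have := disjP ((bond_a_lat ha).2 x bx) sx.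
have [hb|hb] := pselect (bond_b l).
  have [T ST Tx] := xS (subset_closure sx).
  rewrite wb//; last exact: obox_Omega.
  exact: ybar_interpolant (STT _ ST) (SO T ST) Tx.
have lat_l : lat l.
  apply: contrapT => nl; apply: hb; right; exact: (bond_meets_bdry M0 bx Ux nl).
have gl : bond_G l by split.
have [T DT Tx] := xG l gl bx.
have [[_ nD _ _] side cb _ _] := admD gl.
have [TO|TO] := side T DT; first by have := disjP (TO _ Tx) sx.
have [l' [s rT]] := cb T DT TO; rewrite wG//.
apply: (affine_interp_interpolant k0 lam (nD T DT).1 _ rT _ Tx).
  by move=> y /TO /Os_sub_U; exact: obox_Omega.
by have [_] := yintP gl in_V_deformation; exact.
Qed.

(** In the atomistic bond volumes the gradient is replaced by the difference
   quotient, as in the energy. *)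
Definition bond_gradient (l : site) (x : pt) : pt :=
  if `[< bond_a l >] then Dbar k eta v l else 'd (yint l eta v) x (real_vec eta).

Lemma bond_gradientE (l : site) T : in_coset eta r l -> bond_pieces l T ->
  exists A b, (forall x, tetra T x -> w x = A *m x + b) /\
    forall x, tetra T x -> bond_gradient l x = A *m real_vec eta.
Proof.
move=> hl PT; have [nT Tb TO _] := bond_piecesP PT.
have [wa wG _] := wP hl; rewrite /bond_gradient.
move: PT => [[[gl DT]|[ha [s E]]] _].
  have [_ /(_ T DT)[A [b [fE fv]]]] := yintP gl in_V_deformation.
  exists A, b; split=> [x Tx|x Tx]; first by rewrite wG ?fE//; exact: Tb.
  rewrite asboolF; last by have [] := gl.
  exact: (diff_affine_near _ (open_tetra nT) Tx fE).
have [A [b [fE fv]]] := wa ha s; exists A, b; rewrite E; split=> // x _.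
by rewrite asboolT// (typeA_edge k0 (fv)).
Qed.

Lemma interpolant_period (i : 'I_3) (x : pt) :
  (forall j, j != i -> omega_lo M j 0 < x j 0 < omega_hi M j 0) ->
  omega_lo M i 0 <= x i 0 < omega_hi M i 0 ->
  V (x + (omega_hi M i 0 - omega_lo M i 0) *: delta_mx i 0) = V x.
Proof.
move=> xj xi; have M1 j : 1 <= (M j)%:R :> R by rewrite ler1n.
have lohiE j : (omega_lo M j 0 = 1 - (M j)%:R :> R) * (omega_hi M j 0 = (M j)%:R :> R).
  by rewrite !mxE.
apply: (@interpolant_periodic R k _ _ _ _ (k%:Z * (2 * (M i)%:Z - 1))).
- by rewrite !lohiE !(intrM, intrB, intrD) /= -?pmulrn; ring.
- by move=> l; have [/(_ i l) ->] := Vv.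
- move=> j; apply: site_bound_ge; rewrite ler_norml.
  have := M1 j; have [->|/xj] := eqVneq j i; last by rewrite !lohiE; lra.
  by move: xi; rewrite !lohiE; lra.
- move=> j; apply: site_bound_ge; rewrite ler_norml; move: (M1 j).
  have -> : (x + (omega_hi M i 0 - omega_lo M i 0) *: (delta_mx i 0 : pt)) j 0 =
      x j 0 + (omega_hi M i 0 - omega_lo M i 0) * (j == i)%:R by rewrite !mxE andbT.
  have [->|/xj] := eqVneq j i; last by rewrite mulr0 !lohiE; lra.
  by move: xi; rewrite mulr1 !lohiE; lra.
Qed.

Lemma closure_Oa_margin : exists2 d : R, 0 < d &
  forall x, Oa x -> forall j, omega_lo M j 0 + d <= x j 0 <= omega_hi M j 0 - d.
Proof.
have cO : compact (closure Oa).
  apply: (subclosed_compact (@closed_closure _ _) (@compact_Omega R M)).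
  by apply: subset_trans Oa_int _; exact: interior_subset.
have [|d d0 hd] := @compact_aff_margin R _ (box_faces (@omega_lo R M) (@omega_hi R M)) cO.
  by move=> x /Oa_int; rewrite Omega_interior => /polyhedron_box.
exists d => // x /subset_closure /hd /(box_facesP _ _ (fun t => d <= t)) h j.
by have [h1 h2] := h j; rewrite -lerBrDl h1 lerBrDr -lerBrDl h2.
Qed.

Lemma constant_on_pieces (S : set tet) (f : pt -> R) :
  (forall T, S T -> exists c, forall x, tetra T x -> f x = c) ->
  exists b, forall T, S T -> forall x, tetra T x -> f x = b T.
Proof.
move=> h; have /choice[b hb] : forall T, exists c, S T -> forall x, tetra T x -> f x = c.
  by move=> T; have [/h[c hc]|nS] := pselect (S T); [exists c|exists 0].
by exists b.
Qed.

Definition cb_density (x : pt) : R := (lam *m 'd (ybar v) x (real_vec eta)) 0 0.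

Definition bond_density (l : site) (x : pt) : R :=
  \1_Oa x * (lam *m bond_gradient l x) 0 0.

Lemma TT_gradient T : TT k M T -> tetra T `<=` Os -> exists A b,
  (forall x, tetra T x -> ybar v x = A *m x + b) /\
  forall x, tetra T x -> cb_density x = (lam *m (A *m real_vec eta)) 0 0.
Proof.
move=> TT_T TO; have [_ /(_ T TT_T TO)[A [b [fE fv]]]] := ybarP in_V_deformation.
exists A, b; split=> // x Tx; have [nT _ _] := TT_tetra k0 TT_T.
by rewrite /cb_density (diff_affine_near _ (open_tetra nT) Tx fE).
Qed.

Lemma ae_integrable_cb : ae_integrable (fun x => \1_Os x * cb_density x).
Proof.
have [S [fS STT SO Scov]] := region_pieces k0 regOs.
have [|b hb] := @constant_on_pieces S cb_density.
  by move=> T ST; have [A [b [_ h]]] := TT_gradient (STT _ ST) (SO _ ST); eexists; exact: h.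
have nS T : S T -> Defs.nondegenerate T by move=> /STT /(TT_tetra k0)[].
have [cs _ /(_ _ _ hb)[]//] := int3_pieces fS nS SO.
apply: aeLS Scov => x h sx hn; have [T ST Tx] := h (subset_closure sx).
by have := hn _ ST.
Qed.

Lemma ae_integrable_bond (l : site) : in_coset eta r l ->
  ae_integrable (fun x => \1_(bond l eta) x * bond_density l x).
Proof.
move=> hl; have [|b hb] := @constant_on_pieces (bond_pieces l) (bond_density l).
  move=> T PT; have [A [b [_ h]]] := bond_gradientE hl PT.
  have [_ _ TO _] := bond_piecesP PT.
  exists ((lam *m (A *m real_vec eta)) 0 0) => x Tx.
  by rewrite /bond_density h// indicE mem_set ?mul1r//; exact: TO.
have nP T : bond_pieces l T -> Defs.nondegenerate T by move=> /bond_piecesP[].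
have Pb T : bond_pieces l T -> tetra T `<=` bond l eta by move=> /bond_piecesP[].
have [cs _ /(_ _ _ hb)[]//] := int3_pieces (finite_bond_pieces l) nP Pb.
apply: aeLS bond_pieces_ae => x h bx hn; rewrite /bond_density indicE.
have [/set_mem ax|_] := boolP (x \in Oa); last by rewrite mul0r.
by have [T PT Tx] := h l bx ax; have := hn _ PT.
Qed.

(** Outside of the atomistic region v^[m] is the periodic interpolant [V]. *)
Lemma vm_gradient_mean0 (g : 'I_3 -> pt -> R) :
  (forall i, integrable3 (fun x => \1_U x * g i x)) ->
  (forall i psi, smooth psi -> test_fun U psi ->
    integ (fun x => \1_U x * ((lam *m w x) 0 0 * 'D_(delta_mx i 0 : pt) psi x)) =
    - integ (fun x => \1_U x * (g i x * psi x))) ->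
  forall i, integ (fun x => \1_U x * g i x) = 0.
Proof.
move=> gi wg i; have [d d0 hd] := closure_Oa_margin.
have [K VK] := interpolant_bounded k0 (fun l => (lam *m v l) 0 0) (site_bound k M).
have [C C0 VC] := interpolant_lipschitz k0 (fun l => (lam *m v l) 0 0) (site_bound k M).
pose Q j x n := n.+1%:R * (V (x + n.+1%:R^-1 *: delta_mx j 0) - V x).
have [Sa [_ SaTT SaO Sacov]] := region_pieces k0 regOa.
have [Ss [_ SsTT SsO Sscov]] := region_pieces k0 regOs.
apply: (@weak_derivative_mean0 R _ _ _ _ (@omega_lohi R M M0) gi wg V
  (fun j x => lim (Q j x n @[n --> \oo])) K C d Oa i) => //.
- exact: mfun_interpolant.
- by move=> x h h0; exact: VC.
- exact: interpolant_period.
- apply: aeLS (aeL_and Sacov Sscov) => x [xa xs] Ux.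
  have [T TT_T Tx] : exists2 T, TT k M T & tetra T x.
    have : Om x by exact: obox_Omega.
    by rewrite cover => -[/xa|/xs] [T ST Tx]; exists T; auto.
  exact: (@interpolant_quotient R k k0 M T _ x i TT_T Tx).
- apply: aeLS (aeL_and vm_interpolant_Os (aeL_and Sacov Sscov)) => x [h [xa xs]] Ux na.
  apply: h; have : Om x by exact: obox_Omega.
  rewrite cover => -[/xa[T ST Tx]|/xs[T ST Tx]]; last exact: SsO Tx.
  by have := na (SaO _ ST _ Tx).
Qed.

(** The sum is the integral over [U] of the gradient of v^[m] along [eta] computed
   on the pieces, which equals the integral of the weak gradient. *)
Lemma coset_identity (J : seq site) : uniq J ->
  (forall l, l \in J <-> active l /\ in_coset eta r l) ->
  int3 Os cb_density + \sum_(l <- J) int3 (bond l eta) (bond_density l) = 0.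
Proof.
move=> uJ hJ.
have wU c : in_H1 U (fun x => w x c 0) by rewrite -Omega_interior.
have [g [gi wg]] := weak_derivative_row lam wU.
have g0 := vm_gradient_mean0 gi wg.
pose u : pt := real_vec eta.
have gu0 : integ (fun x => \1_U x * \sum_i u i 0 * g i x) = 0.
  rewrite (eq_integ (g := fun x => \sum_i u i 0 * (\1_U x * g i x))); last first.
    by move=> x; rewrite mulr_sumr; apply: eq_bigr => i _; rewrite mulrCA.
  rewrite integ_sum; last by move=> i _; exact/ae_integrableZ/integrable3_ae.
  by rewrite big1// => i _; rewrite integZ ?g0 ?mulr0//; exact: integrable3_ae.
(* At most one term is nonzero at a given point: the regions are disjoint, and so
   are the bond volumes of a covering. *)
pose h x := \1_Os x * cb_density x + \sum_(l <- J) \1_(bond l eta) x * bond_density l x.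
have JP l : l \in J -> in_coset eta r l by move=> /hJ[].
have i1 := ae_integrable_cb.
have i2 : ae_integrable (fun x => \sum_(l <- J | l \in J) \1_(bond l eta) x * bond_density l x).
  by apply: ae_integrable_sum => l /JP; exact: ae_integrable_bond.
have hE : integ h = int3 Os cb_density + \sum_(l <- J) int3 (bond l eta) (bond_density l).
  rewrite int3E [in RHS]big_seq; under [in RHS]eq_bigr do rewrite int3E.
  rewrite -integ_sum; last by move=> l /JP; exact: ae_integrable_bond.
  rewrite -integD//; apply: eq_integ => x; rewrite /h; congr (_ + _).
  by rewrite [LHS]big_seq.
have hU x : \1_U x * h x = h x.
  rewrite !indicE; have [_|/negP nU] := boolP (x \in U); first by rewrite mul1r.
  rewrite mul0r /h indicE memNset ?mul0r ?add0r; last first.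
    by move=> /Os_sub_U Ux; apply: nU; exact: mem_set.
  rewrite big1// => l _; rewrite /bond_density [\1_Oa x]indicE memNset ?mul0r ?mulr0//.
  by move=> /Oa_sub_U Ux; apply: nU; exact: mem_set.
rewrite -hE -(eq_integ hU) -gu0; apply/esym.
have [Sa [fSa SaTT SaO Sacov]] := region_pieces k0 regOa.
have [Ss [fSs SsTT SsO Sscov]] := region_pieces k0 regOs.
pose S := Ss `|` \bigcup_(l in [set` J]) bond_pieces l.
have Sn T : S T -> Defs.nondegenerate T.
  by move=> [/SsTT/(TT_tetra k0)[]|[l _ /bond_piecesP[]]].
apply: (@weak_derivative_tets R _ _ (fun x => (lam *m w x) 0 0) g S) => //.
- exact: omega_lohi.
- rewrite finite_setU; split=> //; apply: bigcup_finite => //.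
  by move=> l _; exact: finite_bond_pieces.
- by move=> T [/SsO TO|[l _ /bond_piecesP[_ _ TO _]]]; apply: subset_trans TO _;
    [exact: Os_sub_U|exact: Oa_sub_U].
- move=> T [ST|[l lJ PT]].
    have [A [b [fE qE]]] := TT_gradient (SsTT _ ST) (SsO _ ST).
    exists (lam *m A, (lam *m b) 0 0).
      apply: aeLS vm_interpolant_Os => x wx Tx; have TO := SsO _ ST.
      rewrite wx; last exact: TO.
      rewrite -(ybar_interpolant (SsTT _ ST) TO Tx) fE//.
      by rewrite /aff /= mulmxDr mulmxA [LHS]mxE.
    move=> x Tx; have sx := SsO _ ST x Tx; rewrite /h indicE mem_set// mul1r.
    rewrite big1 ?addr0; first by rewrite qE// /= mulmxA.
    move=> l _; rewrite /bond_density [\1_Oa x]indicE memNset ?mul0r ?mulr0//.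
    by move=> ax; exact: disjP ax sx.
  have [A [b [fE qE]]] := bond_gradientE (JP _ lJ) PT.
  have [_ Tb TO _] := bond_piecesP PT.
  exists (lam *m A, (lam *m b) 0 0).
    by apply: aeLW => x Tx; rewrite fE// /aff /= mulmxDr mulmxA [LHS]mxE.
  move=> x Tx; have ax := TO x Tx; rewrite /h indicE memNset ?mul0r ?add0r; last first.
    by move=> sx; exact: disjP ax sx.
  rewrite (bigD1_seq l)//= big1_seq ?addr0; last first.
    move=> l' /andP[ll' l'J]; rewrite indicE memNset ?mul0r// => bx'.
    move/eqP: ll'; apply; apply: (coset_disjoint k0 eta0 (JP _ l'J) (JP _ lJ) bx').
    exact: Tb.
  rewrite indicE mem_set ?mul1r; last exact: Tb.
  by rewrite /bond_density indicE mem_set// mul1r qE// /= mulmxA.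
- apply: aeLS (aeL_and (aeL_and Sacov Sscov) (aeL_and (coset_cover k0 eta0 r) bond_pieces_ae)).
  move=> x [[xa xs] [[l hl bx] xP]] Ux.
  have : Om x by exact: obox_Omega.
  rewrite cover => -[/xa[T ST Tx]|/xs[T ST Tx]]; last by exists T => //; left.
  have ax := SaO _ ST x Tx; have [T' PT' Tx'] := xP l bx ax.
  exists T' => //; right; exists l => //=; apply/hJ; split=> //.
  by have [] := bond_meets_Oa bx ax.
- apply: (@ae_integrable_eq _ h); first by apply: aeLW => x; exact: hU.
  by apply: ae_integrable_eq (ae_integrableD i1 i2); apply: aeLW => x; rewrite /h [in LHS]big_seq.
Qed.

End Covering.

(** ** Summation over the coverings *)

Hypothesis vmH1 : forall r, vm_in_H1 k M Oa Os ybar yint eta r v.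

Local Notation coset := {dffun forall i : 'I_3, 'I_(absz (eta i 0%R))}.
Local Notation norm_eta := (`|\prod_i eta i 0|%:~R : R).

Lemma residue_lt (l : site) i : (absz (l i 0%R %% eta i 0%R)%Z < absz (eta i 0%R))%N.
Proof.
have ei : eta i 0 != 0 by move/prodf_neq0: eta0 => /(_ i isT).
by rewrite -ltz_nat !abszE (ger0_norm (modz_ge0 _ ei)) ltz_mod.
Qed.

Definition coset_of (l : site) : coset := [ffun i => Ordinal (residue_lt l i)].

Definition coset_site (c : coset) : site := \col_i (c i : nat)%:Z.

Lemma coset_ofP (l : site) (c : coset) : (coset_of l == c) <-> in_coset eta (coset_site c) l.
Proof.
have ei i : eta i 0 != 0 by move/prodf_neq0: eta0 => /(_ i isT).
have small i : ((c i : nat)%:Z %% eta i 0%R)%Z = (c i : nat)%:Z.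
  by rewrite -modz_abs modz_small// ltz_nat ltn_ord andbT.
split=> [/eqP <- i|h].
  rewrite mxE ffunE /= -eqz_mod_dvd abszE (ger0_norm (modz_ge0 _ (ei i))).
  by rewrite modz_mod.
apply/eqP/ffunP => i; rewrite ffunE; apply: val_inj => /=.
have := h i; rewrite mxE -eqz_mod_dvd small => /eqP ->.
by [].
Qed.

Lemma card_coset : (#|{: coset}|)%:R = norm_eta.
Proof.
rewrite card_dep_ffun foldrE big_image /= natr_prod normr_prod rmorph_prod /=.
by apply: eq_bigr => i _; rewrite card_ord -abszE.
Qed.

(** Each active bond volume belongs to one covering, while the Cauchy-Born
   region is counted once for each of the coverings. *)
Lemma coverings_identity (J : seq site) : uniq J ->
  (forall l, l \in J <-> active l) ->
  norm_eta * int3 Os cb_density + \sum_(l <- J) int3 (bond l eta) (bond_density l) = 0.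
Proof.
move=> uJ hJ; rewrite (partition_big coset_of xpredT)//= -card_coset mulr_natl.
rewrite -sumr_const -big_split big1//= => c _.
have [w [wP wH]] := vmH1 (coset_site c).
rewrite -big_filter; apply: (coset_identity wP wH); first exact: filter_uniq.
move=> l; rewrite mem_filter; split=> [/andP[/coset_ofP hc /hJ ha]//|[/hJ -> /coset_ofP ->]//].
Qed.

(** ** The derivative of the energy *)

Variable phi : pt -> R.
Hypothesis phi_diff : forall x, differentiable phi x.
Variable F : 'M[R]_3.
Local Notation p := (F *m real_vec eta).
Hypothesis lamE : lam = \row_i 'd phi p (delta_mx i 0).
Local Notation y t := (fun l : site => F *m xl l + t *: v l).

Lemma is_derive_phi (z : pt) :
  is_derive (0 : R) (1 : R) (fun t : R => phi (p + t *: z)) ((lam *m z) 0 0).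
Proof.
have -> : (lam *m z) 0 0 = 'D_z phi (0 *: z + p).
  have zE : z = \sum_i z i 0 *: delta_mx i 0.
    apply/colP => j; rewrite summxE (bigD1 j)//= !mxE !eqxx mulr1 big1 ?addr0//.
    by move=> m mj; rewrite !mxE eq_sym (negbTE mj) mulr0.
  rewrite scale0r add0r deriveE// {2}zE linear_sum mxE lamE.
  by apply: eq_bigr => i _; rewrite linearZ mxE mulrC.
rewrite (_ : (fun t : R => _) = fun t : R => phi (t *: z + p)).
  by apply: is_derive_line; exact: diff_derivable.
by apply/funext => t; rewrite addrC.
Qed.

Lemma deformation_y t : deformation k M (y t).
Proof.
exists F, (fun l => t *: v l); split=> //; have [v1 v2] := Vv; split=> [i l|].
  by rewrite v1.
have fc : finite_set (@period_cell R k M).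
  apply: sub_finite_set (finite_site_box k0 (site_bound k M)) => l hl.
  by apply: (@lat_site_box R) => // i; have /andP[-> /ltW ->] := hl i.
by rewrite fsbig_finite//= -scaler_sumr -fsbig_finite// v2 scaler0.
Qed.

Lemma Dbar_y t l : Dbar k eta (y t) l = p + t *: Dbar k eta v l.
Proof.
have e0 : eps k != 0 :> R by rewrite gt_eqF// eps_gt0.
rewrite /Dbar (_ : _ - _ = F *m (eps k *: real_vec eta) + t *: (v (l + eta) - v l)).
  by rewrite scalerDr -scalemxAr scalerA mulVf// scale1r !scalerA mulrC.
rewrite opprD addrACA -mulmxBr -scalerBr; congr (F *m _ + _); last by rewrite scalerBr.
by apply/colP => i; rewrite !mxE intrD; ring.
Qed.

Lemma lattice_slopes (S : set tet) :
  (forall T, S T -> Defs.nondegenerate T /\ range T `<=` range xl) ->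
  exists z : tet -> pt, forall T, S T -> forall (G : 'M[R]_3) t u f,
    (forall l, u l = G *m xl l + t *: v l) -> affine_interp k u T f ->
    forall x, tetra T x -> 'd f x (real_vec eta) = G *m real_vec eta + t *: z T.
Proof.
move=> hS; have /choice[z hz] : forall T, exists z : pt, S T -> forall (G : 'M[R]_3) t u f,
    (forall l, u l = G *m xl l + t *: v l) -> affine_interp k u T f ->
    forall x, tetra T x -> 'd f x (real_vec eta) = G *m real_vec eta + t *: z.
  move=> T; have [/hS[nT rT]|nST] := pselect (S T); last by exists 0.
  by have [z hz] := lattice_gradient eta v nT rT; exists z.
by exists z.
Qed.

Lemma is_derive_E_cb :
  is_derive (0 : R) (1 : R) (fun t => E_cb Os ybar (fun=> phi) eta (y t)) (int3 Os cb_density).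
Proof.
have [S [fS STT SO Scov]] := region_pieces k0 regOs.
have nS T : S T -> Defs.nondegenerate T by move=> /STT /(TT_tetra k0)[].
have [|z hz] := @lattice_slopes S.
  move=> T ST; split; first exact: nS.
  have [l [s [_ ->]]] := STT _ ST.
  by move=> _ [j _ <-]; rewrite /cell_tet /typeA; eexists.
apply: (@is_derive_int3_pieces R S Os _ _ (fun t T => phi (p + t *: z T))
  (fun T => (lam *m z T) 0 0)) => //.
- move=> T ST x Tx; split=> [t|].
    have [_ /(_ T (STT _ ST) (SO _ ST)) h] := ybarP (deformation_y t).
    by rewrite (hz T ST F t _ _ _ h).
  have [_ /(_ T (STT _ ST) (SO _ ST)) h] := ybarP in_V_deformation.
  rewrite /cb_density (hz T ST 0 1 _ _ _ h) ?mul0mx ?add0r ?scale1r//.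
  by move=> l; rewrite mul0mx add0r scale1r.
- by move=> T ST; exact: is_derive_phi.
- apply: aeLS Scov => x h sx hn; have [T ST Tx] := h (subset_closure sx).
  by have := hn _ ST.
Qed.

Lemma is_derive_interface (l : site) : bond_G l ->
  is_derive (0 : R) (1 : R) (fun t => int3 (bond l eta)
    (fun x => \1_Oa x * phi ('d (yint l eta (y t)) x (real_vec eta))))
  (int3 (bond l eta) (bond_density l)).
Proof.
move=> gl; set S := bond_pieces l.
have [|z hz] := @lattice_slopes S; first by move=> T /bond_piecesP[].
have na : ~ bond_a l by have [] := gl.
have SD T : S T -> D l eta T by move=> [[[]//|[]//]].
have aff_y T u : S T -> deformation k M u -> affine_interp k u T (yint l eta u).
  by move=> /SD DT hu; have [_ /(_ T DT)] := yintP gl hu.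
apply: (@is_derive_int3_pieces R S (bond l eta) _ _ (fun t T => phi (p + t *: z T))
  (fun T => (lam *m z T) 0 0)).
- exact: finite_bond_pieces.
- by move=> T /bond_piecesP[].
- by move=> T /bond_piecesP[].
- move=> T ST x Tx; have [_ _ TO _] := bond_piecesP ST.
  have ax : \1_Oa x = 1 :> R by rewrite indicE mem_set//; exact: TO.
  split=> [t|].
    by rewrite ax mul1r (hz T ST F t _ _ _ (aff_y T _ ST (deformation_y t)) _ Tx).
  rewrite /bond_density ax mul1r /bond_gradient asboolF//.
  rewrite (hz T ST 0 1 _ _ _ (aff_y T _ ST in_V_deformation)) ?mul0mx ?add0r ?scale1r//.
  by move=> m; rewrite mul0mx add0r scale1r.
- by move=> T ST; exact: is_derive_phi.
- apply: aeLS bond_pieces_ae => x h bx hn; rewrite /bond_density indicE.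
  have [/set_mem ax|_] := boolP (x \in Oa); last first.
    by split=> [t|]; rewrite mul0r.
  by have [T PT Tx] := h l bx ax; have := hn _ PT.
Qed.

(** The factor eps^3 is the volume of the bond volume divided by the number of
   coverings. *)
Lemma is_derive_E_atom :
  is_derive (0 : R) (1 : R) (fun t => E_atom k M Oa (fun=> phi) eta (y t))
    (\sum_(l \in [set l | bond_a l]) norm_eta^-1 * int3 (bond l eta) (bond_density l)).
Proof.
have fa := finite_bond_a.
have n0 : norm_eta != 0 by rewrite intr_eq0 normr_eq0.
have aE : [set l | lat l /\ bond_a l] = [set l | bond_a l].
  by apply/seteqP; split=> l => [[]//|ha] /=; split=> //; have [] := bond_a_lat ha.
rewrite fsbig_finite// (_ : (fun t => _) =
    fun t => eps k ^+ 3 * \sum_(l <- fset_set [set l | bond_a l]) phi (p + t *: Dbar k eta v l)).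
  rewrite (_ : \sum_(l <- _) _ = eps k ^+ 3 *
      \sum_(l <- fset_set [set l | bond_a l]) (lam *m Dbar k eta v l) 0 0).
    by apply: is_deriveZ; apply: is_derive_sum_seq => l _; exact: is_derive_phi.
  rewrite mulr_sumr big_seq [RHS]big_seq; apply: eq_bigr => l; rewrite in_fset_set// => /set_mem ha.
  have [_ bO] := bond_a_lat ha.
  rewrite int3E (eq_integ (g := fun x => (lam *m Dbar k eta v l) 0 0 * \1_(bond l eta) x)).
    have [ib Eb] := @integ_bond R k k0 eta l.
    rewrite integZ ?Eb; last exact: integrable3_ae.
    by move: (eps k ^+ 3) norm_eta n0 => a n n0; field.
  move=> x; rewrite /bond_density /bond_gradient asboolT// !indicE.
  have [/set_mem bx|_] := boolP (x \in bond l eta); last by rewrite mul0r mulr0.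
  by rewrite mem_set ?mul1r ?mulr1//; exact: bO.
apply/funext => t; rewrite /E_atom aE fsbig_finite//.
by congr (_ * _); apply: eq_bigr => l _; rewrite Dbar_y.
Qed.

Lemma is_derive_E_interface :
  is_derive (0 : R) (1 : R) (fun t => E_interface k M Oa Os yint (fun=> phi) eta (y t))
    (\sum_(l \in [set l | bond_G l]) norm_eta^-1 * int3 (bond l eta) (bond_density l)).
Proof.
have fG := finite_bond_G.
rewrite fsbig_finite// (_ : (fun t => _) = fun t => \sum_(l <- fset_set [set l | bond_G l])
   norm_eta^-1 * int3 (bond l eta)
    (fun x => \1_Oa x * phi ('d (yint l eta (y t)) x (real_vec eta)))).
  apply: is_derive_sum_seq => l; rewrite in_fset_set// => /set_mem gl.
  by apply: is_deriveZ; exact: is_derive_interface.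
by apply/funext => t; rewrite /E_interface fsbig_finite.
Qed.

Lemma is_derive_energy :
  is_derive (0 : R) (1 : R) (fun t => E_atom k M Oa (fun=> phi) eta (y t) +
    E_cb Os ybar (fun=> phi) eta (y t) +
    E_interface k M Oa Os yint (fun=> phi) eta (y t)) 0.
Proof.
have fa := finite_bond_a.
have fG := finite_bond_G.
have n0 : norm_eta != 0 by rewrite intr_eq0 normr_eq0.
rewrite [X in is_derive _ _ _ X](_ : _ =
    \sum_(l \in [set l | bond_a l]) norm_eta^-1 * int3 (bond l eta) (bond_density l) +
    int3 Os cb_density +
    \sum_(l \in [set l | bond_G l]) norm_eta^-1 * int3 (bond l eta) (bond_density l)).
  exact: (is_deriveD (is_deriveD is_derive_E_atom is_derive_E_cb) is_derive_E_interface).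
apply/esym.
rewrite addrAC -fsbigU0//; last by move=> l [/= ha [_ /(_ ha)]].
rewrite -mulr_fsumr (_ : _ `|` _ = active) //.
have -> : int3 Os cb_density = norm_eta^-1 * (norm_eta * int3 Os cb_density).
  by rewrite mulrA mulVf// mul1r.
rewrite -mulrDr addrC fsbig_finite//; last exact: finite_active.
rewrite coverings_identity ?mulr0//.
  exact: fset_uniq.
by move=> l; rewrite in_fset_set; [rewrite inE|exact: finite_active].
Qed.

End Coupled.

(** * Absence of ghost forces *)

Theorem proposition4p1 (R : realType) (k : nat) (M : 'I_3 -> nat)
    (bonds : {fset site}) (phi : site -> 'cV[R]_3 -> R)
    (Oa Os : set 'cV[R]_3)
    (D : site -> site -> set ('I_4 -> 'cV[R]_3))
    (ybar : (site -> 'cV[R]_3) -> 'cV[R]_3 -> 'cV[R]_3)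
    (yint : site -> site -> (site -> 'cV[R]_3) -> 'cV[R]_3 -> 'cV[R]_3)
    (hk : (0 < k)%N) (hM : forall i, (0 < M i)%N)
    (hbonds : forall eta : site, eta \in bonds -> \prod_i eta i 0 != 0)
    (hphi : forall eta : site, eta \in bonds -> Cn 2 (phi eta))
    (hOa : region k M Oa) (hOs : region k M Os)
    (hOa_conn : connected Oa) (hOs_conn : connected Os)
    (hdisj : Oa `&` Os = set0)
    (hcover : Omega M = closure Oa `|` closure Os)
    (hOa_int : closure Oa `<=` (Omega M)°)
    (hOa_dist : forall eta l : site, eta \in bonds ->
       closure (bond R k l eta) `&` closure Oa !=set0 ->
       closure (bond R k l eta) `<=` (Omega M)°)
    (hybar : forall y, deformation k M y -> is_overline k M Os y (ybar y))
    (hD : forall eta l : site, eta \in bonds -> bond_G k M Oa Os l eta ->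
       admissible_decomposition k M Oa Os D l eta)
    (hyint : forall eta l : site, eta \in bonds -> bond_G k M Oa Os l eta ->
       forall y, deformation k M y ->
       is_bond_interp k D l eta y (yint l eta y))
    (hH1 : forall (eta r : site) (v : site -> 'cV[R]_3), eta \in bonds -> in_V k M v ->
       vm_in_H1 k M Oa Os ybar yint eta r v) :
  forall F : 'M[R]_3, 0 < \det F ->
  forall v, in_V k M v ->
    is_derive (0 : R) (1 : R)
      (fun t : R => E_bv k M Oa Os ybar yint bonds phi
                      (fun l => F *m xl k l + t *: v l)) 0.
Proof.
move=> F _ v Vv.
have eta_diff eta : eta \in bonds -> forall x, differentiable (phi eta) x.
  by move=> /hphi [].
rewrite [X in is_derive _ _ _ X](_ : _ = \sum_(eta <- bonds) (0 : R)); last by rewrite big1.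
apply: is_derive_sum_seq => eta heta.
exact: (is_derive_energy hk hM hOa hOs hdisj hcover hOa_int (hbonds _ heta)
  (fun l => hOa_dist eta l heta) (fun l => hD eta l heta) hybar
  (fun l => hyint eta l heta) Vv (fun r => hH1 eta r v heta Vv)
  (eta_diff _ heta) (F := F) erefl).
Qed.
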